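(* Let $1<p,p'<\infty$ with $p'p=p'+p$, and let $w\ge0$ be a weight function on $[0,\infty)$ in the class $D_p$ such that $\int_0^t w(s)s^{-p}\,ds=\infty$ for all $t>0$. The following statements are equivalent. (i) The Lorentz space $\Gamma_{p,w}$ on $[0,\infty)$ is reflexive. (ii) $W(\infty)=\int_0^\infty w(s)\,ds=\infty$ and $V(\infty)=\int_0^\infty v(s)\,ds=\infty$, where $$v(t)=\frac{t^{p'-1}W(t)W_p(t)}{(W(t)+W_p(t))^{p'+1}}\qquad\text{for } t\in(0,\infty).$$
   Context: Let $L^0$ be the set of (classes of) extended real valued Lebesgue measurable functions on $I=[0,\infty)$. For $x\in L^0$: $d_x(\lambda)=\mu\{s\in I:|x(s)|>\lambda\}$, where $\mu$ is Lebesgue measure, $x^*(t)=\inf\{\lambda>0:d_x(\lambda)\le t\}$, $x^{**}(t)=\frac1t\int_0^t x^*(s)\,ds$. $\Gamma_{p,w}=\{x\in L^0:\|x\|_{\Gamma_{p,w}}=(\int_0^\infty (x^{**}(t))^p w(t)\,dt)^{1/p}<\infty\}$. $W(s)=\int_0^s w(t)\,dt$ and $W_p(s)=s^p\int_s^\infty t^{-p}w(t)\,dt$; the weight $w$ belongs to the class $D_p$ if $W(s)<\infty$ and $W_p(s)<\infty$ for all $0<s<\infty$. A Banach function space $E$ is order continuous if for every $x\in E$ and every sequence of nonnegative $x_n\in E$ with $x_n\le|x|$ and $x_n\to0$ a.e. one has $\|x_n\|_E\to0$; it is reflexive if $E$ and its associate space $E'=\{y\in L^0:\int_I|xy|\,d\mu<\infty\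 \forall x\in E\}$ (with norm $\sup\{\int_I|xy|\,d\mu:\|x\|_E\le1\}$) are both order continuous (for spaces with the Fatou property, such as $\Gamma_{p,w}$, this is the usual reflexivity). *)

(* Defs.v *)
From HB Require Import structures.
From mathcomp Require Import all_boot all_order all_algebra.
From mathcomp Require Import all_classical all_reals all_analysis.
From mathcomp Require Import measurable_realfun.
Set Implicit Arguments.
Unset Strict Implicit.
Unset Printing Implicit Defensive.
Import Order.TTheory GRing.Theory Num.Theory.
Import numFieldNormedType.Exports.
Local Open Scope classical_set_scope.
Local Open Scope ring_scope.
Local Open Scope ereal_scope.

(* The real line with the Lebesgue (not just Borel) sigma-algebra: the one on
   which [completed_lebesgue_measure] is a measure. Its carrier is [R]. *)
Definition lebesgueType (R : realType) : measurableType _ :=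
  caratheodory_type ((wlength (@idfun R))^*)%mu.

Notation leb R := (@completed_lebesgue_measure R).

Definition half_line (R : realType) : set R := `[0%R, +oo[%classic.
Arguments half_line R : clear implicits.

Definition lebesgue_measurable_fun (R : realType) d (U : measurableType d)
    (f : R -> U) : Prop :=
  @measurable_fun _ _ (lebesgueType R) U (half_line R) f.

(* Elements of L^0 are represented by functions; only their values on
   [half_line R] matter, and every notion below that depends on such a function
   is invariant under equality almost everywhere on [half_line R]. *)
Definition L0 (R : realType) : set (R -> \bar R) :=
  [set x : R -> \bar R | lebesgue_measurable_fun x].

Definition distribution_fun (R : realType) (x : R -> \bar R) (l : R) : \bar R :=
  leb R (half_line R `&` [set s | l%:E < `|x s|]).

Definition rearrangement (R : realType) (x : R -> \bar R) (t : R) : \bar R :=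
  ereal_inf [set l%:E | l in [set l : R | (0 < l)%R /\
                                          distribution_fun x l <= t%:E]].

Definition maximal_fun (R : realType) (x : R -> \bar R) (t : R) : \bar R :=
  (t^-1)%:E * \int[leb R]_(s in `[0%R, t]) rearrangement x s.

Definition Gamma_norm (R : realType) (p : R) (w : R -> R) (x : R -> \bar R)
    : \bar R :=
  (\int[leb R]_(t in half_line R) (maximal_fun x t `^ p * (w t)%:E)) `^ p^-1.

Definition Gamma (R : realType) (p : R) (w : R -> R) : set (R -> \bar R) :=
  [set x | L0 x /\ Gamma_norm p w x < +oo].

Definition associate (R : realType) (E : set (R -> \bar R))
    : set (R -> \bar R) :=
  [set y | L0 y /\
    forall x, E x -> \int[leb R]_(s in half_line R) `|x s * y s| < +oo].

Definition associate_norm (R : realType) (E : set (R -> \bar R))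
    (N : (R -> \bar R) -> \bar R) (y : R -> \bar R) : \bar R :=
  ereal_sup [set \int[leb R]_(s in half_line R) `|x s * y s|
            | x in [set x | E x /\ N x <= 1]].

Definition order_continuous (R : realType) (E : set (R -> \bar R))
    (N : (R -> \bar R) -> \bar R) : Prop :=
  forall (x : R -> \bar R) (x_ : nat -> R -> \bar R),
    E x -> (forall n, E (x_ n)) ->
    (forall n, \forall s \ae leb R, half_line R s -> 0 <= x_ n s <= `|x s|) ->
    (\forall s \ae leb R, half_line R s -> x_ n s @[n --> \oo] --> 0) ->
    N (x_ n) @[n --> \oo] --> 0.

(* Lattice form of reflexivity: for a Banach function space with the Fatou
   property it agrees with reflexivity as a Banach space. *)
Definition reflexive_space (R : realType) (E : set (R -> \bar R))
    (N : (R -> \bar R) -> \bar R) : Prop :=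
  order_continuous E N /\
  order_continuous (associate E) (associate_norm E N).

Definition weight (R : realType) (w : R -> R) : Prop :=
  lebesgue_measurable_fun w /\
  (forall t : R, half_line R t -> (0 <= w t)%R).

Definition W (R : realType) (w : R -> R) (s : R) : \bar R :=
  \int[leb R]_(t in `[0%R, s]) (w t)%:E.

Definition Wp (R : realType) (p : R) (w : R -> R) (s : R) : \bar R :=
  (s `^ p)%:E * \int[leb R]_(t in `[s, +oo[) (t `^ (- p) * w t)%:E.

Definition class_D (R : realType) (p : R) (w : R -> R) : Prop :=
  forall s : R, (0 < s)%R -> W w s < +oo /\ Wp p w s < +oo.

(* [fine] loses nothing for [0 < t] when [w] is a weight of class [class_D p]. *)
Definition dual_weight (R : realType) (p p' : R) (w : R -> R) (t : R) : R :=
  (t `^ (p' - 1) * fine (W w t) * fine (Wp p w t)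
   / (fine (W w t) + fine (Wp p w t)) `^ (p' + 1))%R.

(* Main.v *)
(* Put [K x t = inf_l (l t + int (|x| - l)^+) = t x^**(t)], which is sublinear
   in [x]; the norm of Gamma_{p,w} is the L^p norm of [K x] for the measure
   [t^-p w(t) dt], of infinite mass near 0.

   If W(oo) < oo, the constant 1 and the indicators of [[n, oo[] belong to
   Gamma_{p,w} and have the same norm, so Gamma_{p,w} is not order continuous.
   If W(oo) = oo, then [K x t = o(t)] for every [x] in Gamma_{p,w}, so [K x_n]
   tends to 0 pointwise whenever [0 <= x_n <= |x|] and [x_n --> 0] a.e., and
   dominated convergence gives order continuity.

   The associate space is always order continuous. Otherwise some [y] in it
   pairs uniformly with normalized [z_k] of disjoint supports; choosing the
   [z_k] nearly norm-minimal, uniform convexity of L^p makes all the [K z_k]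
   close to each other, hence averages of the [z_k] are small in norm although
   their pairings with [y] are not.

   Finally W(oo) = oo implies V(oo) = oo. Let [U = W + W_p] and [a = W / U].
   Then [U(2t) <= U(t) (1 + C (1 - a(t)))] and [t^p / U(t)] grows at most by
   the factor [1 + C a(2t)] from [t] to [2t]; both are unbounded, so along the
   dyadic points [a] cannot settle near 0 or near 1, while the integral of [v]
   over []t, 2t]] is at least a constant times [a(t) (1 - a(2t))]. *)
Require Import Defs.
From HB Require Import structures.
From mathcomp Require Import all_boot all_order all_algebra.
From mathcomp Require Import all_classical all_reals all_analysis.
From mathcomp Require Import measurable_realfun.
From mathcomp Require Import ring lra.
Import Order.TTheory GRing.Theory Num.Theory.
Import numFieldNormedType.Exports.
Local Open Scope classical_set_scope.
Local Open Scope ring_scope.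
Set Implicit Arguments.
Unset Strict Implicit.
Unset Printing Implicit Defensive.

(** No description of the associate space is used: its norm is a supremum of pairings over the unit
    ball of Gamma_{p,w}, which is also the unit ball of the modular, so Minkowski's inequality never
    enters. Convexity is applied in L^p to the functions K z_k, not in Gamma_{p,w}. Closeness of the
    K z_k says nothing about the z_k, which have disjoint supports, and the contrast is the point.
    On the one hand, the average of z_0, ..., z_n has a K-functional below the mean of nearly equal
    functions, so up to a small error K z_0 is a majorant for dominated convergence. On the other
    hand, truncating this average at level l amounts to truncating each z_k at level (n+1) l, so its
    K-functional tends to 0 at each t, provided that high truncations are small uniformly on the
    unit ball. The infinite mass near 0 provides this uniformity. With finite mass there, peaks of
    bounded integral on ever smaller sets would stay bounded in norm, as in L^1. *)

(** * Uniform convexity of powers *)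

(* From [exp y >= 1 + y] and [ln x >= 1 - 1/x] with [x = sqrt A]: the excess of
   [A `^ p] over its tangent at 1 controls the distance of [A] to 1. *)
Lemma powR_tangent (R : realType) (p A : R) : (1 : R) < p -> 0 <= A ->
  1 + p * (A - 1) + (p - 1) * (Num.sqrt A - 1) ^+ 2 <= A `^ p.
Proof.
move=> p_gt1; have p_gt0 : 0 < p by lra.
have p1_gt0 : 0 < p - 1 by lra.
have p_ge0 := ltW p_gt0; have p1_ge0 := ltW p1_gt0.
rewrite le_eqVlt => /predU1P[<-|A0].
  by rewrite sqrtr0 powR0 ?gt_eqF ?p_gt0//; lra.
have [s s0 [-> As]] : exists2 s : R, 0 < s & Num.sqrt A = s /\ A = s ^+ 2.
  by exists (Num.sqrt A); rewrite ?sqrtr_gt0// sqr_sqrtr// ltW.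
have lns : ln s >= 1 - s^-1.
  have si0 : 0 < s^-1 by rewrite invr_gt0.
  have := @le_ln1Dx R (s^-1 - 1) ltac:(lra).
  have -> : 1 + (s^-1 - 1) = s^-1 by ring.
  by rewrite lnV ?posrE//; lra.
have lnA : ln A = 2 * ln s by rewrite As lnXn// mulr_natl.
have -> : A `^ p = A * A `^ (p - 1) by rewrite mulr_powRB1 ?ltW// p_gt0.
have h : 1 + (p - 1) * ln A <= A `^ (p - 1).
  by rewrite /powR gt_eqF//; exact: expR_ge1Dx.
have {}h : 1 + (p - 1) * (2 * (1 - s^-1)) <= A `^ (p - 1).
  apply: le_trans h; rewrite lerD2l lnA ler_wpM2l//; lra.
have -> : 1 + p * (A - 1) + (p - 1) * (s - 1) ^+ 2 = A * (1 + (p - 1) * (2 * (1 - s^-1))).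
  by rewrite As; field; exact: lt0r_neq0.
by rewrite ler_wpM2l// ltW.
Qed.

(** The tangent of x^p at [m], obtained from [powR_tangent] at [a / m]. Summed over values [a] of
    mean [m], it yields Jensen's inequality. *)
Lemma powR_young (R : realType) (p a m : R) : (1 : R) < p -> 0 <= a -> 0 <= m ->
  p * m `^ (p - 1) * a <= a `^ p + (p - 1) * m `^ p.
Proof.
move=> p_gt1; have p_gt0 : 0 < p by lra.
have p1_gt0 : 0 < p - 1 by lra.
have p_ge0 := ltW p_gt0; have p1_ge0 := ltW p1_gt0.
move=> a0; rewrite le_eqVlt => /predU1P[<-|m0].
  rewrite powR0 ?gt_eqF ?subr_gt0// powR0 ?gt_eqF ?p_gt0//.
  by rewrite !mulr0 mul0r addr0 powR_ge0.
have am0 : 0 <= a / m by rewrite divr_ge0// ltW.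
have h : 1 + p * (a / m - 1) <= (a / m) `^ p.
  apply: le_trans (powR_tangent p_gt1 am0).
  by rewrite lerDl mulr_ge0 ?sqr_ge0//; lra.
have -> : a `^ p = (a / m) `^ p * m `^ p.
  by rewrite -(powRM p am0 (ltW m0)) divfK ?gt_eqF.
have mE : m `^ p = m * m `^ (p - 1) by rewrite mulr_powRB1 ?ltW// p_gt0.
rewrite -subr_ge0.
have -> : (a / m) `^ p * m `^ p + (p - 1) * m `^ p - p * m `^ (p - 1) * a =
    m `^ p * ((a / m) `^ p - (1 + p * (a / m - 1))).
  by rewrite mE; field; exact: lt0r_neq0.
by rewrite mulr_ge0 ?powR_ge0 // subr_ge0.
Qed.

Lemma powRD_le (R : realType) (p a b : R) : (1 : R) < p -> 0 <= a -> 0 <= b ->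
  (a + b) `^ p <= 2 `^ p * (a `^ p + b `^ p).
Proof.
move=> p_gt1; have p_gt0 : 0 < p by lra.
have p1_gt0 : 0 < p - 1 by lra.
have p_ge0 := ltW p_gt0; have p1_ge0 := ltW p1_gt0.
have p0 := p_ge0.
wlog ab : a b / a <= b.
  move=> h a0 b0; have [ab|/ltW ba] := leP a b; first exact: h.
  by rewrite addrC [X in _ <= _ * X]addrC; exact: h.
move=> a0 b0; apply: (@le_trans _ _ ((2 * b) `^ p)).
  by apply: ge0_ler_powR; rewrite ?nnegrE//; lra.
by rewrite powRM// ler_wpM2l ?powR_ge0// lerDr powR_ge0.
Qed.

(** Averaging [powR_young] at the mean [m] gives p m^p on the left and (p - 1) m^p plus the mean of
    the powers on the right. *)
Lemma powR_mean_le (R : realType) (p : R) (e : nat -> R) n : (1 : R) < p -> (forall k, 0 <=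
  e k) ->
  (n.+1%:R^-1 * \sum_(k < n.+1) e k) `^ p <=
  n.+1%:R^-1 * \sum_(k < n.+1) e k `^ p.
Proof.
move=> p_gt1; have p_gt0 : 0 < p by lra.
have p1_gt0 : 0 < p - 1 by lra.
have p_ge0 := ltW p_gt0; have p1_ge0 := ltW p1_gt0.
move=> e0; set m := _^-1 * _; set c := n.+1%:R^-1 in m *.
have c0 : 0 < c by rewrite invr_gt0.
have m0 : 0 <= m by rewrite mulr_ge0 ?sumr_ge0// ltW.
have h : \sum_(k < n.+1) (p * m `^ (p - 1) * e k) <=
         \sum_(k < n.+1) (e k `^ p + (p - 1) * m `^ p).
  by apply: ler_sum => k _; exact: powR_young.
move: h; rewrite -mulr_sumr big_split/= sumr_const card_ord -mulr_natr => h.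
have : c * (p * m `^ (p - 1) * \sum_(i < n.+1) e i) <= c * (\sum_(i < n.+1) e i `^ p + (p -
  1) * m `^ p * n.+1%:R).
  by rewrite ler_wpM2l// ltW.
rewrite mulrDr.
have -> : c * ((p - 1) * m `^ p * n.+1%:R) = (p - 1) * m `^ p.
  by rewrite mulrCA mulVf ?mulr1// pnatr_eq0.
have -> : c * (p * m `^ (p - 1) * \sum_(i < n.+1) e i) = p * (m * m `^ (p - 1)).
  by rewrite /m; ring.
rewrite mulr_powRB1//; lra.
Qed.

(** Chosen so that the convexity gain (p - 1) u^2 / 6, multiplied by this constant over h^2, is
    exactly 2^p (u / h)^2. *)
Definition uconv_const (R : realType) (p : R) : R := 6 * 2 `^ p / (p - 1).

Lemma uconv_const_ge0 (R : realType) (p : R) : (1 : R) < p -> 0 <= uconv_const p.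
Proof. by move=> p_gt1; rewrite divr_ge0 ?mulr_ge0 ?powR_ge0//; lra. Qed.

(** Write a = m (1 + u) and b = m (1 - u). The tangents at 1 show that a^p + b^p exceeds 2 m^p by
    m^p (p - 1) u^2 / 6. If u <= h, the difference is absorbed by the term with h^p; if u > h, by
    this gain. The bound is linear in the p-th powers, so it can be integrated as it stands, with
    [h] free. *)
Lemma powR_uniform_convexity (R : realType) (p a b h : R) : (1 : R) < p -> 0 <= a -> 0 <= b
  -> 0 < h ->
  `|a - b| `^ p + 2 * (uconv_const p / h ^+ 2) * ((a + b) / 2) `^ p <=
  (h `^ p * 2 `^ p + uconv_const p / h ^+ 2) * (a `^ p + b `^ p).
Proof.
move=> p_gt1; have p_gt0 : 0 < p by lra.
have p1_gt0 : 0 < p - 1 by lra.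
have p_ge0 := ltW p_gt0; have p1_ge0 := ltW p1_gt0.
have p0 := p_ge0.
wlog ba : a b / b <= a.
  move=> H a0 b0 h0; have [ba|/ltW ab] := leP b a; first exact: H.
  by have := H b a ab b0 a0 h0; rewrite distrC [b + a]addrC [b `^ p + _]addrC.
move=> a0 b0 h0.
have [m mE] : exists m, m = (a + b) / 2 by eexists.
rewrite -mE; set C := uconv_const p; set X := a `^ p + b `^ p.
have X0 : 0 <= X by rewrite addr_ge0 ?powR_ge0.
have h20 : 0 < h ^+ 2 by rewrite exprn_gt0.
have C0 : 0 <= C := uconv_const_ge0 p_gt1.
have Ch0 : 0 <= C / h ^+ 2 by rewrite divr_ge0// ltW.
have [m0|m0] := leP m 0.
  have -> : a = 0 by lra.
  have -> : b = 0 by lra.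
  rewrite subr0 normr0.
  have pn0 : p != 0 by rewrite gt_eqF//; lra.
  rewrite powR0// add0r.
  have -> : m = 0 by lra.
  by rewrite powR0// mulr0 mulr_ge0// addr_ge0// mulr_ge0 ?powR_ge0.
have [u uE] : exists u, u = (a - b) / (2 * m) by eexists.
have m20 : 0 < 2 * m by rewrite mulr_gt0.
have abE : a - b = 2 * m * u by rewrite uE; field; exact: lt0r_neq0.
have u0 : 0 <= u by rewrite uE; apply: divr_ge0 => //; rewrite ?subr_ge0// ltW.
have u1 : u <= 1 by rewrite uE ler_pdivrMr// mE; lra.
have aE : a = m * (1 + u) by lra.
have bE : b = m * (1 - u) by lra.
have mX : m `^ p * (2 + (p - 1) * (u ^+ 2 / 6)) <= X.
  rewrite /X {1}aE {1}bE !powRM; try lra.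
  rewrite -mulrDr ler_wpM2l ?powR_ge0//.
  have h1 := @powR_tangent R p (1 + u) p_gt1 ltac:(lra).
  have h2 := @powR_tangent R p (1 - u) p_gt1 ltac:(lra).
  have s0 : 0 <= (Num.sqrt (1 - u) - 1) ^+ 2 by exact: sqr_ge0.
  have s1 : u ^+ 2 / 6 <= (Num.sqrt (1 + u) - 1) ^+ 2.
    have [s s0' [-> sE]] : exists2 s : R, 0 <= s & Num.sqrt (1 + u) = s /\ s ^+ 2 = 1 + u.
      by exists (Num.sqrt (1 + u)); rewrite ?sqrtr_ge0// sqr_sqrtr//; lra.
    (* The bound 1.42 is just above the square root of 2 and still gives (s + 1)^2 <= 6, the origin
       of the constant 6. *)
    have s3 : s <= 7 / 5 + 1/50 by nra.
    have -> : u = (s - 1) * (s + 1) by rewrite -subr_sqr sE; lra.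
    rewrite exprMn ler_pdivrMr// ler_wpM2l ?sqr_ge0//.
    by nra.
  have : (p - 1) * (u ^+ 2 / 6) <= (p - 1) * (Num.sqrt (1 + u) - 1) ^+ 2.
    by rewrite ler_wpM2l//; lra.
  have : 0 <= (p - 1) * (Num.sqrt (1 - u) - 1) ^+ 2 by rewrite mulr_ge0//; lra.
  by move: h1 h2; lra.
have dE : `|a - b| `^ p = (2 * m) `^ p * u `^ p.
  rewrite -(powRM p (ltW m20) u0).
  by rewrite ger0_norm ?subr_ge0// abE.
have mp0 : 0 <= m `^ p by exact: powR_ge0.
have [q qE] : exists q, q = (p - 1) * (u ^+ 2 / 6) by eexists.
have q0 : 0 <= q by rewrite qE mulr_ge0// divr_ge0 ?sqr_ge0.
rewrite -qE in mX.
have [D DE] : exists D, D = C / h ^+ 2 by eexists.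
rewrite -DE in Ch0 *.
have Dm0 : 0 <= D * (m `^ p * q) by rewrite !mulr_ge0.
have hX0 : 0 <= h `^ p * 2 `^ p * X by rewrite !mulr_ge0 ?powR_ge0.
have key : D * (2 * m `^ p) + D * (m `^ p * q) <= D * X.
  by rewrite -mulrDr; apply: ler_wpM2l => //; lra.
have m2X : 2 * m `^ p <= X.
  have : 0 <= m `^ p * q by rewrite mulr_ge0.
  by move: mX; lra.
suff : `|a - b| `^ p <= h `^ p * 2 `^ p * X + D * (m `^ p * q).
  by move: key; lra.
rewrite dE (powRM p (ler0n _ 2) (ltW m0)).
have [uh|hu] := leP u h.
  apply: (@le_trans _ _ (h `^ p * 2 `^ p * X)); last by rewrite lerDl.
  have uph : u `^ p <= h `^ p by apply: ge0_ler_powR; rewrite ?nnegrE// ltW.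
  have -> : 2 `^ p * m `^ p * u `^ p = u `^ p * 2 `^ p * m `^ p by ring.
  apply: ler_pM => //; rewrite ?mulr_ge0 ?powR_ge0//.
    by rewrite ler_wpM2r ?powR_ge0.
  by lra.
apply: (@le_trans _ _ (D * (m `^ p * q))); last by rewrite lerDr.
have -> : D * (m `^ p * q) = 2 `^ p * m `^ p * (u / h) ^+ 2.
  by rewrite qE DE /C /uconv_const; field; rewrite !gt_eqF.
apply: ler_wpM2l; first by rewrite mulr_ge0 ?powR_ge0.
apply: (@le_trans _ _ 1).
  by have := @ge0_ler_powR _ p p_ge0 u 1; rewrite powR1; apply; rewrite ?nnegrE.
by rewrite exprn_ege1// ler_pdivlMr// mul1r ltW.
Qed.

(** * Crossing sums *)

Lemma growth_expR (R : realType) (u c : nat -> R) n :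
  (forall k, 0 <= u k) -> (forall k, u k.+1 <= u k * (1 + c k)) ->
  u n <= u 0 * expR (\sum_(k < n) c k).
Proof.
move=> u0 uS; elim: n => [|n IH]; first by rewrite big_ord0 expR0 mulr1.
rewrite big_ord_recr/= expRD mulrA; apply: (le_trans (uS n)).
apply: (@le_trans _ _ (u n * expR (c n))); first by rewrite ler_wpM2l// expR_ge1Dx.
by rewrite ler_wpM2r// expR_ge0.
Qed.

Lemma nonneg_series_small_tail (R : realType) (f : nat -> R) B :
  (forall k, 0 <= f k) -> (forall n, \sum_(k < n) f k <= B) ->
  forall e, 0 < e -> exists K, forall n, \sum_(k < n) f (K + k)%N < e.
Proof.
move=> f0 fB e e0; pose s n := \sum_(k < n) f k.
have hs : has_sup (range s).
  by split; [exists (s 0), 0%N|exists B => _ [n _ <-]; exact: fB].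
have [_ [K _ <-] sK] := sup_adherent e0 hs.
exists K => n.
have : s (K + n)%N <= sup (range s) by apply: sup_upper_bound => //; exists (K + n)%N.
rewrite {1}/s big_split_ord/= -/(s K).
by move: sK; lra.
Qed.

(* If the sum of [a k * (1 - a k.+1)] were finite, [a] would eventually stay on
   one side of 1/2, so that [1 - a] or [a] would be summable and [U] or [g]
   bounded. *)
Lemma unbounded_crossing_sum (R : realType) (a U g : nat -> R) (C : R) :
  (forall k, 0 <= a k <= 1) -> 0 <= C ->
  (forall k, 0 <= U k) -> (forall k, 0 <= g k) ->
  {homo U : m n / (m <= n)%N >-> m <= n} ->
  {homo g : m n / (m <= n)%N >-> m <= n} ->
  (forall k, U k.+1 <= U k * (1 + C * (1 - a k))) ->
  (forall k, g k.+1 <= g k * (1 + C * a k.+1)) ->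
  (forall M, exists k, M < U k) -> (forall M, exists k, M < g k) ->
  forall B, exists n, B < \sum_(k < n) a k * (1 - a k.+1).
Proof.
move=> a01 C0 U0 g0 ndU ndg US gS Uoo goo B; apply: contrapT => nB.
have a0 k : 0 <= a k by case/andP: (a01 k).
have a1 k : 0 <= 1 - a k by rewrite subr_ge0; case/andP: (a01 k).
pose f k := a k * (1 - a k.+1).
have f0 k : 0 <= f k by rewrite mulr_ge0.
have fB n : \sum_(k < n) f k <= B.
  by rewrite leNgt; apply/negP => h; apply: nB; exists n.
have q0 : 0 < (1 / 4 : R) by lra.
have [K tail] := nonneg_series_small_tail f0 fB q0.
have fK k : f (K + k)%N < 1 / 4.
  apply: le_lt_trans (tail k.+1); rewrite big_ord_recr/= lerDr.
  by apply: sumr_ge0 => i _.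
(* Discrete Gronwall: growth factors with summable excess over 1, from index [K'] on, keep [u]
   bounded. *)
have bounded (u c : nat -> R) K' : (forall k, 0 <= u k) ->
    {homo u : m n / (m <= n)%N >-> m <= n} ->
    (forall k, u (K' + k).+1 <= u (K' + k)%N * (1 + c k)) ->
    (forall n, \sum_(k < n) c k <= 2 * C * B) -> ~ forall M, exists k, M < u k.
  move=> u0 ndu uS cB /(_ (u K' * expR (2 * C * B)))[k].
  apply/negP; rewrite -leNgt.
  have [kK|/ltnW Kk] := leqP k K'.
    apply: (le_trans (ndu _ _ kK)); rewrite ler_peMr// -[leLHS]expR0 ler_expR.
    by have := cB 0%N; rewrite big_ord0.
  rewrite -(subnKC Kk).
  have := @growth_expR _ (fun j => u (K' + j)%N) c (k - K') (fun=> u0 _).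
  rewrite addn0 => /(_ _)/le_trans; apply; first by move=> j; rewrite addnS.
  by rewrite ler_wpM2l// ler_expR.
have sumf j n : \sum_(k < n) f (j + k)%N <= B.
  apply: le_trans (fB (j + n)%N); rewrite big_split_ord/= lerDr.
  by apply: sumr_ge0 => i _.
have [[k0 ak0]|allK] := pselect (exists k, 1 / 2 <= a (K + k)%N).
  (* The threshold 1/4 is used here: when a k >= 1/2, a term below 1/4 forces 1 - a (k + 1) < 1/2,
     so [a] never falls below 1/2 again. *)
  have ak k : 1 / 2 <= a (K + k0 + k)%N.
    elim: k => [|k IH]; first by rewrite addn0.
    have := fK (k0 + k)%N; rewrite /f addnA addnS.
    by have := a1 (K + k0 + k).+1; nra.
  (* The growth of [U] at an index involves 1 - a at that index, which occurs in [f] one index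
     earlier; hence the start at the successor. The other factor of [f] is at least 1/2, whence the
     factor 2. *)
  apply: (bounded U (fun k => C * (1 - a (K + k0 + k).+1)) (K + k0).+1) => // n.
  apply: (@le_trans _ _ (2 * C * \sum_(k < n) f (K + k0 + k)%N)).
    rewrite mulr_sumr; apply: ler_sum => k _.
    rewrite [2 * C]mulrC -mulrA ler_wpM2l// /f mulrA.
    by have := ak k; have := a1 (K + k0 + k).+1; nra.
  by rewrite ler_wpM2l ?sumf// mulr_ge0.
have ak k : a (K + k)%N < 1 / 2.
  by rewrite ltNge; apply/negP => ?; apply: allK; exists k.
apply: (bounded g (fun k => C * a (K + k).+1) K) => // n.
apply: (@le_trans _ _ (2 * C * \sum_(k < n) f (K.+1 + k)%N)).
  rewrite mulr_sumr; apply: ler_sum => k _.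
  rewrite [2 * C]mulrC -mulrA ler_wpM2l// /f mulrA addSn.
  by have := ak k.+2; have := a0 (K + k).+1; rewrite !addnS; nra.
by rewrite ler_wpM2l ?sumf// mulr_ge0.
Qed.

Local Open Scope ereal_scope.

(** * Truncation and the K-functional *)

Section Excess.
Context {d} {T : measurableType d} {R : realType}.
Implicit Types (f g h : T -> \bar R) (c l : R) (s : T).

Definition excess f l s : \bar R := maxe (`|f s| - l%:E) 0.

Lemma excess_ge0 f l s : 0 <= excess f l s.
Proof. by rewrite /excess le_max lexx orbT. Qed.

Lemma le_excess f g l l' s : `|f s| <= `|g s| -> (l' <= l)%R ->
  excess f l s <= excess g l' s.
Proof.
move=> fg ll; rewrite /excess ge_max !le_max lexx orbT andbT.
by rewrite leeB.
Qed.

Lemma abse_le_excess f l s : `|f s| <= excess f l s + l%:E.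
Proof. by rewrite /excess -leeBlDr// le_max lexx. Qed.

(** With [abse_le_excess], this characterizes the excess as the least nonnegative [x] with |f s| <=
    x + l; later bounds use it instead of case analysis on the maximum. *)
Lemma excess_leP f l s x : 0 <= x -> `|f s| <= x + l%:E -> excess f l s <= x.
Proof. by move=> x0 fx; rewrite /excess ge_max x0 andbT leeBlDr. Qed.

Lemma excessD f g h l l' s : `|f s| <= `|g s| + `|h s| ->
  excess f (l + l') s <= excess g l s + excess h l' s.
Proof.
move=> fgh; apply: excess_leP; first by rewrite adde_ge0 ?excess_ge0.
apply: (le_trans fgh); rewrite EFinD addeACA.
by apply: leeD; exact: abse_le_excess.
Qed.

Lemma excessZ f g c l s : (0 <= c)%R -> `|f s| <= c%:E * `|g s| ->
  excess f (c * l) s <= c%:E * excess g l s.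
Proof.
move=> c0 fg; apply: excess_leP; first by rewrite mule_ge0 ?excess_ge0.
apply: (le_trans fg); rewrite EFinM -muleDr ?fin_num_adde_defl//.
by rewrite lee_wpmul2l// ?lee_fin// abse_le_excess.
Qed.

Lemma measurable_excess (D : set T) f l : measurable_fun D f ->
  measurable_fun D (excess f l).
Proof.
move=> mf; apply: measurable_maxe => //.
apply: emeasurable_funB => //.
by apply: measurableT_comp.
Qed.

End Excess.

Section Kfunctional.
Context {d} {T : measurableType d} {R : realType}.
Variables (mu : {measure set T -> \bar R}) (D : set T).
Hypothesis mD : measurable D.
Implicit Types (f g h : T -> \bar R) (c l t u : R).

(* Peetre's K-functional of the pair (L^1, L^infty): [Kfun f t] is
   [t * f^** t], and subadditivity in [f] is visible in this form. *)
Definition Kfun f t : \bar R :=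
  ereal_inf [set (l * t)%:E + \int[mu]_(s in D) excess f l s | l in [set l | (0 <= l)%R]].

Lemma integral_excess_ge0 f l : 0 <= \int[mu]_(s in D) excess f l s.
Proof. by apply: integral_ge0 => s _; exact: excess_ge0. Qed.

Lemma Kfun_le f t l : (0 <= l)%R ->
  Kfun f t <= (l * t)%:E + \int[mu]_(s in D) excess f l s.
Proof. by move=> l0; apply: ereal_inf_lbound; exists l. Qed.

Lemma Kfun_lt f t x : Kfun f t < x ->
  exists2 l, (0 <= l)%R & (l * t)%:E + \int[mu]_(s in D) excess f l s < x.
Proof. by move=> /ereal_inf_lt[_ [l l0 <-]]; exists l. Qed.

Lemma le_KfunP x f t :
  (forall l, (0 <= l)%R -> x <= (l * t)%:E + \int[mu]_(s in D) excess f l s) ->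
  x <= Kfun f t.
Proof. by move=> h; apply: le_ereal_inf_tmp => _ [l l0 <-]; exact: h. Qed.

Lemma Kfun_ge0 f t : (0 <= t)%R -> 0 <= Kfun f t.
Proof.
move=> t0; apply: le_KfunP => l l0.
by rewrite adde_ge0 ?integral_excess_ge0// lee_fin mulr_ge0.
Qed.

Lemma le_Kfun f g t : measurable_fun D f -> measurable_fun D g ->
  (forall s, D s -> `|f s| <= `|g s|) -> Kfun f t <= Kfun g t.
Proof.
move=> mf mg fg; apply: le_KfunP => l l0; apply: (le_trans (Kfun_le _ _ l0)).
rewrite leeD2l//; apply: ge0_le_integral => //; first by move=> *; exact: excess_ge0.
- exact: measurable_excess.
- exact: measurable_excess.
- by move=> s Ds; apply: le_excess => //; exact: fg.
Qed.

Lemma ae_le_Kfun f g t : measurable_fun D f -> measurable_fun D g ->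
  (\forall s \ae mu, D s -> `|f s| <= `|g s|) -> Kfun f t <= Kfun g t.
Proof.
move=> mf mg fg; apply: le_KfunP => l l0; apply: (le_trans (Kfun_le _ _ l0)).
rewrite leeD2l//; apply: ae_ge0_le_integral => //.
- by move=> *; exact: excess_ge0.
- exact: measurable_excess.
- by move=> *; exact: excess_ge0.
- exact: measurable_excess.
- by apply: filterS fg => s fg Ds; apply: le_excess => //; exact: fg.
Qed.

Lemma Kfun_nd f t u : (t <= u)%R -> Kfun f t <= Kfun f u.
Proof.
move=> tu; apply: le_KfunP => l l0; apply: (le_trans (Kfun_le _ _ l0)).
by rewrite leeD2r// lee_fin ler_wpM2l.
Qed.

(** Each competitor in the infimum is affine in [t] with a nonnegative intercept, so its quotient by
    [t] is nonincreasing. *)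
Lemma Kfun_ratio f t u : (0 < t)%R -> (t <= u)%R ->
  t%:E * Kfun f u <= u%:E * Kfun f t.
Proof.
move=> t0 tu; have u0 : (0 < u)%R by apply: lt_le_trans tu.
rewrite -lee_pdivrMl//; apply: le_KfunP => l l0.
rewrite lee_pdivrMl//.
apply: (@le_trans _ _ (t%:E * ((l * u)%:E + \int[mu]_(s in D) excess f l s))).
  by rewrite lee_pmul2l// Kfun_le.
have := integral_excess_ge0 f l; move: (integral _ _ _) => I I0.
rewrite (@ge0_muleDr _ t%:E) ?(@ge0_muleDr _ u%:E) ?lee_fin ?mulr_ge0 ?(ltW t0) ?(ltW u0)//.
apply: leeD; first by rewrite -!EFinM lee_fin mulrCA [leRHS]mulrCA [(u * t)%R]mulrC.
by apply: lee_wpmul2r => //; rewrite lee_fin.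
Qed.

(** Near-optimal levels for [g] and [h] are added to give a level for [f]; [excessD] then splits the
    excess. *)
Lemma KfunD f g h t : measurable_fun D f -> measurable_fun D g ->
  measurable_fun D h -> (0 <= t)%R ->
  (forall s, D s -> `|f s| <= `|g s| + `|h s|) ->
  Kfun f t <= Kfun g t + Kfun h t.
Proof.
move=> mf mg mh t0 fgh.
have [->|gy] := eqVneq (Kfun g t) +oo.
  by rewrite addye ?leey// gt_eqF// (lt_le_trans _ (Kfun_ge0 _ t0)).
have [->|hy] := eqVneq (Kfun h t) +oo.
  by rewrite addey ?leey// gt_eqF// (lt_le_trans _ (Kfun_ge0 _ t0)).
have gfin : Kfun g t \is a fin_num by rewrite ge0_fin_numE ?Kfun_ge0// ltey.
have hfin : Kfun h t \is a fin_num by rewrite ge0_fin_numE ?Kfun_ge0// ltey.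
apply/lee_addgt0Pr => e e0; have e20 : (0 < e / 2)%R by rewrite divr_gt0.
have [|l l0 gl] := @Kfun_lt g t (Kfun g t + (e / 2)%:E); first by rewrite lteDl.
have [|l' l'0 hl] := @Kfun_lt h t (Kfun h t + (e / 2)%:E); first by rewrite lteDl.
have ll0 : (0 <= l + l')%R by rewrite addr_ge0.
apply: (le_trans (Kfun_le _ _ ll0)).
rewrite [e]splitr EFinD addeACA; apply: le_trans (leeD (ltW gl) (ltW hl)).
rewrite addeACA mulrDl EFinD leeD2l// -ge0_integralD//; last 4 first.
- by move=> *; exact: excess_ge0.
- exact: measurable_excess.
- by move=> *; exact: excess_ge0.
- exact: measurable_excess.
apply: ge0_le_integral => //.
- by move=> *; exact: excess_ge0.
- exact: measurable_excess.
- by apply: emeasurable_funD; exact: measurable_excess.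
- by move=> s Ds; apply: excessD; exact: fgh.
Qed.

Lemma KfunZ f g c t : measurable_fun D f -> measurable_fun D g -> (0 < c)%R ->
  (forall s, D s -> `|f s| <= c%:E * `|g s|) ->
  Kfun f t <= c%:E * Kfun g t.
Proof.
move=> mf mg c0 fg; rewrite -lee_pdivrMl//; apply: le_KfunP => l l0.
rewrite lee_pdivrMl//.
have cl0 : (0 <= c * l)%R by rewrite mulr_ge0// ltW.
apply: (le_trans (Kfun_le _ _ cl0)).
rewrite muleDr//.
rewrite -EFinM mulrA leeD2l//.
rewrite -ge0_integralZl_EFin ?(ltW c0)//; last 2 first.
- by move=> *; exact: excess_ge0.
- exact: measurable_excess.
apply: ge0_le_integral => //.
- by move=> *; exact: excess_ge0.
- exact: measurable_excess.
- by apply: measurable_funeM; exact: measurable_excess.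
- by move=> s Ds; apply: excessZ; [exact: ltW|exact: fg].
Qed.

End Kfunctional.

Section KfunctionalSeries.
Context {d} {T : measurableType d} {R : realType}.
Variables (mu : {measure set T -> \bar R}) (D : set T).
Hypothesis mD : measurable D.
Implicit Types (c : nat -> R) (l t u : R) (f : nat -> T -> \bar R).

Lemma measurable_nneseries_abs f c : (forall n, measurable_fun D (f n)) ->
  (forall n, (0 <= c n)%R) ->
  measurable_fun D (fun s => \sum_(n <oo) (c n)%:E * `|f n s|).
Proof.
move=> mf c0; apply: (@ge0_emeasurable_sum _ _ _ D (fun n s => (c n)%:E * `|f n s|) xpredT).
  by move=> n s _ _; rewrite mule_ge0 ?lee_fin.
by move=> n _; apply: measurable_funeM; apply: measurableT_comp.
Qed.

(** Countable version of [KfunD]: near-optimal levels [l n], all with the same error [e], are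
    combined into the level L, the sum of the c n * l n. The total error is at most [e] because the
    weights sum to at most 1. *)
Lemma Kfun_series f c t : (forall n, measurable_fun D (f n)) ->
  (forall n, (0 <= c n)%R) -> \sum_(n <oo) (c n)%:E <= 1 -> (0 < t)%R ->
  (forall n, Kfun mu D (f n) t < +oo) ->
  Kfun mu D (fun s => \sum_(n <oo) (c n)%:E * `|f n s|) t <=
  \sum_(n <oo) (c n)%:E * Kfun mu D (f n) t.
Proof.
move=> mf c0 c1 t0 Kfin; set F := fun s => _; set S := \sum_(n <oo) _.
have K0 n : 0 <= Kfun mu D (f n) t by apply: Kfun_ge0; exact: ltW.
have S0 : 0 <= S by apply: nneseries_ge0 => n _ _; rewrite mule_ge0 ?lee_fin.
have [->|Sy] := eqVneq S +oo; first by rewrite leey.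
have mF : measurable_fun D F by exact: measurable_nneseries_abs.
have F0 s : 0 <= F s by apply: nneseries_ge0 => n _ _; rewrite mule_ge0 ?lee_fin.
apply/lee_addgt0Pr => e e0.
have h n : exists l, (0 <= l)%R /\ (l * t)%:E + \int[mu]_(s in D) excess (f n) l s <=
    Kfun mu D (f n) t + e%:E.
  have [|l l0 /ltW hl] := @Kfun_lt _ _ _ mu D (f n) t (Kfun mu D (f n) t + e%:E).
    by rewrite lteDl ?ge0_fin_numE.
  by exists l.
have [l hl] := choice h.
have l0 n : (0 <= l n)%R by case: (hl n).
pose I n := \int[mu]_(s in D) excess (f n) (l n) s.
have I0 n : 0 <= I n by exact: integral_excess_ge0.
have cl0 n : 0 <= (c n * l n)%:E by rewrite lee_fin mulr_ge0.
have cI0 n : 0 <= (c n)%:E * I n by rewrite mule_ge0 ?lee_fin.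
pose L := \sum_(n <oo) (c n * l n)%:E.
have key : t%:E * L + \sum_(n <oo) (c n)%:E * I n <= S + e%:E.
  rewrite -nneseriesZl// -nneseriesD//; last first.
    by move=> n _ _; rewrite mule_ge0// lee_fin ltW.
  apply: (@le_trans _ _ (\sum_(n <oo) ((c n)%:E * Kfun mu D (f n) t + e%:E * (c n)%:E))).
    apply: lee_nneseries.
      by move=> n _ _; rewrite adde_ge0// mule_ge0// lee_fin ltW.
    move=> n _; rewrite [e%:E * _]muleC -ge0_muleDr//; last by rewrite lee_fin ltW.
    have -> : t%:E * (c n * l n)%:E = (c n)%:E * (l n * t)%:E.
      by rewrite -!EFinM; congr EFin; ring.
    rewrite -ge0_muleDr//; last by rewrite lee_fin mulr_ge0// ltW.
    by apply: lee_wpmul2l; [rewrite lee_fin|exact: (hl n).2].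
  rewrite nneseriesD; last 2 first.
    by move=> n _ _; apply: mule_ge0; rewrite ?lee_fin.
    move=> n _ _; apply: mule_ge0; rewrite lee_fin; [exact: ltW|exact: c0].
  rewrite nneseriesZl; last by move=> n _; rewrite lee_fin.
  by rewrite leeD2l// -[leRHS]mule1 lee_wpmul2l// lee_fin ltW.
have L0 : 0 <= L by exact: nneseries_ge0.
have SI0 : 0 <= \sum_(n <oo) (c n)%:E * I n by exact: nneseries_ge0.
(* The combined level must be a real number. It is one because t * L is at most S + e and [t] is
   positive. *)
have Lfin : L \is a fin_num.
  rewrite ge0_fin_numE// ltey; apply/eqP => Ly; move: key; rewrite Ly.
  rewrite gt0_muley ?lte_fin// addye; last by rewrite gt_eqF// (lt_le_trans _ SI0).
  by rewrite leye_eq => /eqP; case: S Sy S0.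
have fL0 : (0 <= fine L)%R by rewrite fine_ge0.
apply: (le_trans (Kfun_le _ _ _ _ fL0)); apply: le_trans key.
apply: leeD; first by rewrite EFinM fineK// muleC.
have -> : \sum_(n <oo) (c n)%:E * I n =
    \int[mu]_(s in D) \sum_(n <oo) (c n)%:E * excess (f n) (l n) s.
  rewrite integral_nneseries//.
  - apply: eq_eseriesr => n _; rewrite ge0_integralZl_EFin//.
    + by move=> *; exact: excess_ge0.
    + exact: measurable_excess.
  - by move=> n; apply: measurable_funeM; exact: measurable_excess.
  - by move=> n s _; rewrite mule_ge0 ?excess_ge0// lee_fin.
apply: ge0_le_integral => //.
- by move=> *; exact: excess_ge0.
- exact: measurable_excess.
- apply: (@ge0_emeasurable_sum _ _ _ D (fun n s => (c n)%:E * excess (f n) (l n) s) xpredT).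
    by move=> n s _ _; rewrite mule_ge0 ?excess_ge0// lee_fin.
  by move=> n _; apply: measurable_funeM; exact: measurable_excess.
- move=> s Ds; apply: excess_leP.
    by apply: nneseries_ge0 => n _ _; rewrite mule_ge0 ?excess_ge0// lee_fin.
  rewrite gee0_abs// fineK// /L -nneseriesD//; last first.
    by move=> n _ _; rewrite mule_ge0 ?excess_ge0// lee_fin.
  apply: lee_nneseries => [n _ _|n _]; first by rewrite mule_ge0 ?lee_fin.
  rewrite EFinM -ge0_muleDr ?excess_ge0 ?lee_fin//.
  by apply: lee_wpmul2l; [rewrite lee_fin|exact: abse_le_excess].
Qed.

(* Functions with disjoint supports: at each point at most one term of the sum
   is nonzero, so truncation commutes with the sum. *)
Lemma excess_disjoint_sum (z : nat -> T -> \bar R) (A : nat -> set T) (l : R) n s :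
  (0 <= l)%R -> (forall k s, 0 <= z k s) ->
  (forall k s, z k s != 0 -> (A k `\` A k.+1) s) ->
  (forall k, A k.+1 `<=` A k) ->
  excess (fun s => \sum_(k < n) z k s) l s <= \sum_(k < n) excess (z k) l s.
Proof.
move=> l0 z0 zA Adecr.
have AS k j : (k <= j)%N -> A j `<=` A k.
  by elim: j => [|j IH]; [rewrite leqn0 => /eqP ->|rewrite leq_eqVlt => /predU1P[->//|/IH
    h]; exact: subset_trans (Adecr j) h].
(* The induction also carries that a nonzero partial sum keeps [s] outside [A n]. A nonzero next
   term puts [s] in [A n], so then the partial sum vanishes. *)
suff : excess (fun s => \sum_(k < n) z k s) l s <= \sum_(k < n) excess (z k) l s /\
    (\sum_(k < n) z k s != 0 -> ~ A n s).
  by case.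
elim: n => [|n [IH1 IH2]].
  rewrite !big_ord0 eqxx; split=> //; rewrite /excess big_ord0 abse0 ge_max lexx andbT.
  by rewrite sub0e -EFinN lee_fin oppr_le0.
have s0 : 0 <= \sum_(k < n) z k s by exact: sume_ge0.
rewrite !big_ord_recr/=; have [zn0|zn0] := eqVneq (z n s) 0.
  rewrite zn0 adde0; split; last by move=> /IH2 nA /(Adecr n).
  rewrite /excess big_ord_recr/= zn0 adde0; apply: (le_trans IH1).
  by rewrite leeDl// le_max lexx orbT.
have [An An1] := zA _ _ zn0.
have sum0 : \sum_(k < n) z k s = 0.
  by apply: contrapT => /eqP /IH2; exact.
split=> //; rewrite {1}/excess big_ord_recr/= sum0 add0e.
by rewrite leeDr//; apply: sume_ge0 => k _; exact: excess_ge0.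
Qed.

End KfunctionalSeries.

Lemma erestrictE (T : Type) (R : realType) (f : T -> \bar R) (B : set T) s :
  (f \_ B) s = if s \in B then f s else 0.
Proof. by rewrite patchE. Qed.

(** * The layer cake formula *)

Section LayerCake.
Context {R : realType}.
Notation lbg := (@lebesgue_measure R).

(** Serves twice: with [x] a function value in the layer cake formula, and with [x] a value of the
    distribution function, as the length of a level interval of the rearrangement. *)
Lemma lebesgue_measure_itv0 (x : \bar R) : 0 <= x ->
  lbg [set l : R | (0 <= l)%R /\ l%:E < x] = x.
Proof.
case: x => [r r0| _|//].
  have -> : [set l : R | (0 <= l)%R /\ l%:E < r%:E] = `[0%R, r[%classic.
    by apply/seteqP; split => l; rewrite /= in_itv/= lte_fin; [move=> [? ?];
      apply/andP|move=> /andP].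
  rewrite lebesgue_measure_itv/= lte_fin; move: r0.
  rewrite lee_fin le_eqVlt => /predU1P[<-|->]; first by rewrite ltxx.
  by rewrite oppr0 adde0.
have -> : [set l : R | (0 <= l)%R /\ l%:E < +oo] = `[0%R, +oo[%classic.
  by apply/seteqP; split => l; rewrite /= in_itv/= andbT ltry; [case|].
by rewrite lebesgue_measure_itv/= lt0y.
Qed.

Lemma measurable_itv0 (x : \bar R) :
  @measurable _ (measurableTypeR R) [set l : R | (0 <= l)%R /\ l%:E < x].
Proof.
have -> : [set l : R | (0 <= l)%R /\ l%:E < x] = `[0%R, +oo[ `&` [set l : R | l%:E < x].
  by apply/seteqP; split => l /=; rewrite in_itv/= andbT.
by apply: emeasurable_fun_infty_o => //; exact/measurable_EFinP.
Qed.

Definition layer_set T (g : T -> \bar R) : set (T * R) :=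
  [set z : T * R | (0 <= z.2)%R /\ z.2%:E < g z.1].

Lemma measurable_layer_set d (T : measurableType d) (g : T -> \bar R) :
  measurable_fun setT g -> measurable (layer_set g).
Proof.
move=> mg.
have -> : layer_set g = (setT `&` [set z : T * R | z.2%:E < g z.1]) `&` (setT `*` `[0%R, +oo[).
  apply/seteqP; split => [[s l]|[s l]]/=; rewrite /layer_set/= in_itv/= andbT.
    by move=> [].
  by move=> [[_ ?] []].
apply: measurableI; last exact: measurableX.
apply: measurable_lte => //.
  by apply/measurable_EFinP; exact: measurable_snd.
exact: (measurableT_comp mg measurable_fst).
Qed.

Lemma integral_layer_set d (T : measurableType d) (m : {measure set T -> \bar R})
  (g : T -> \bar R) (l : R) : measurable_fun setT g -> (0 <= l)%R ->
  \int[m]_s (\1_(layer_set g) (s, l))%:E = m [set s | l%:E < g s].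
Proof.
move=> mg l0; have mB : measurable [set s | l%:E < g s].
  by rewrite -[X in measurable X]setTI; apply: emeasurable_fun_o_infty.
have := @integral_indic _ _ _ m setT measurableT _ mB; rewrite setIT => <-.
apply: eq_integral => s _; congr EFin; rewrite !indicE.
suff -> : ((s, l) \in layer_set g) = (s \in [set s0 | l%:E < g s0]) by [].
by apply/idP/idP; rewrite !inE /layer_set/=; [case|].
Qed.

Lemma layer_cake d (T : measurableType d) (m : {sigma_finite_measure set T -> \bar R})
  (g : T -> \bar R) : measurable_fun setT g -> (forall s, 0 <= g s) ->
  \int[m]_s g s = \int[lbg]_(l in `[0%R, +oo[) m [set s | l%:E < g s].
Proof.
move=> mg g0; pose f (z : T * R) : \bar R := (\1_(layer_set g) z)%:E.
have mA := measurable_layer_set mg.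
have mf : measurable_fun setT f by apply/measurable_EFinP; exact: measurable_indic.
have f0 z : 0 <= f z by rewrite lee_fin.
have -> : \int[m]_s g s = \int[m]_s \int[lbg]_l f (s, l).
  apply: eq_integral => s _; rewrite -[LHS]lebesgue_measure_itv0//.
  have := @integral_indic _ _ _ lbg setT measurableT _ (measurable_itv0 (g s)).
  rewrite setIT => <-.
  by apply: eq_integral => l _; rewrite /f; congr EFin; rewrite !indicE; congr (_%:R);
    apply/idP/idP; rewrite !inE.
have := fubini_tonelli (m1 := m) (m2 := lbg) f mf f0 => ->.
rewrite [RHS]integral_mkcond; apply: eq_integral => l _.
rewrite erestrictE; case: ifPn => [|l0].
  by rewrite inE/= in_itv/= andbT => l0; exact: integral_layer_set.
rewrite integral0_eq// => s _; rewrite /f indicE memNset// => -[/= l0' _].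
by move: l0; rewrite notin_setE/= in_itv/= andbT; exact.
Qed.

Lemma measurable_layer d (T : measurableType d) (m : {sigma_finite_measure set T -> \bar R})
  (g : T -> \bar R) : measurable_fun setT g ->
  @measurable_fun _ _ (measurableTypeR R) _ `[0%R, +oo[%classic (fun l : R => m [set s |
    l%:E < g s]).
Proof.
move=> mg; pose f (z : T * R) : \bar R := (\1_(layer_set g) z)%:E.
have mf : measurable_fun setT f.
  by apply/measurable_EFinP; apply: measurable_indic; exact: measurable_layer_set.
have f0 z : 0 <= f z by rewrite lee_fin.
apply: (eq_measurable_fun (fubini_G m f)).
  move=> l; rewrite inE/= in_itv/= andbT => l0.
  exact: integral_layer_set.
apply: measurable_funS (measurable_fun_fubini_tonelli_G f mf f0) => //.
Qed.

(** Only the measures of superlevel sets are compared, so the integrands may live on different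
    spaces. This is how a function and its rearrangement are compared in both directions. *)
Lemma le_layers d (T : measurableType d) (m : {sigma_finite_measure set T -> \bar R})
  d' (T' : measurableType d') (m' : {sigma_finite_measure set T' -> \bar R})
  (D : set T) (D' : set T') (f : T -> \bar R) (g : T' -> \bar R) :
  measurable D -> measurable D' -> measurable_fun D f -> measurable_fun D' g ->
  (forall s, D s -> 0 <= f s) -> (forall s, D' s -> 0 <= g s) ->
  (forall l : R, (0 <= l)%R ->
    m (D `&` [set s | l%:E < f s]) <= m' (D' `&` [set s | l%:E < g s])) ->
  \int[m]_(s in D) f s <= \int[m']_(s in D') g s.
Proof.
move=> mD mD' mf mg f0 g0 fg.
have mfD : measurable_fun setT (f \_ D) by apply/(measurable_restrictT _ mD).
have mgD : measurable_fun setT (g \_ D') by apply/(measurable_restrictT _ mD').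
have fD0 s : 0 <= (f \_ D) s by apply: erestrict_ge0.
have gD0 s : 0 <= (g \_ D') s by apply: erestrict_ge0.
have lev U (E : set U) (h : U -> \bar R) (l : R) : (0 <= l)%R ->
    [set s | l%:E < (h \_ E) s] = E `&` [set s | l%:E < h s].
  move=> l0; apply/seteqP; split => s /=; rewrite erestrictE.
    by case: ifPn => [/set_mem//|_]; rewrite ltNge lee_fin l0.
  by move=> [Es hs]; rewrite mem_set.
rewrite integral_mkcond [leRHS]integral_mkcond !layer_cake//.
apply: ge0_le_integral => //.
- exact: measurable_layer.
- exact: measurable_layer.
- by move=> l; rewrite /= in_itv/= andbT => l0; rewrite !lev//; exact: fg.
Qed.

End LayerCake.

(** * Order continuity of modulars of the K-functional and of their duals *)

(** From a <= 1 + a^p the sum on the left is finite if the right-hand side is. Then [powR_young] is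
    summed with [m] equal to that sum; total weight at most 1 is enough because the constant term (p
    - 1) m^p is nonnegative. *)
Lemma poweR_jensen_series (R : realType) (p : R) (a : nat -> \bar R) (c : nat -> R) :
  ((1 : R) < p)%R -> (forall n, (0 <= c n)%R) -> \sum_(n <oo) (c n)%:E <= 1 ->
  (forall n, 0 <= a n) -> (forall n, a n < +oo) ->
  (\sum_(n <oo) (c n)%:E * a n) `^ p <= \sum_(n <oo) (c n)%:E * a n `^ p.
Proof.
move=> p1 c0 c1 a0 aoo; set S := \sum_(n <oo) (c n)%:E * a n.
set B := \sum_(n <oo) _.
have p0 : (0 <= p)%R by lra.
have pm1 : (0 <= p - 1)%R by lra.
have aE n : a n = (fine (a n))%:E by rewrite fineK// ge0_fin_numE.
have fa0 n : (0 <= fine (a n))%R by exact: fine_ge0.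
have ce0 n : 0 <= (c n)%:E by rewrite lee_fin.
have cap0 n : 0 <= (c n)%:E * a n `^ p by rewrite mule_ge0 ?poweR_ge0// lee_fin.
have ca0 n : 0 <= (c n)%:E * a n by rewrite mule_ge0// lee_fin.
have S0 : 0 <= S by exact: nneseries_ge0.
have B0 : 0 <= B by exact: nneseries_ge0.
have [->|By] := eqVneq B +oo; first by rewrite leey.
have Bfin : B \is a fin_num by rewrite ge0_fin_numE// ltey.
have Sfin : S \is a fin_num.
  rewrite ge0_fin_numE//; apply: (@le_lt_trans _ _ (1 + B)); last first.
    by rewrite lte_add_pinfty ?ltey.
  apply: (@le_trans _ _ (\sum_(n <oo) ((c n)%:E + (c n)%:E * a n `^ p))).
    apply: lee_nneseries => // n _.
    rewrite -[X in X + _]mule1 -ge0_muleDr ?poweR_ge0 ?lee_fin//.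
    apply: lee_wpmul2l; first by rewrite lee_fin.
    rewrite aE poweR_EFin -EFinD lee_fin.
    have [a1|/ltW a1] := leP (fine (a n)) 1%R.
      by apply: le_trans a1 _; rewrite lerDl powR_ge0.
    by apply: (le_trans (le1r_powR a1 (ltW p1))); rewrite lerDr.
  by rewrite nneseriesD// leeD2r.
pose m := fine S.
have m0 : (0 <= m)%R by exact: fine_ge0.
have SE : S = m%:E by rewrite /m fineK.
have pmm0 : (0 <= p * m `^ (p - 1))%R by rewrite mulr_ge0 ?powR_ge0.
have h : (p * m `^ (p - 1))%:E * S <= B + ((p - 1) * m `^ p)%:E.
  rewrite -nneseriesZl//.
  apply: (@le_trans _ _ (\sum_(n <oo) ((c n)%:E * a n `^ p + ((p - 1) * m `^ p)%:E * (c
    n)%:E))).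
    apply: lee_nneseries => [n _ _|n _]; first by rewrite mule_ge0// lee_fin.
    rewrite aE poweR_EFin -!EFinM -EFinD lee_fin.
    have := ler_wpM2l (c0 n) (powR_young p1 (fa0 n) m0); lra.
  have pmp0 : 0 <= ((p - 1) * m `^ p)%:E by rewrite lee_fin mulr_ge0 ?powR_ge0.
  rewrite nneseriesD//; last by move=> n _ _; rewrite mule_ge0// lee_fin.
  rewrite nneseriesZl//.
  by rewrite leeD2l// -[leRHS]mule1 lee_wpmul2l.
move: h; rewrite SE poweR_EFin -(fineK Bfin) -EFinM -EFinD !lee_fin.
by rewrite -mulrA [X in (p * X)%R]mulrC mulr_powRB1//; lra.
Qed.

Lemma cvge0P (R : realType) (u : nat -> \bar R) : (forall n, 0 <= u n) ->
  (u n @[n --> \oo] --> 0) <->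
  (forall e : R, (0 < e)%R -> exists N, forall n, (N <= n)%N -> u n <= e%:E).
Proof.
move=> u0; split.
  move=> /fine_cvgP[ufin /cvgrPdist_le uc] e /uc[N1 _ hN1].
  have [N2 _ hN2] := ufin.
  exists (maxn N1 N2) => n; rewrite geq_max => /andP[n1 n2].
  have := hN1 n n1; rewrite /= sub0r normrN ger0_norm ?fine_ge0// => h.
  by rewrite -(fineK (hN2 n n2)) lee_fin.
move=> ue; apply/fine_cvgP; split.
  have [N hN] := ue 1%R ltr01; exists N => // n /= /hN un.
  by rewrite ge0_fin_numE// (le_lt_trans un)// ltry.
apply/cvgrPdist_le => e /ue[N hN]; exists N => // n /= /hN un.
rewrite sub0r normrN ger0_norm ?fine_ge0// -lee_fin fineK//.
by rewrite ge0_fin_numE// (le_lt_trans un)// ltry.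
Qed.

Lemma exists_powR_small (R : realType) (p e : R) : ((1 : R) < p)%R -> (0 < e)%R ->
  exists2 h : R, (0 < h)%R & (h `^ p = e)%R.
Proof.
move=> p1 e0; exists (e `^ p^-1)%R; first by rewrite powR_gt0.
by rewrite -powRrM mulVf ?powRr1 ?ltW// gt_eqF//; lra.
Qed.

(** [H] is at most its minimum with [a 0] plus the mean distance of the [a k] to [a 0]. The minimum
    is there for dominated convergence: it lies below the fixed [a 0], whereas [H] will vary with
    [n]. *)
Lemma powR_mean_dist (R : realType) (p : R) (a : nat -> R) (H : R) n :
  ((1 : R) < p)%R -> (0 <= H)%R -> (forall k, 0 <= a k)%R ->
  (H <= n.+1%:R^-1 * \sum_(k < n.+1) a k)%R ->
  (H `^ p <= 2 `^ p * (Num.min H (a 0) `^ p +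
    n.+1%:R^-1 * \sum_(k < n.+1) `|a k - a 0| `^ p))%R.
Proof.
move=> p1 H0 a0 Hm.
pose e k := `|a k - a 0%N|%R; have e0 k : (0 <= e k)%R by exact: normr_ge0.
pose me := (n.+1%:R^-1 * \sum_(k < n.+1) e k)%R.
have me0 : (0 <= me)%R by rewrite mulr_ge0// sumr_ge0.
have Hbe : (H <= a 0%N + me)%R.
  apply: (le_trans Hm).
  have -> : a 0%N = (n.+1%:R^-1 * \sum_(k < n.+1) a 0%N)%R.
    by rewrite sumr_const card_ord -[(a 0%N *+ _)%R]mulr_natl mulKf// pnatr_eq0.
  rewrite -mulrDr ler_wpM2l// -big_split/=.
  by apply: ler_sum => k _; rewrite -lerBlDl ler_norm.
have Hmin : (H <= Num.min H (a 0%N) + me)%R.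
  by rewrite addr_minl le_min lerDl me0 Hbe.
have min0 : (0 <= Num.min H (a 0%N))%R by rewrite le_min H0 a0.
have h1 : (H `^ p <= 2 `^ p * (Num.min H (a 0%N) `^ p + me `^ p))%R.
  apply: le_trans (powRD_le p1 min0 me0).
  by apply: ge0_ler_powR; rewrite ?nnegrE ?addr_ge0//; lra.
apply: (le_trans h1); rewrite ler_wpM2l ?powR_ge0// lerD2l.
exact: powR_mean_le.
Qed.

Lemma le_poweR (R : realType) (p : R) (x y : \bar R) :
  (0 <= p)%R -> 0 <= x -> x <= y -> x `^ p <= y `^ p.
Proof.
move=> p0 x0 xy; apply: gt0_ler_poweR => //; rewrite in_itv/= leey andbT//.
exact: le_trans xy.
Qed.

Opaque integral powR.

Section OrderContinuityOfDual.
Context {d} {T : measurableType d} {R : realType}.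
Variables (mu : {measure set T -> \bar R}) (D : set T).
Hypothesis mD : measurable D.
Context {d'} {S : measurableType d'}.
Variables (nu : {measure set S -> \bar R}) (P : set S).
Hypothesis mP : measurable P.
Variables (tau : S -> R) (om : S -> R) (p : R).
Hypothesis p_gt1 : ((1 : R) < p)%R.
Let p_ge0 : (0 <= p)%R. Proof. by have := p_gt1; lra. Qed.
Hypothesis tau_gt0 : forall s, P s -> (0 < tau s)%R.
Hypothesis om_ge0 : forall s, P s -> (0 <= om s)%R.
Hypothesis m_om : measurable_fun P om.
Notation K := (Kfun mu D).
Hypothesis mK : forall f : T -> \bar R, measurable_fun D f -> measurable_fun P (fun s => K
  f (tau s)).

(** A p-th power without the root, over an abstract parameter space. For Gamma_{p,w}, [nu] is
    Lebesgue measure on the open half-line, [tau] the identity and [om] the function t^-p w(t). *)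
Definition Kmodular (f : T -> \bar R) : \bar R :=
  \int[nu]_(s in P) (K f (tau s) `^ p * (om s)%:E).
Notation J := Kmodular.

Implicit Types (f g h z y : T -> \bar R) (e t c : R).

Lemma Kmodular_integrand_ge0 f s : P s -> 0 <= K f (tau s) `^ p * (om s)%:E.
Proof. by move=> Ps; rewrite mule_ge0 ?poweR_ge0// lee_fin om_ge0. Qed.

Lemma measurable_Kmodular_integrand f : measurable_fun D f ->
  measurable_fun P (fun s => K f (tau s) `^ p * (om s)%:E).
Proof.
move=> mf; apply: emeasurable_funM; last exact/measurable_EFinP.
by apply: (measurableT_comp (measurable_poweR p)); exact: mK.
Qed.

Lemma Kmodular_ge0 f : 0 <= J f.
Proof. by apply: integral_ge0 => s Ps; exact: Kmodular_integrand_ge0. Qed.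

Lemma le_Kmodular_Kfun f g : measurable_fun D f -> measurable_fun D g ->
  (forall t, (0 < t)%R -> K f t <= K g t) -> J f <= J g.
Proof.
move=> mf mg fg; apply: ge0_le_integral => //.
- by move=> s Ps; exact: Kmodular_integrand_ge0.
- exact: measurable_Kmodular_integrand.
- exact: measurable_Kmodular_integrand.
- move=> s Ps; have t0 := tau_gt0 Ps.
  apply: lee_wpmul2r; first by rewrite lee_fin om_ge0.
  by apply: le_poweR => //; [rewrite Kfun_ge0// ltW|exact: fg].
Qed.

Lemma le_Kmodular f g : measurable_fun D f -> measurable_fun D g ->
  (forall s, D s -> `|f s| <= `|g s|) -> J f <= J g.
Proof. by move=> mf mg fg; apply: le_Kmodular_Kfun => // t _; exact: le_Kfun. Qed.

Lemma KmodularZ f g c : measurable_fun D f -> measurable_fun D g -> (0 < c)%R ->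
  (forall s, D s -> `|f s| <= c%:E * `|g s|) -> J f <= (c `^ p)%:E * J g.
Proof.
move=> mf mg c0 fg; rewrite -ge0_integralZl_EFin ?powR_ge0//; last 2 first.
- by move=> s Ps; exact: Kmodular_integrand_ge0.
- exact: measurable_Kmodular_integrand.
apply: ge0_le_integral => //.
- by move=> s Ps; exact: Kmodular_integrand_ge0.
- exact: measurable_Kmodular_integrand.
- by apply: measurable_funeM; exact: measurable_Kmodular_integrand.
- move=> s Ps; have t0 := tau_gt0 Ps.
  rewrite muleA; apply: lee_wpmul2r; first by rewrite lee_fin om_ge0.
  rewrite -poweR_EFin -poweRM ?lee_fin ?(ltW c0) ?Kfun_ge0 ?(ltW t0)//.
  by apply: le_poweR => //; [rewrite Kfun_ge0// ltW|exact: KfunZ].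
Qed.

(** The abstract form of infinite mass near 0: on the unit ball of [J], the K-functional is
    uniformly small at small [t]. *)
Hypothesis Kfun_uniform : forall e, (0 < e)%R -> exists2 t : R, (0 < t)%R &
  forall f, measurable_fun D f -> J f <= 1 -> K f t <= e%:E.

Lemma Kfun_fin f t : measurable_fun D f -> J f <= 1 -> (0 < t)%R -> K f t < +oo.
Proof.
move=> mf Jf t0; have [u u0 /(_ f mf Jf) Ku] := Kfun_uniform ltr01.
have [tu|/ltW ut] := leP t u.
  by apply: le_lt_trans (ltry 1); apply: le_trans Ku; exact: Kfun_nd.
have := Kfun_ratio mu D f u0 ut.
rewrite -lee_pdivlMl// => /le_lt_trans; apply.
rewrite lte_mul_pinfty ?lee_fin ?invr_ge0 ?ltW//.
rewrite lte_mul_pinfty ?lee_fin ?ltW//.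
by rewrite (le_lt_trans Ku)// ltry.
Qed.

(** A near-optimal level l' for [K f t] satisfies l' * t <= e, so it lies below e / t for every [f]
    in the unit ball, and raising the level only decreases the excess. *)
Lemma excess_uniform e : (0 < e)%R -> exists2 L : R, (0 <= L)%R &
  forall f (l : R), measurable_fun D f -> J f <= 1 -> (L <= l)%R ->
  \int[mu]_(s in D) excess f l s <= e%:E.
Proof.
move=> e0; have e20 : (0 < e / 2)%R by rewrite divr_gt0.
have [t t0 Kt] := Kfun_uniform e20.
exists (e / t)%R; first by rewrite divr_ge0 ?ltW.
move=> f l mf Jf Ll.
have [|l' l'0 hl'] := @Kfun_lt _ _ _ mu D f t e%:E.
  by rewrite (le_lt_trans (Kt _ mf Jf))// lte_fin; lra.
have I0 := integral_excess_ge0 mu D f l'.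
have l't : (l' <= e / t)%R.
  rewrite ler_pdivlMr// -lee_fin; apply: le_trans (ltW hl').
  by rewrite leeDl.
apply: (@le_trans _ _ (\int[mu]_(s in D) excess f l' s)).
  apply: ge0_le_integral => //.
  - by move=> *; exact: excess_ge0.
  - exact: measurable_excess.
  - exact: measurable_excess.
  - by move=> s _; apply: le_excess => //; exact: le_trans Ll.
by apply: le_trans _ (ltW hl'); rewrite leeDr// lee_fin mulr_ge0// ltW.
Qed.

(** Condensation argument: if the [f n] in the unit ball have pairings above 4^n, their sum with
    weights 2^-(n+1) stays in the unit ball by [Kfun_series] and Jensen, yet its pairing with [y] is
    at least 2^n / 2 for every [n]. *)
Lemma Kmodular_uniform_boundedness y : measurable_fun D y ->
  (forall f, measurable_fun D f -> J f < +oo -> \int[mu]_(s in D) `|f s * y s| < +oo) ->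
  exists2 M : R, (0 <= M)%R & forall f, measurable_fun D f -> J f <= 1 ->
    \int[mu]_(s in D) `|f s * y s| <= M%:E.
Proof.
move=> my yE; apply: contrapT => nM.
have h n : exists f, [/\ measurable_fun D f, J f <= 1 &
    (4 ^+ n)%:E < \int[mu]_(s in D) `|f s * y s|].
  apply: contrapT => nf; apply: nM; exists (4 ^+ n)%R; first by rewrite exprn_ge0.
  move=> f mf Jf; rewrite leNgt; apply/negP => ?; apply: nf; by exists f.
have [f hf] := choice h.
have mf n : measurable_fun D (f n) by case: (hf n).
have Jf n : J (f n) <= 1 by case: (hf n).
pose c n : R := (1 / (2 ^ (n + 1))%:R)%R.
have c0 n : (0 <= c n)%R by rewrite divr_ge0.
have c1 : \sum_(n <oo) (c n)%:E <= 1.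
  have := @cvg_geometric_eseries_half R 1 0; rewrite expr0 divr1 => /cvg_lim <-//.
pose F s := \sum_(n <oo) (c n)%:E * `|f n s|.
have mF : measurable_fun D F by exact: measurable_nneseries_abs.
have F0 s : 0 <= F s by apply: nneseries_ge0 => n _ _; rewrite mule_ge0// lee_fin.
have JF : J F <= 1.
  apply: (@le_trans _ _ (\sum_(n <oo) (c n)%:E * J (f n))); last first.
    apply: le_trans c1; apply: lee_nneseries => n.
      by move=> _ _; rewrite mule_ge0 ?Kmodular_ge0// lee_fin.
    by move=> _; rewrite -[leRHS]mule1 lee_wpmul2l// lee_fin.
  have -> : \sum_(n <oo) (c n)%:E * J (f n) =
      \int[nu]_(s in P) \sum_(n <oo) (c n)%:E * (K (f n) (tau s) `^ p * (om s)%:E).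
    rewrite integral_nneseries//.
    - apply: eq_eseriesr => n _; rewrite ge0_integralZl_EFin//.
      + by move=> s; exact: Kmodular_integrand_ge0.
      + exact: measurable_Kmodular_integrand.
    - by move=> n; apply: measurable_funeM; exact: measurable_Kmodular_integrand.
    - by move=> n s Ps; rewrite mule_ge0 ?Kmodular_integrand_ge0// lee_fin.
  apply: ge0_le_integral => //.
  - by move=> s Ps; exact: Kmodular_integrand_ge0.
  - exact: measurable_Kmodular_integrand.
  - apply: (@ge0_emeasurable_sum _ _ _ P (fun n s => (c n)%:E * (K (f n) (tau s) `^ p * (om
    s)%:E)) xpredT).
      by move=> n s Ps _; rewrite mule_ge0 ?Kmodular_integrand_ge0// lee_fin.
    by move=> n _; apply: measurable_funeM; exact: measurable_Kmodular_integrand.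
  - move=> s Ps; have t0 := tau_gt0 Ps.
    have Kfin n : K (f n) (tau s) < +oo by exact: Kfun_fin.
    have K0 n : 0 <= K (f n) (tau s) by rewrite Kfun_ge0// ltW.
    apply: (@le_trans _ _ ((om s)%:E * \sum_(n <oo) (c n)%:E * (K (f n) (tau s) `^ p)));
      last first.
      rewrite -nneseriesZl; last by move=> n _; rewrite mule_ge0 ?poweR_ge0// lee_fin.
      apply: lee_nneseries => [n _ _|n _]; last by rewrite muleCA [(om s)%:E * _]muleC.
      by rewrite !mule_ge0 ?poweR_ge0 ?lee_fin ?om_ge0.
    rewrite muleC; apply: lee_wpmul2l; first by rewrite lee_fin om_ge0.
    apply: le_trans (poweR_jensen_series p_gt1 c0 c1 K0 Kfin).
    by apply: le_poweR => //; [rewrite Kfun_ge0// ltW|exact: Kfun_series].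
have := yE F mF (le_lt_trans JF (ltry 1)).
set I := \int[mu]_(s in D) _ => Ioo.
have I0 : 0 <= I by exact: integral_ge0.
have lb n : ((2 ^+ n) / 2)%:E <= I.
  apply: (@le_trans _ _ ((c n)%:E * \int[mu]_(s in D) `|f n s * y s|)).
    have [_ _ /ltW h4] := hf n.
    apply: (@le_trans _ _ ((c n)%:E * (4 ^+ n)%:E)); last by apply: lee_wpmul2l; rewrite
      ?lee_fin.
    rewrite -EFinM lee_fin /c natrX exprD expr1.
    have -> : (4%:R = 2%:R * 2%:R :> R)%R by rewrite -natrM.
    rewrite exprMn; have h2 : (2 ^+ n != 0 :> R)%R by rewrite expf_neq0.
    have -> // : (1 / (2 ^+ n * 2) * (2 ^+ n * 2 ^+ n) = 2 ^+ n / 2 :> R)%R by field.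
  rewrite -ge0_integralZl_EFin//; last first.
    by apply: measurableT_comp => //; exact: emeasurable_funM.
  apply: ge0_le_integral => //.
  - by move=> s _; rewrite mule_ge0// lee_fin.
  - by apply: measurable_funeM; apply: measurableT_comp => //; exact: emeasurable_funM.
  - by apply: measurableT_comp => //; exact: emeasurable_funM.
  - move=> s Ds; rewrite !abseM muleA; apply: lee_wpmul2r => //.
    rewrite (gee0_abs (F0 s)).
    have cf0 k : 0 <= (c k)%:E * `|f k s| by rewrite mule_ge0// lee_fin.
    apply: (@le_trans _ _ (\sum_(0 <= k < n.+1) (c k)%:E * `|f k s|)).
      by rewrite big_nat_recr//= leeDr// sume_ge0.
    exact: nneseries_lim_ge.
have Ifin : I \is a fin_num by rewrite ge0_fin_numE.
have I20 : (0 <= 2 * fine I)%R by rewrite mulr_ge0 ?fine_ge0.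
have := lb (Num.bound (2 * fine I)); rewrite -(fineK Ifin) lee_fin.
have := archi_boundP I20; set b := Num.bound _ => h1.
have h2 : (b%:R <= 2 ^+ b :> R)%R by rewrite -natrX ler_nat ltnW// ltn_expl.
by rewrite ler_pdivrMr// => h3; move: h1; rewrite ltNge (le_trans h2)// mulrC.
Qed.

Notation kf z s := (fine (K z (tau s))).

Lemma Kfun_fineK f s : measurable_fun D f -> J f <= 1 -> P s ->
  K f (tau s) = (kf f s)%:E.
Proof.
move=> mf Jf Ps; have t0 := tau_gt0 Ps; rewrite fineK// ge0_fin_numE ?Kfun_fin//.
by rewrite Kfun_ge0// ltW.
Qed.

Lemma kf_ge0 f s : P s -> (0 <= kf f s)%R.
Proof. by move=> Ps; rewrite fine_ge0// Kfun_ge0// ltW// tau_gt0. Qed.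

Lemma measurable_kf f : measurable_fun D f -> measurable_fun P (fun s => kf f s).
Proof. by move=> mf; apply: (measurableT_comp (fine_measurable measurableT)); exact: mK. Qed.

Lemma measurable_powR_weight (a : S -> R) : measurable_fun P a ->
  measurable_fun P (fun s => (a s `^ p * om s)%:E).
Proof.
move=> ma; apply/measurable_EFinP; apply: measurable_funM => //.
exact: (measurableT_comp (measurable_powR p)).
Qed.

Lemma powR_weight_ge0 (a : S -> R) s : P s -> 0 <= (a s `^ p * om s)%:E.
Proof. by move=> Ps; rewrite lee_fin mulr_ge0 ?powR_ge0 ?om_ge0. Qed.

Lemma KmodularE f : measurable_fun D f -> J f <= 1 ->
  J f = \int[nu]_(s in P) (kf f s `^ p * om s)%:E.
Proof.
move=> mf Jf; apply: eq_integral => s; rewrite inE => Ps.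
by rewrite Kfun_fineK// poweR_EFin -EFinM.
Qed.

Lemma Kmodular_le_integral f (a : S -> R) : measurable_fun D f ->
  measurable_fun P a -> (forall s, P s -> K f (tau s) <= (a s)%:E) ->
  J f <= \int[nu]_(s in P) (a s `^ p * om s)%:E.
Proof.
move=> mf ma fa; apply: ge0_le_integral => //.
- by move=> s; exact: Kmodular_integrand_ge0.
- exact: measurable_Kmodular_integrand.
- exact: measurable_powR_weight.
- move=> s Ps; rewrite EFinM -poweR_EFin; apply: lee_wpmul2r.
    by rewrite lee_fin om_ge0.
  by apply: le_poweR => //; [rewrite Kfun_ge0// ltW// tau_gt0|exact: fa].
Qed.

(** Absolute values make the absolute pairing of the midpoint with [y] exactly the mean of the two
    absolute pairings. *)
Definition midpoint z g : T -> \bar R := fun s => (2^-1)%:E * (`|z s| + `|g s|).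

Lemma measurable_midpoint z g : measurable_fun D z -> measurable_fun D g ->
  measurable_fun D (midpoint z g).
Proof.
move=> mz mg; apply: measurable_funeM.
by apply: emeasurable_funD; exact: measurableT_comp.
Qed.

Lemma Kfun_midpoint z g t : measurable_fun D z -> measurable_fun D g -> (0 <= t)%R ->
  K (midpoint z g) t <= (2^-1)%:E * (K z t + K g t).
Proof.
move=> mz mg t0; have msum : measurable_fun D (fun s => `|z s| + `|g s|).
  by apply: emeasurable_funD; exact: measurableT_comp.
apply: (@le_trans _ _ ((2^-1)%:E * K (fun s => `|z s| + `|g s|) t)).
  apply: KfunZ => //; first exact: measurable_midpoint.
  by move=> s _; rewrite abseM [`|(2^-1)%:E|]gee0_abs// lee_fin.
apply: lee_wpmul2l; first by rewrite lee_fin.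
by apply: KfunD => // s _; rewrite gee0_abs// adde_ge0.
Qed.

Lemma integral_uniform_convexity (a b : S -> R) (h : R) :
  measurable_fun P a -> measurable_fun P b ->
  (forall s, P s -> (0 <= a s)%R) -> (forall s, P s -> (0 <= b s)%R) -> (0 < h)%R ->
  \int[nu]_(s in P) (`|a s - b s| `^ p * om s)%:E +
    (2 * (uconv_const p / h ^+ 2))%:E * \int[nu]_(s in P) (((a s + b s) / 2) `^ p * om s)%:E <=
  (h `^ p * 2 `^ p + uconv_const p / h ^+ 2)%:E *
    (\int[nu]_(s in P) (a s `^ p * om s)%:E + \int[nu]_(s in P) (b s `^ p * om s)%:E).
Proof.
move=> ma mb a0 b0 h0.
have C0 := uconv_const_ge0 p_gt1.
set E := (uconv_const p / h ^+ 2)%R.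
have E0 : (0 <= E)%R by rewrite divr_ge0// exprn_ge0// ltW.
have [B BE] : exists B : R, B = (2 * E)%R by eexists.
have [A AE] : exists A : R, A = (h `^ p * 2 `^ p + E)%R by eexists.
rewrite -BE -AE.
have E20 : (0 <= B)%R by rewrite BE mulr_ge0.
have A0 : (0 <= A)%R by rewrite AE addr_ge0// mulr_ge0 ?powR_ge0.
have mm : measurable_fun P (fun s => ((a s + b s) / 2)%R).
  exact: (measurableT_comp (@mulrr_measurable R setT (2^-1)%R) (measurable_funD ma mb)).
have mv : measurable_fun P (fun s => `|a s - b s|%R).
  exact: (measurableT_comp (@normr_measurable R setT) (measurable_funB ma mb)).
have X0 := powR_weight_ge0 a; have mX := measurable_powR_weight ma.
have Y0 := powR_weight_ge0 b; have mY := measurable_powR_weight mb.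
have V0 := powR_weight_ge0 (fun s => `|a s - b s|%R).
have mV := measurable_powR_weight mv.
have M0 := powR_weight_ge0 (fun s => ((a s + b s) / 2)%R).
have mM := measurable_powR_weight mm.
have EM0 s : P s -> 0 <= B%:E * (((a s + b s) / 2) `^ p * om s)%:E.
  by move=> Ps; apply: mule_ge0 (M0 _ Ps); rewrite lee_fin.
have mEM := measurable_funeM B%:E mM.
have mXY := emeasurable_funD mX mY.
have XY0 s : P s -> 0 <= (a s `^ p * om s)%:E + (b s `^ p * om s)%:E.
  by move=> Ps; apply: adde_ge0; [exact: X0|exact: Y0].
have VEM0 s : P s -> 0 <= (`|a s - b s| `^ p * om s)%:E + B%:E * (((a s + b s) / 2) `^ p *
  om s)%:E.
  by move=> Ps; apply: adde_ge0; [exact: V0|exact: EM0].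
have -> : \int[nu]_(s in P) (`|a s - b s| `^ p * om s)%:E +
    B%:E * \int[nu]_(s in P) (((a s + b s) / 2) `^ p * om s)%:E =
    \int[nu]_(s in P) ((`|a s - b s| `^ p * om s)%:E +
      B%:E * (((a s + b s) / 2) `^ p * om s)%:E).
  by rewrite (ge0_integralD nu mP V0 mV EM0 mEM) (ge0_integralZl_EFin nu mP M0 mM E20).
have -> : A%:E * (\int[nu]_(s in P) (a s `^ p * om s)%:E + \int[nu]_(s in P) (b s `^ p * om
  s)%:E) =
    \int[nu]_(s in P) (A%:E * ((a s `^ p * om s)%:E + (b s `^ p * om s)%:E)).
  by rewrite (ge0_integralZl_EFin nu mP XY0 mXY A0) (ge0_integralD nu mP X0 mX Y0 mY).
apply: ge0_le_integral => //.
- exact: (emeasurable_funD mV mEM).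
- exact: (measurable_funeM _ mXY).
move=> s Ps; rewrite -EFinM -!EFinD -EFinM lee_fin.
have := powR_uniform_convexity p_gt1 (a0 _ Ps) (b0 _ Ps) h0.
move/(ler_wpM2r (om_ge0 Ps)); rewrite AE BE -/E.
move: (`|_| `^ p)%R ((_ / 2) `^ p)%R (a s `^ p)%R (b s `^ p)%R => v m x y.
by move: (h `^ p * 2 `^ p)%R => q; lra.
Qed.

Lemma integral_midpoint_convexity (a b : S -> R) :
  measurable_fun P a -> measurable_fun P b ->
  (forall s, P s -> (0 <= a s)%R) -> (forall s, P s -> (0 <= b s)%R) ->
  2%:E * \int[nu]_(s in P) (((a s + b s) / 2) `^ p * om s)%:E <=
  \int[nu]_(s in P) (a s `^ p * om s)%:E + \int[nu]_(s in P) (b s `^ p * om s)%:E.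
Proof.
move=> ma mb a0 b0.
have mm : measurable_fun P (fun s => ((a s + b s) / 2)%R).
  exact: (measurableT_comp (@mulrr_measurable R setT (2^-1)%R) (measurable_funD ma mb)).
have X0 := powR_weight_ge0 a; have mX := measurable_powR_weight ma.
have Y0 := powR_weight_ge0 b; have mY := measurable_powR_weight mb.
have M0 := powR_weight_ge0 (fun s => ((a s + b s) / 2)%R).
have mM := measurable_powR_weight mm.
have -> : \int[nu]_(s in P) (a s `^ p * om s)%:E + \int[nu]_(s in P) (b s `^ p * om s)%:E =
    \int[nu]_(s in P) ((a s `^ p * om s)%:E + (b s `^ p * om s)%:E).
  by rewrite (ge0_integralD nu mP X0 mX Y0 mY).
have -> : 2%:E * \int[nu]_(s in P) (((a s + b s) / 2) `^ p * om s)%:E =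
    \int[nu]_(s in P) (2%:E * (((a s + b s) / 2) `^ p * om s)%:E).
  by rewrite (ge0_integralZl_EFin nu mP M0 mM (ler0n _ 2)).
apply: ge0_le_integral => //.
- by move=> s Ps; apply: mule_ge0 (M0 _ Ps); rewrite lee_fin.
- exact: (measurable_funeM _ mM).
- exact: (emeasurable_funD mX mY).
move=> s Ps; rewrite -EFinM -EFinD lee_fin.
have m0 : (0 <= (a s + b s) / 2)%R by rewrite divr_ge0 ?addr_ge0 ?a0 ?b0.
have h1 := powR_young p_gt1 (a0 _ Ps) m0; have h2 := powR_young p_gt1 (b0 _ Ps) m0.
rewrite mulrA -mulrDl; apply: ler_wpM2r; first exact: om_ge0.
have p1 := p_gt1.
have hm : ((a s + b s) / 2 * ((a s + b s) / 2) `^ (p - 1) = ((a s + b s) / 2) `^ p)%R.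
  by rewrite mulr_powRB1//; lra.
rewrite -hm in h1 h2 *.
have key (x A B u v : R) : (p * x * u <= A + (p - 1) * ((u + v) / 2 * x) ->
    p * x * v <= B + (p - 1) * ((u + v) / 2 * x) -> 2 * ((u + v) / 2 * x) <= A + B)%R.
  by lra.
exact: key h1 h2.
Qed.

Lemma Kmodular_midpoint z g : measurable_fun D z -> measurable_fun D g ->
  J z <= 1 -> J g <= 1 -> J (midpoint z g) <= 1.
Proof.
move=> mz mg Jz Jg.
have mkz := measurable_kf mz; have mkg := measurable_kf mg.
rewrite -(@lee_pmul2l _ 2%:E)// mule1.
apply: (@le_trans _ _ (J z + J g)); last first.
  by apply: (le_trans (leeD Jz Jg)); rewrite -EFinD lee_fin.
rewrite (KmodularE mz Jz) (KmodularE mg Jg).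
apply: le_trans (integral_midpoint_convexity mkz mkg (kf_ge0 z) (kf_ge0 g)).
apply: lee_wpmul2l; first by rewrite lee_fin.
apply: Kmodular_le_integral; first exact: measurable_midpoint.
  exact: (measurableT_comp (@mulrr_measurable R setT (2^-1)%R) (measurable_funD mkz mkg)).
move=> s Ps; apply: le_trans (Kfun_midpoint mz mg _) _; first by rewrite ltW// tau_gt0.
by rewrite (Kfun_fineK mz Jz Ps) (Kfun_fineK mg Jg Ps) -EFinD -EFinM lee_fin mulrC.
Qed.

(** Sublinearity of [K] goes in the right direction: the modular of the midpoint is at most that of
    the mean of [K z] and [K g]. So if the midpoint is almost as large as [z] and [g], then [K z]
    and [K g] are close in L^p. *)
Lemma Kmodular_uniform_convexity z g (h : R) : measurable_fun D z -> measurable_fun D g ->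
  J z <= 1 -> J g <= 1 -> (0 < h)%R ->
  \int[nu]_(s in P) (`|kf z s - kf g s| `^ p * om s)%:E +
    (2 * (uconv_const p / h ^+ 2))%:E * J (midpoint z g) <=
  (h `^ p * 2 `^ p + uconv_const p / h ^+ 2)%:E * (J z + J g).
Proof.
move=> mz mg Jz Jg h0.
have mkz := measurable_kf mz; have mkg := measurable_kf mg.
rewrite (KmodularE mz Jz) (KmodularE mg Jg).
apply: le_trans (integral_uniform_convexity mkz mkg (kf_ge0 z) (kf_ge0 g) h0).
rewrite leeD2l//; apply: lee_wpmul2l.
  by rewrite lee_fin mulr_ge0// divr_ge0 ?(uconv_const_ge0 p_gt1)// exprn_ge0// ltW.
apply: Kmodular_le_integral; first exact: measurable_midpoint.
  exact: (measurableT_comp (@mulrr_measurable R setT (2^-1)%R) (measurable_funD mkz mkg)).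
move=> s Ps; apply: le_trans (Kfun_midpoint mz mg _) _; first by rewrite ltW// tau_gt0.
by rewrite (Kfun_fineK mz Jz Ps) (Kfun_fineK mg Jg Ps) -EFinD -EFinM lee_fin mulrC.
Qed.

(** * Averages of functions with disjoint supports *)

Definition average (z : nat -> T -> \bar R) n : T -> \bar R :=
  fun s => (n.+1%:R^-1)%:E * \sum_(k < n.+1) z k s.

Section Average.
Variable z : nat -> T -> \bar R.
Hypothesis mz : forall k, measurable_fun D (z k).
Hypothesis z0 : forall k s, 0 <= z k s.
Hypothesis Jz : forall k, J (z k) <= 1.

Lemma measurable_sum_z n : measurable_fun D (fun s => \sum_(k < n) z k s).
Proof. by apply: emeasurable_sum => k; exact: mz. Qed.

Lemma measurable_average n : measurable_fun D (average z n).
Proof. by apply: measurable_funeM; exact: measurable_sum_z. Qed.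

Lemma Kfun_sum n t : (0 <= t)%R ->
  K (fun s => \sum_(k < n.+1) z k s) t <= \sum_(k < n.+1) K (z k) t.
Proof.
move=> t0; elim: n => [|n IH].
  rewrite big_ord1; apply: le_Kfun => //; first exact: measurable_sum_z.
  by move=> s _; rewrite big_ord1.
rewrite big_ord_recr/=; apply: le_trans (leeD2r _ IH).
apply: KfunD => //; [exact: measurable_sum_z|exact: measurable_sum_z|].
move=> s _; rewrite big_ord_recr/= (gee0_abs (z0 _ _)) gee0_abs ?adde_ge0 ?sume_ge0//.
by rewrite gee0_abs// sume_ge0.
Qed.

Lemma Kfun_average n t : (0 <= t)%R ->
  K (average z n) t <= (n.+1%:R^-1)%:E * \sum_(k < n.+1) K (z k) t.
Proof.
move=> t0; apply: (@le_trans _ _ ((n.+1%:R^-1)%:E * K (fun s => \sum_(k < n.+1) z k s) t)).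
  apply: KfunZ => //; [exact: measurable_average|exact: measurable_sum_z|].
  by move=> s _; rewrite abseM [`|(n.+1%:R^-1)%:E|]gee0_abs// lee_fin.
by apply: lee_wpmul2l; [rewrite lee_fin|exact: Kfun_sum].
Qed.

Lemma Kfun_average_mean n s : P s ->
  K (average z n) (tau s) <= (n.+1%:R^-1 * \sum_(k < n.+1) kf (z k) s)%:E.
Proof.
move=> Ps; apply: (le_trans (Kfun_average n (ltW (tau_gt0 Ps)))).
rewrite EFinM -sumEFin; apply: lee_wpmul2l; first by rewrite lee_fin.
by apply: lee_sum => k _; rewrite Kfun_fineK.
Qed.

Lemma Kfun_average_fineK n s : P s -> K (average z n) (tau s) = (kf (average z n) s)%:E.
Proof.
move=> Ps; rewrite fineK// ge0_fin_numE ?Kfun_ge0 ?(ltW (tau_gt0 Ps))//.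
by apply: le_lt_trans (ltry _); exact: Kfun_average_mean.
Qed.

(** This is [powR_mean_dist] integrated, with [H] the K-functional of the average and [a k] that of
    [z k]. *)
Lemma Kmodular_average_le n (rho : R) :
  (forall k, \int[nu]_(s in P) (`|kf (z k) s - kf (z 0) s| `^ p * om s)%:E <= rho%:E) ->
  J (average z n) <= (2 `^ p)%:E *
    (\int[nu]_(s in P) (Num.min (kf (average z n) s) (kf (z 0) s) `^ p * om s)%:E + rho%:E).
Proof.
move=> Vrho.
have mkz k := measurable_kf (mz k).
have mka := measurable_kf (measurable_average n).
have mv k : measurable_fun P (fun s => `|kf (z k) s - kf (z 0) s|%R).
  exact: (measurableT_comp (@normr_measurable R setT) (measurable_funB (mkz k) (mkz 0%N))).
have mmin := measurable_minr mka (mkz 0%N).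
apply: (@le_trans _ _ ((2 `^ p)%:E *
    (\int[nu]_(s in P) (Num.min (kf (average z n) s) (kf (z 0) s) `^ p * om s)%:E +
     (n.+1%:R^-1)%:E * \sum_(k < n.+1) \int[nu]_(s in P) (`|kf (z k) s - kf (z 0) s| `^ p *
       om s)%:E))); last first.
  apply: lee_wpmul2l; first by rewrite lee_fin powR_ge0.
  rewrite leeD2l//; apply: (@le_trans _ _ ((n.+1%:R^-1)%:E * \sum_(k < n.+1) rho%:E)).
    by apply: lee_wpmul2l; [rewrite lee_fin|apply: lee_sum].
  by rewrite sumEFin -EFinM sumr_const card_ord -[(rho *+ _)%R]mulr_natl mulKf// pnatr_eq0.
rewrite -ge0_integral_sum//; last 2 first.
  by move=> k; exact: measurable_powR_weight.
  by move=> k s; exact: (powR_weight_ge0 (fun s => `|kf (z k) s - kf (z 0) s|%R)).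
have msum : measurable_fun P (fun s => \sum_(k < n.+1) (`|kf (z k) s - kf (z 0) s| `^ p *
  om s)%:E).
  by apply: emeasurable_sum => k; exact: measurable_powR_weight.
have sum0 s : P s -> 0 <= \sum_(k < n.+1) (`|kf (z k) s - kf (z 0) s| `^ p * om s)%:E.
  by move=> Ps; apply: sume_ge0 => k _; rewrite lee_fin mulr_ge0 ?powR_ge0 ?om_ge0.
rewrite -ge0_integralZl_EFin// -ge0_integralD//; last 4 first.
- by move=> s; exact: (powR_weight_ge0 (fun s => Num.min (kf (average z n) s) (kf (z 0) s))).
- exact: measurable_powR_weight.
- by move=> s Ps; rewrite mule_ge0 ?sum0// lee_fin.
- exact: measurable_funeM.
rewrite -ge0_integralZl_EFin ?powR_ge0//; last 2 first.
- by move=> s Ps; rewrite adde_ge0 ?mule_ge0 ?sum0 ?lee_fin ?mulr_ge0 ?powR_ge0 ?om_ge0.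
- by apply: emeasurable_funD; [exact: measurable_powR_weight|exact: measurable_funeM].
apply: ge0_le_integral => //.
- by move=> s; exact: Kmodular_integrand_ge0.
- by apply: measurable_Kmodular_integrand; exact: measurable_average.
- by apply: measurable_funeM; apply: emeasurable_funD; [exact:
  measurable_powR_weight|exact: measurable_funeM].
- move=> s Ps; rewrite [X in X `^ p * _](Kfun_average_fineK n Ps) poweR_EFin sumEFin.
  rewrite -EFinM -(EFinM n.+1%:R^-1) -EFinD -EFinM lee_fin.
  have := Kfun_average_mean n Ps; rewrite [X in X <= _](Kfun_average_fineK n Ps) lee_fin.
  move=> Hm.
  have := powR_mean_dist p_gt1 (kf_ge0 (average z n) Ps) (fun k => kf_ge0 (z k) Ps) Hm.
  move=> /(ler_wpM2r (om_ge0 Ps))/le_trans; apply.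
  by rewrite -mulrA ler_wpM2l ?powR_ge0// mulrDl -mulrA mulr_suml.
Qed.

Variable A : nat -> set T.
Hypothesis zA : forall k s, z k s != 0 -> (A k `\` A k.+1) s.
Hypothesis Adecr : forall k, A k.+1 `<=` A k.

(** Take the level l = e / (2 t), which costs e / 2. The excess of the average over [l] is the mean
    of the excesses of the disjoint [z k] over (n + 1) l, and for large [n] [excess_uniform] bounds
    each integral by e / 2. *)
Lemma Kfun_average_small t e : (0 < t)%R -> (0 < e)%R ->
  exists N, forall n, (N <= n)%N -> K (average z n) t <= e%:E.
Proof.
move=> t0 e0; have e20 : (0 < e / 2)%R by rewrite divr_gt0.
have [L L0 hL] := excess_uniform e20.
pose l := (e / 2 / t)%R; have l0 : (0 < l)%R by rewrite divr_gt0.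
have Ll0 : (0 <= L / l)%R by rewrite divr_ge0// ltW.
exists (Num.bound (L / l)) => n bn.
pose c : R := (n.+1%:R^-1)%R; have c0 : (0 <= c)%R by rewrite invr_ge0.
pose l' := (n.+1%:R * l)%R.
have l'0 : (0 <= l')%R by rewrite mulr_ge0// ltW.
have cl : (c * l')%R = l by rewrite /c /l' mulKf// pnatr_eq0.
have Ll' : (L <= l')%R.
  rewrite -ler_pdivrMr//; apply: (le_trans (ltW (archi_boundP Ll0))).
  by rewrite ler_nat ltnW.
have mE k : measurable_fun D (excess (z k) l') by exact: measurable_excess.
have E0 k s : D s -> 0 <= excess (z k) l' s by move=> _; exact: excess_ge0.
apply: (le_trans (Kfun_le _ _ _ _ (ltW l0))).
have -> : (l * t = e / 2)%R by rewrite /l divfK// gt_eqF.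
have -> : e%:E = (e / 2)%:E + (e / 2)%:E by rewrite -EFinD -splitr.
rewrite leeD2l//.
apply: (@le_trans _ _ (\int[mu]_(s in D) (c%:E * \sum_(k < n.+1) excess (z k) l' s))).
  apply: ge0_le_integral => //.
  - by move=> *; exact: excess_ge0.
  - by apply: measurable_excess; exact: measurable_average.
  - by apply: measurable_funeM; exact: emeasurable_sum.
  - move=> s Ds; rewrite -cl.
    apply: (@le_trans _ _ (c%:E * excess (fun s => \sum_(k < n.+1) z k s) l' s)).
      apply: excessZ => //.
      by rewrite abseM [`|(n.+1%:R^-1)%:E|]gee0_abs// lee_fin.
    by apply: lee_wpmul2l; [rewrite lee_fin|exact: (excess_disjoint_sum _ _ l'0 z0 zA)].
rewrite ge0_integralZl_EFin//; last 2 first.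
- by move=> s Ds; apply: sume_ge0 => k _; exact: E0.
- exact: emeasurable_sum.
rewrite ge0_integral_sum//; last by move=> k; exact: E0.
apply: (@le_trans _ _ (c%:E * \sum_(k < n.+1) (e / 2)%:E)).
  apply: lee_wpmul2l; first by rewrite lee_fin.
  by apply: lee_sum => k _; exact: hL.
by rewrite sumEFin -EFinM sumr_const card_ord -[(_ *+ _)%R]mulr_natl mulKf// pnatr_eq0.
Qed.

(** Dominated convergence with majorant the integrand of [J (z 0)]; the pointwise limit is
    [Kfun_average_small]. *)
Lemma integral_min_average_small e : (0 < e)%R -> exists n,
  \int[nu]_(s in P) (Num.min (kf (average z n) s) (kf (z 0) s) `^ p * om s)%:E <= e%:E.
Proof.
move=> e0.
pose b s := kf (z 0) s; pose H n s := kf (average z n) s.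
have mb : measurable_fun P b := measurable_kf (mz 0%N).
have mH n : measurable_fun P (H n) := measurable_kf (measurable_average n).
have b0 s : P s -> (0 <= b s)%R := @kf_ge0 (z 0%N) s.
have H0 n s : P s -> (0 <= H n s)%R := @kf_ge0 (average z n) s.
have Hsmall s : P s -> forall e, (0 < e)%R -> exists N, forall n, (N <= n)%N -> (H n s <= e)%R.
  move=> Ps e' e'0; have [N hN] := Kfun_average_small (tau_gt0 Ps) e'0.
  exists N => n Nn; rewrite -lee_fin; apply: le_trans (hN n Nn).
  by rewrite [X in _ <= X](Kfun_average_fineK n Ps).
have Jb : \int[nu]_(s in P) (b s `^ p * om s)%:E <= 1.
  by rewrite -(KmodularE (mz 0%N) (Jz 0%N)).
suff h : exists n, \int[nu]_(s in P) (Num.min (H n s) (b s) `^ p * om s)%:E <= e%:E.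
  by case: h => n hn; exists n.
move: b H mb mH b0 H0 Hsmall Jb => b H mb mH b0 H0 Hsmall Jb.
pose f n s := (Num.min (H n s) (b s) `^ p * om s)%:E.
have f0 n s : P s -> 0 <= f n s by move=> Ps; rewrite lee_fin mulr_ge0 ?powR_ge0 ?om_ge0.
have mf n : measurable_fun P (f n).
  by apply: measurable_powR_weight; exact: measurable_minr (mH n) mb.
have fb n s : P s -> f n s <= (b s `^ p * om s)%:E.
  move=> Ps; rewrite lee_fin ler_wpM2r ?om_ge0//.
  apply: ge0_ler_powR => //; rewrite ?nnegrE ?le_min ?H0 ?b0//.
  by rewrite ge_min lexx orbT.
have cvf s : P s -> f ^~ s @ \oo --> 0.
  move=> Ps; apply/cvge0P => [n|e' e'0]; first exact: f0.
  (* Since [om s] may vanish, the division is by [om s + 1]. *)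
  have om1 : (0 < om s + 1)%R by rewrite ltr_wpDl ?om_ge0.
  have [h h0 hE] := exists_powR_small p_gt1 (divr_gt0 e'0 om1).
  have [N hN] := Hsmall s Ps h h0; exists N => n Nn.
  rewrite lee_fin; apply: (@le_trans _ _ (h `^ p * om s)%R).
    rewrite ler_wpM2r ?om_ge0//; apply: ge0_ler_powR => //.
    - by rewrite nnegrE le_min H0 ?b0.
    - by rewrite nnegrE ltW.
    - by rewrite ge_min hN.
  by rewrite hE mulrAC ler_pdivrMr// ler_wpM2l ?(ltW e'0)// lerDl.
have ib : nu.-integrable P (fun s => (b s `^ p * om s)%:E).
  apply/integrableP; split; first exact: measurable_powR_weight.
  apply: le_lt_trans _ (ltry 1); apply: le_trans _ Jb.
  rewrite le_eqVlt; apply/orP; left; apply/eqP/eq_integral => s; rewrite inE => Ps.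
  by rewrite gee0_abs// (powR_weight_ge0 b).
have fg s n : P s -> `|f n s| <= (b s `^ p * om s)%:E.
  by move=> Ps; rewrite gee0_abs ?fb ?f0.
have [_ _] := @dominated_convergence _ _ _ nu P mP f (cst 0) (fun s => (b s `^ p * om s)%:E)
  mf (measurable_cst _) (aeW nu cvf) ib (aeW nu fg).
rewrite integral0 => /cvge0P h.
have [n|N hN] := h _ e e0; first by apply: integral_ge0 => s; exact: f0.
by exists N; exact: (hN N (leqnn N)).
Qed.

End Average.

(** * Absolute continuity of the pairing with a fixed function *)

Section AbsoluteContinuity.
Variables (y : T -> \bar R) (M : R) (C : nat -> set T).
Hypothesis my : measurable_fun D y.
Hypothesis M0 : (0 <= M)%R.
Hypothesis yM : forall f, measurable_fun D f -> J f <= 1 ->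
  \int[mu]_(s in D) `|f s * y s| <= M%:E.
Hypothesis mC : forall m, measurable (C m).
Hypothesis CS : forall m, C m.+1 `<=` C m.
Hypothesis C0 : forall s, exists m, ~ C m s.

Let Cle i j : (i <= j)%N -> C j `<=` C i.
Proof.
elim: j => [|j IH]; first by rewrite leqn0 => /eqP ->.
by rewrite leq_eqVlt => /predU1P[->//|/IH h] s /CS; exact: h.
Qed.

(* Normalized test functions living on [C m] away from the limit of the [C n]
   and pairing with [y] at least [e]. *)
Definition tail_test (e : R) m z := [/\ measurable_fun D z, (forall s, 0 <= z s),
  J z <= 1, (exists2 m', (m <= m')%N & forall s, z s != 0 -> (C m `\` C m') s) &
  e%:E <= \int[mu]_(s in D) `|z s * y s|].

(** The sets C m minus C (m + n) exhaust [C m] because the [C n] decrease to the empty set. By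
    monotone convergence one of them keeps the pairing above [e], which leaves room for later tests
    with disjoint support. *)
Lemma exists_tail_test e m f : measurable_fun D f -> J f <= 1 ->
  e%:E < \int[mu]_(s in D) `|(f \_ (C m)) s * y s| -> exists z, tail_test e m z.
Proof.
move=> mf Jf ef.
pose B n := C m `\` C (m + n)%N.
have mB n : measurable (B n) by exact: measurableD.
pose z n := (abse \o f) \_ (B n).
have z0 n s : 0 <= z n s by rewrite /z erestrictE; case: ifPn => _ //=.
have mz n : measurable_fun D (z n).
  apply/(measurable_restrict _ (mB n) mD).
  by apply: measurable_funS (measurableT_comp (@abse_measurable R setT) mf) => // s [].
have mfC : measurable_fun D (f \_ (C m)).
  by apply/(measurable_restrict _ (mC m) mD); apply: measurable_funS mf => // s [].
pose g n s := `|z n s * y s|.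
have mg n : measurable_fun D (g n).
  by apply: (measurableT_comp (@abse_measurable R setT)); exact: emeasurable_funM.
have zle n k s : (n <= k)%N -> z n s <= z k s.
  move=> nk; rewrite /z !erestrictE; case: ifPn => [|_]; last by case: ifPn => _ //=.
  rewrite inE => -[Cm Cn]; rewrite ifT// inE; split=> //.
  by apply: contra_not Cn; apply: Cle; rewrite leq_add2l.
have gnd s : D s -> nondecreasing_seq (g ^~ s).
  by move=> _ n k nk; rewrite /g !abseM !(gee0_abs (z0 _ _)); apply: lee_wpmul2r => //;
    exact: zle.
have glim s : limn (g ^~ s) = `|(f \_ (C m)) s * y s|.
  have [N CN] := C0 s.
  apply/cvg_lim => //; apply: cvg_near_cst; exists N => // n /= Nn.
  rewrite /g !abseM /z !erestrictE; congr (_ * _).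
  have nC : ~ C (m + n)%N s by apply: contra_not CN; apply: Cle; rewrite (leq_trans Nn)//
    leq_addl.
  case: ifPn => [/set_mem[Cm _]|]; first by rewrite /= abse_id mem_set//.
  by rewrite notin_setE => nB; rewrite abse0 memNset ?abse0// => Cm; apply: nB.
have cvg_g := @cvg_monotone_convergence _ _ _ mu D mD g mg (fun n s _ => abse_ge0 _) gnd.
have {cvg_g} [n en] : exists n, e%:E <= \int[mu]_(s in D) g n s.
  apply: contrapT => ne; move: ef; apply/negP; rewrite -leNgt.
  under eq_integral do rewrite -glim.
  rewrite -(cvg_lim _ cvg_g)//; apply: lime_le; first by apply/cvg_ex; eexists; exact: cvg_g.
  by apply: nearW => n; rewrite leNgt; apply/negP => /ltW en; apply: ne; exists n.
exists (z n); split; [exact: mz|exact: z0| | |exact: en].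
- apply: le_trans Jf; apply: le_Kmodular => [|//|s _]; first exact: mz.
  by rewrite /z erestrictE; case: ifPn => _; rewrite ?abse_id// abse0.
- exists (m + n)%N; first exact: leq_addr.
  move=> s; rewrite /z erestrictE; case: ifPn => [/set_mem//|_].
  by rewrite eqxx.
Qed.

(** The midpoint with a test of a later stage is still a test of stage [m], so the least modular at
    stage [m] bounds its modular from below. *)
Lemma tail_test_midpoint e m n k z g : (m <= n)%N -> (n <= k)%N ->
  tail_test e m g -> (forall s, g s != 0 -> (C m `\` C n) s) ->
  tail_test e k z -> tail_test e m (midpoint z g).
Proof.
move=> mn nk [mg g0 Jg _ eg] gC [mz z0 Jz [n' kn' zC] ez]; split.
- exact: measurable_midpoint.
- by move=> s; rewrite mule_ge0 ?adde_ge0// lee_fin.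
- exact: Kmodular_midpoint.
- have nn' := leq_trans nk kn'; exists n'; first exact: leq_trans nn'.
  move=> s; have [gs0|/gC[Cm Cn] _] := eqVneq (g s) 0; last first.
    by split=> //; apply: contra_not Cn; exact: Cle.
  have [zs0|/zC[Ck Cn'] _] := eqVneq (z s) 0.
    by rewrite /midpoint zs0 gs0 abse0 adde0 mule0 eqxx.
  by split=> //; exact: (Cle (leq_trans mn nk)).
- have mzy : measurable_fun D (fun s => `|z s * y s|).
    by apply: (measurableT_comp (@abse_measurable R setT)); exact: emeasurable_funM.
  have mgy : measurable_fun D (fun s => `|g s * y s|).
    by apply: (measurableT_comp (@abse_measurable R setT)); exact: emeasurable_funM.
  have -> : \int[mu]_(s in D) `|midpoint z g s * y s| =
      (2^-1)%:E * (\int[mu]_(s in D) `|z s * y s| + \int[mu]_(s in D) `|g s * y s|).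
    rewrite -(ge0_integralD mu mD (fun s _ => abse_ge0 _) mzy (fun s _ => abse_ge0 _) mgy).
    rewrite -ge0_integralZl_EFin//; last 2 first.
    - by move=> s _; exact: adde_ge0.
    - exact: emeasurable_funD.
    apply: eq_integral => s _; rewrite /midpoint !abseM [`|(2^-1)%:E|]gee0_abs ?lee_fin//.
    rewrite -muleA (gee0_abs (adde_ge0 (abse_ge0 _) (abse_ge0 _))).
    by rewrite ge0_muleDl.
  have -> : e = (2^-1 * (e + e))%R by lra.
  rewrite EFinM EFinD.
  by apply: lee_wpmul2l; [rewrite lee_fin|exact: leeD].
Qed.

Lemma pairing_average_ge e (z : nat -> T -> \bar R) n : (forall k, measurable_fun D (z k)) ->
  (forall k s, 0 <= z k s) ->
  (forall k, e%:E <= \int[mu]_(s in D) `|z k s * y s|) ->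
  e%:E <= \int[mu]_(s in D) `|average z n s * y s|.
Proof.
move=> mz z0 ez.
have mzy k : measurable_fun D (fun s => `|z k s * y s|).
  by apply: (measurableT_comp (@abse_measurable R setT)); exact: emeasurable_funM.
have -> : \int[mu]_(s in D) `|average z n s * y s| =
    (n.+1%:R^-1)%:E * \sum_(k < n.+1) \int[mu]_(s in D) `|z k s * y s|.
  rewrite -ge0_integral_sum//.
  rewrite -ge0_integralZl_EFin//; last 2 first.
  - by move=> s _; exact: sume_ge0.
  - exact: emeasurable_sum.
  apply: eq_integral => s _; rewrite /average !abseM [`|(n.+1%:R^-1)%:E|]gee0_abs ?lee_fin//.
  rewrite -muleA gee0_abs ?sume_ge0// ge0_sume_distrl//.
  by congr (_ * _); apply: eq_bigr => k _; rewrite abseM (gee0_abs (z0 _ _)).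
have -> : e%:E = (n.+1%:R^-1)%:E * \sum_(k < n.+1) e%:E.
  by rewrite sumEFin -EFinM sumr_const card_ord -[(e *+ _)%R]mulr_natl mulKf// pnatr_eq0.
by apply: lee_wpmul2l; [rewrite lee_fin|exact: lee_sum].
Qed.

(* Among the tail tests take nearly norm-minimal ones with disjoint supports;
   by convexity their midpoints are nearly minimal as well, so uniform
   convexity puts all the functions [K (z k)] close to [K (z 0)]. Their averages
   are then dominated, up to a small error, by [K (z 0)], and tend to 0
   pointwise because the supports are disjoint, whereas pairing with [y] keeps
   the averages away from 0. *)
Lemma pairing_absolutely_continuous e : (0 < e)%R -> exists m, forall f,
  measurable_fun D f -> J f <= 1 ->
  \int[mu]_(s in D) `|(f \_ (C m)) s * y s| <= e%:E.
Proof.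
move=> e0; apply: contrapT => nH.
have Kne m : exists z, tail_test e m z.
  have [f [mf Jf ef]] : exists f, [/\ measurable_fun D f, J f <= 1 &
      e%:E < \int[mu]_(s in D) `|(f \_ (C m)) s * y s|].
    apply: contrapT => nf; apply: nH; exists m => f mf Jf.
    by rewrite leNgt; apply/negP => ef; apply: nf; exists f.
  exact: exists_tail_test mf Jf ef.
pose dm m := ereal_inf (J @` [set z | tail_test e m z]).
have dm_le1 m : dm m <= 1.
  have [z zm] := Kne m; apply: (@le_trans _ _ (J z)).
    by apply: ereal_inf_lbound; exists z.
  by case: zm.
(* Once dm m0 > sd - sig, near-minimal tests from any stage have modular below sd + sig, while
   midpoints that are tests of stage [m0] have modular above sd - sig. *)
pose sd := ereal_sup (range dm).
have dm_sd m : dm m <= sd by apply: ereal_sup_ubound; exists m.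
have sd1 : sd <= 1 by apply: ge_ereal_sup => _ [m _ <-].
have dm0 m : 0 <= dm m by apply: le_ereal_inf_tmp => _ [z _ <-]; exact: Kmodular_ge0.
have sd0 : 0 <= sd by exact: le_trans (dm0 0%N) (dm_sd 0%N).
have sdfin : sd \is a fin_num by rewrite ge0_fin_numE// (le_lt_trans sd1)// ltry.
have p1 := p_gt1.
(* The average will have modular at most kap^p. Divided by [kap] it is in the unit ball, so its
   pairing is at most kap * M < e, a contradiction. The summand 1 covers M = 0. *)
pose kap : R := (e / (2 * (M + 1)))%R.
have kap0 : (0 < kap)%R by rewrite divr_gt0// mulr_gt0// ltr_wpDl.
have kapM : (kap * M < e)%R.
  rewrite /kap mulrAC ltr_pdivrMr ?mulr_gt0 ?ltr_wpDl// ltr_pM2l//.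
  by have := M0; lra.
(* Three errors share the budget kap^p / 2^p: one [q] for the minimum with [K (z 0)], two for the
   distance of [K (z k)] to [K (z 0)]. *)
pose q : R := (kap `^ p / (3 * 2 `^ p))%R.
have p20 : (0 < 2 `^ p :> R)%R by rewrite powR_gt0.
have q0 : (0 < q)%R by rewrite divr_gt0 ?mulr_gt0 ?powR_gt0.
have qE : (2 `^ p * (q + (q + q)) = kap `^ p)%R.
  by rewrite /q; field; rewrite gt_eqF.
(* As the two modulars sum to at most 2, this choice of [h] makes the h^p term of uniform convexity
   at most [q]. It is fixed before [sig], which depends on it through [E]. *)
have q20 : (0 < q / (2 * 2 `^ p))%R by rewrite divr_gt0// mulr_gt0.
have [h h0 hE] := exists_powR_small p_gt1 q20.
have hq : (h `^ p * 2 `^ p * 2 = q)%R by rewrite hE; field; rewrite gt_eqF.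
pose E : R := (uconv_const p / h ^+ 2)%R.
have E0 : (0 <= E)%R by rewrite divr_ge0 ?(uconv_const_ge0 p_gt1)// exprn_ge0// ltW.
(* The two modulars exceed twice that of the midpoint by less than 4 sig, so the remaining term is
   at most E * 4 sig <= q. *)
pose sig : R := (q / (4 * (E + 1)))%R.
have sig0 : (0 < sig)%R by rewrite divr_gt0// mulr_gt0// ltr_wpDl.
have Esig : (E * (4 * sig) <= q)%R.
  have -> : (E * (4 * sig) = q * (E / (E + 1)))%R by rewrite /sig; field; rewrite gt_eqF//
    ltr_wpDl.
  by rewrite ler_piMr ?(ltW q0)// ler_pdivrMr ?ltr_wpDl//; lra.
have [_ [m0 _ <-] dm_gt] := ub_ereal_sup_adherent sig0 sdfin.
have pick m : exists F : nat * (T -> \bar R), [/\ (m <= F.1)%N, tail_test e m F.2,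
    forall s, F.2 s != 0 -> (C m `\` C F.1) s & J F.2 < sd + sig%:E].
  have : dm m < sd + sig%:E by rewrite (le_lt_trans (dm_sd m))// lteDl.
  move=> /ereal_inf_lt[_ [z zt <-] Jz]; have [_ _ _ [m' mm' zC] _] := zt.
  by exists (m', z).
have [F HF] := choice pick.
(* Each test starts at the stage where the support of the previous one ended. *)
pose ms k := iter k (fun m => (F m).1) m0.
have msS k : (ms k <= ms k.+1)%N by rewrite /ms iterS; have [] := HF (ms k).
have msle i j : (i <= j)%N -> (ms i <= ms j)%N.
  move=> ij; rewrite -(subnKC ij); elim: (j - i)%N => [|u IH]; first by rewrite addn0.
  by rewrite addnS; exact: leq_trans IH (msS _).
pose z k := (F (ms k)).2.
have zt k : tail_test e (ms k) (z k) by have [] := HF (ms k).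
have zC k s : z k s != 0 -> (C (ms k) `\` C (ms k.+1)) s.
  by have [_ _ + _] := HF (ms k); exact.
have Jzs k : J (z k) < sd + sig%:E by have [] := HF (ms k).
have mz k : measurable_fun D (z k) by have [] := zt k.
have z0 k s : 0 <= z k s by have [_ /(_ s)] := zt k.
have Jz k : J (z k) <= 1 by have [] := zt k.
have ez k : e%:E <= \int[mu]_(s in D) `|z k s * y s| by have [] := zt k.
have V k : \int[nu]_(s in P) (`|kf (z k) s - kf (z 0%N) s| `^ p * om s)%:E <= (q + q)%:E.
  have [-> |k0] := posnP k.
    rewrite integral0_eq ?lee_fin ?addr_ge0 ?ltW// => s _.
    by rewrite subrr normr0 powR0 ?mul0r// gt_eqF//; lra.
  have UC := Kmodular_uniform_convexity (mz k) (mz 0%N) (Jz k) (Jz 0%N) h0.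
  have tm : tail_test e m0 (midpoint (z k) (z 0%N)).
    apply: (@tail_test_midpoint e m0 (ms 1%N) (ms k)).
    - exact: (msle 0%N).
    - exact: msle.
    - exact: (zt 0%N).
    - exact: (zC 0%N).
    - exact: (zt k).
  have dJ : dm m0 <= J (midpoint (z k) (z 0%N)).
    by apply: ereal_inf_lbound; exists (midpoint (z k) (z 0%N)).
  have Jm1 : J (midpoint (z k) (z 0%N)) <= 1 by case: tm.
  have Jfin g : J g <= 1 -> J g = (fine (J g))%:E.
    by move=> Jg; rewrite fineK// ge0_fin_numE ?Kmodular_ge0// (le_lt_trans Jg)// ltry.
  have jms := lt_le_trans dm_gt dJ.
  have [jm jmE] : exists jm, J (midpoint (z k) (z 0%N)) = jm%:E by eexists; exact: (Jfin _ Jm1).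
  have toR k' : exists2 jk, J (z k') = jk%:E & (jk <= 1 /\ jk < fine sd + sig)%R.
    exists (fine (J (z k'))); first exact: (Jfin _ (Jz k')).
    split; first by rewrite -lee_fin -(Jfin _ (Jz k')); exact: Jz.
    by rewrite -lte_fin -(Jfin _ (Jz k')) EFinD fineK//; exact: Jzs.
  have [jk jkE [jk1 jks]] := toR k; have [j0 j0E [j01 j0s]] := toR 0%N.
  have {}jms : (fine sd - sig < jm)%R by rewrite -lte_fin EFinB fineK// -jmE.
  move: UC; rewrite jmE jkE j0E -(EFinM (2 * _)) -(EFinD jk) -(EFinM (_ + _)).
  move: (integral _ _ _) => I.
  rewrite -leeBrDr// -EFinB => /le_trans; apply; rewrite lee_fin.
  have hp0 : (0 <= h `^ p * 2 `^ p)%R by rewrite mulr_ge0 ?powR_ge0.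
  have l1 : (h `^ p * 2 `^ p * (jk + j0) <= q)%R.
    by rewrite -hq ler_wpM2l//; lra.
  have l2 : (E * (jk + j0 - 2 * jm) <= q)%R.
    by apply: le_trans Esig; rewrite ler_wpM2l//; lra.
  by rewrite -/E; lra.
have [n hn] := integral_min_average_small mz z0 Jz zC (fun k => Cle (msS k)) q0.
have Javg : J (average z n) <= (kap `^ p)%:E.
  apply: (le_trans (Kmodular_average_le mz z0 Jz n V)).
  by rewrite -qE [leRHS]EFinM; apply: lee_wpmul2l; rewrite ?lee_fin ?powR_ge0//
    [leRHS]EFinD; exact: leeD2r.
have mavg : measurable_fun D (average z n) by exact: measurable_average.
pose f s := (kap^-1)%:E * average z n s.
have ki0 : (0 < kap^-1)%R by rewrite invr_gt0.
have mf : measurable_fun D f by exact: measurable_funeM.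
have absk s : `|f s| = (kap^-1)%:E * `|average z n s|.
  by rewrite abseM [`|(kap^-1)%:E|]gee0_abs// lee_fin ltW.
have Jf : J f <= 1.
  apply: (@le_trans _ _ ((kap^-1 `^ p)%:E * J (average z n))).
    by apply: KmodularZ => // s _; rewrite absk.
  apply: (@le_trans _ _ ((kap^-1 `^ p)%:E * (kap `^ p)%:E)).
    by apply: lee_wpmul2l; rewrite ?lee_fin ?powR_ge0.
  by rewrite -EFinM -(powRM p (ltW ki0) (ltW kap0)) mulVf ?gt_eqF// powR1.
have := yM mf Jf.
have mav : measurable_fun D (fun s => `|average z n s * y s|).
  by apply: (measurableT_comp (@abse_measurable R setT)); exact: emeasurable_funM.
have -> : \int[mu]_(s in D) `|f s * y s| = (kap^-1)%:E * \int[mu]_(s in D) `|average z n s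
  * y s|.
  rewrite -ge0_integralZl_EFin ?(ltW ki0)//.
  by apply: eq_integral => s _; rewrite abseM absk -muleA -abseM.
rewrite lee_pdivrMl// => h1.
have := le_trans (pairing_average_ge n mz z0 ez) h1.
by rewrite -EFinM lee_fin leNgt kapM.
Qed.

End AbsoluteContinuity.

(** Let [C n] be where some later [yn] exceeds h |y|. Off [C n] the pairing is at most h * M by
    uniform boundedness; on it, absolute continuity of the pairing with [y] applies, since the [C n]
    decrease to the empty set. *)
Lemma pairing_order_continuous y (yn : nat -> T -> \bar R) :
  measurable_fun D y ->
  (forall f, measurable_fun D f -> J f < +oo -> \int[mu]_(s in D) `|f s * y s| < +oo) ->
  (forall n, measurable_fun D (yn n)) ->
  (forall n, \forall s \ae mu, D s -> 0 <= yn n s <= `|y s|) ->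
  (\forall s \ae mu, D s -> yn n s @[n --> \oo] --> 0) ->
  forall e, (0 < e)%R -> exists N, forall n, (N <= n)%N -> forall f,
    measurable_fun D f -> J f <= 1 -> \int[mu]_(s in D) `|f s * yn n s| <= e%:E.
Proof.
move=> my yE myn yny yn0 e e0.
have [M M0 yM] := Kmodular_uniform_boundedness my yE.
have [N0 [mN0 muN0 good]] : mu.-negligible (~` [set s | (forall n, D s -> 0 <= yn n s <=
  `|y s|) /\
    (D s -> yn n s @[n --> \oo] --> 0)]).
  exact: (filterI (ae_foralln yny) yn0).
have {}good s : D s -> ~ N0 s -> (forall n, 0 <= yn n s <= `|y s|) /\ (yn n s @[n --> \oo]
  --> 0).
  move=> Ds nN0; suff [h1 h2] : [set s | (forall n, D s -> 0 <= yn n s <= `|y s|) /\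
    (D s -> yn n s @[n --> \oo] --> 0)] s by split=> [n|]; [exact: h1|exact: h2].
  by apply: contrapT => /good.
pose h : R := (e / 2 / (M + 1))%R.
have h0 : (0 < h)%R by rewrite divr_gt0 ?divr_gt0// ltr_wpDl.
have hM : (h * M <= e / 2)%R.
  by rewrite /h mulrAC ler_pdivrMr ?ltr_wpDl// ler_wpM2l ?divr_ge0 ?ltW//; lra.
(* The sets [C n] must have empty intersection at every point, so the exceptional null set is
   removed first. *)
pose G := D `\` N0.
have mG : measurable G by exact: measurableD.
have GD : G `<=` D by move=> s [].
pose C n := \bigcup_(m in [set m | (n <= m)%N]) (G `&` [set s | h%:E * `|y s| < yn m s]).
have mC n : measurable (C n).
  apply: bigcup_measurable => m _; apply: measurable_lte => //.
    apply: measurable_funeM; apply: (measurableT_comp (@abse_measurable R setT)).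
    exact: measurable_funS my.
  exact: measurable_funS (myn m).
have CS n : C n.+1 `<=` C n.
  by move=> s [m /= nm Hm]; exists m => //=; exact: ltnW.
have C0 s : exists n, ~ C n s.
  have [[Ds nN]|nG] := pselect (G s); last by exists 0%N => -[m _ [/nG]].
  have [yns ycvg] := good s Ds nN.
  have yns0 n : 0 <= yn n s by have /andP[] := yns n.
  have ynle n : yn n s <= `|y s| by have /andP[] := yns n.
  have [N hN] : exists N, forall n, (N <= n)%N -> yn n s <= h%:E * `|y s|.
    have [y0|y0] := eqVneq `|y s| 0.
      by exists 0%N => n _; rewrite y0 mule0 -y0.
    have [yy|yy] := eqVneq `|y s| +oo.
      by exists 0%N => n _; rewrite yy gt0_muley ?leey.
    have yfin : `|y s| \is a fin_num by rewrite ge0_fin_numE// ltey.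
    have r0 : (0 < h * fine `|y s|)%R by rewrite mulr_gt0// fine_gt0// lt0e y0 abse_ge0 ltey.
    have [N hN] := (cvge0P yns0).1 ycvg _ r0; exists N => n /hN.
    by rewrite EFinM fineK.
  by exists N => -[k /= Nk [_ /=]]; rewrite ltNge hN.
have e20 : (0 < e / 2)%R by rewrite divr_gt0.
have [m hm] := pairing_absolutely_continuous my M0 yM mC CS C0 e20.
exists m => n mn f mf Jf.
have mfy : measurable_fun D (fun s => `|f s * y s|).
  by apply: (measurableT_comp (@abse_measurable R setT)); exact: emeasurable_funM.
have mfC : measurable_fun D (f \_ (C m)).
  by apply/(measurable_restrict _ (mC m) mD); apply: measurable_funS mf => // s [].
have mfCy : measurable_fun D (fun s => `|(f \_ (C m)) s * y s|).
  by apply: (measurableT_comp (@abse_measurable R setT)); exact: emeasurable_funM.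
have mhfy := measurable_funeM h%:E mfy.
have hfy0 s : D s -> 0 <= h%:E * `|f s * y s| by move=> _; rewrite mule_ge0// lee_fin ltW.
have := leeD (lee_wpmul2l (_ : 0 <= h%:E) (yM f mf Jf)) (hm f mf Jf).
rewrite lee_fin => /(_ (ltW h0)) => B.
apply: le_trans (le_trans B _); last by rewrite -EFinM -EFinD lee_fin; lra.
rewrite -(ge0_integralZl_EFin mu mD (fun s _ => abse_ge0 _) mfy (ltW h0)).
rewrite -(ge0_integralD mu mD hfy0 mhfy (fun s _ => abse_ge0 _) mfCy).
apply: ae_ge0_le_integral => //.
- by apply: (measurableT_comp (@abse_measurable R setT)); exact: emeasurable_funM.
- by move=> s Ds; rewrite adde_ge0// hfy0.
- exact: emeasurable_funD.
exists N0; split=> // s /= /not_implyP[Ds /negP]; rewrite -ltNge => h1.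
apply: contrapT => nN; have [/(_ n)/andP[yn0' yny'] _] := good s Ds nN.
move: h1; apply/negP; rewrite -leNgt !abseM erestrictE.
case: ifPn => [_|nC].
  by rewrite (gee0_abs yn0') lee_paddl ?mule_ge0 ?lee_fin ?(ltW h0)//; apply: lee_wpmul2l.
rewrite abse0 mul0e adde0 muleCA; apply: lee_wpmul2l => //.
rewrite (gee0_abs yn0') leNgt; apply/negP => yh; move/negP: nC; apply.
by rewrite inE; exists n.
Qed.

(** Dominated convergence twice: for the excesses at a fixed level, which gives K (fn n) t --> 0,
    then for the modular. The excess of [f] over any l > 0 is integrable because K f t < l * t for
    some [t], which forces a near-optimal level below [l]. *)
Lemma Kmodular_order_continuous f (fn : nat -> T -> \bar R) :
  measurable_fun D f -> J f < +oo ->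
  (forall l : R, (0 < l)%R -> exists2 t, (0 < t)%R & K f t < (l * t)%:E) ->
  (forall n, measurable_fun D (fn n)) ->
  (forall n, \forall s \ae mu, D s -> 0 <= fn n s <= `|f s|) ->
  (\forall s \ae mu, D s -> fn n s @[n --> \oo] --> 0) ->
  J (fn n) @[n --> \oo] --> 0.
Proof.
move=> mf Jf Kl mfn fnf fn0.
have fnle n : \forall s \ae mu, D s -> `|fn n s| <= `|f s|.
  by apply: filterS (fnf n) => s + Ds => /(_ Ds)/andP[h1 h2]; rewrite gee0_abs.
have Kfin t : (0 < t)%R -> K f t < +oo.
  move=> t0; have [u u0 Ku] := Kl 1%R ltr01.
  have {}Ku : K f u < +oo by rewrite (lt_trans Ku)// ltry.
  have [tu|/ltW ut] := leP t u.
    by apply: le_lt_trans Ku; exact: Kfun_nd.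
  have := Kfun_ratio mu D f u0 ut.
  rewrite -lee_pdivlMl// => /le_lt_trans; apply.
  rewrite lte_mul_pinfty ?lee_fin ?invr_ge0 ?ltW//.
  by rewrite lte_mul_pinfty ?lee_fin ?ltW.
have Ifin l : (0 < l)%R -> \int[mu]_(s in D) excess f l s < +oo.
  move=> l0; have [t t0 Kt] := Kl l l0.
  have [l' l'0 h] := Kfun_lt Kt.
  have I0 := integral_excess_ge0 mu D f l'.
  have l'l : (l' <= l)%R.
    by rewrite -(ler_pM2r t0) -lee_fin; apply: le_trans (ltW h); rewrite leeDl.
  apply: (@le_lt_trans _ _ (\int[mu]_(s in D) excess f l' s)).
    apply: ge0_le_integral => //.
    - by move=> *; exact: excess_ge0.
    - exact: measurable_excess.
    - exact: measurable_excess.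
    - by move=> s _; apply: le_excess.
  apply: le_lt_trans (ltry (l * t)); apply: le_trans (ltW h).
  by rewrite leeDr// lee_fin mulr_ge0// ltW.
have Icvg l : (0 < l)%R -> \int[mu]_(s in D) excess (fn n) l s @[n --> \oo] --> 0.
  move=> l0.
  have ie : mu.-integrable D (excess f l).
    apply/integrableP; split; first exact: measurable_excess.
    apply: le_lt_trans (Ifin l l0); rewrite le_eqVlt; apply/orP; left; apply/eqP.
    by apply: eq_integral => s _; rewrite gee0_abs// excess_ge0.
  have mfe n : measurable_fun D (excess (fn n) l) by exact: measurable_excess.
  have cvgae : {ae mu, forall s, D s -> excess (fn n) l s @[n --> \oo] --> 0}.
    apply: filterS2 (ae_foralln fnf) fn0 => s h1 h2 Ds.
    have fns0 n : 0 <= fn n s by have /andP[] := h1 n Ds.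
    apply/(cvge0P (fun n => excess_ge0 _ _ _)) => e e0.
    have [N hN] := (cvge0P fns0).1 (h2 Ds) l l0; exists N => n Nn.
    apply: excess_leP; first by rewrite lee_fin ltW.
    rewrite gee0_abs//; apply: (le_trans (hN n Nn)).
    by rewrite leeDr// lee_fin ltW.
  have dom : {ae mu, forall s n, D s -> `|excess (fn n) l s| <= excess f l s}.
    apply: filterS (ae_foralln fnle) => s h n Ds; rewrite gee0_abs ?excess_ge0//.
    by apply: le_excess => //; exact: h.
  have [_ _] := @dominated_convergence _ _ _ mu D mD (fun n => excess (fn n) l) (cst 0)
    (excess f l) mfe (measurable_cst _) cvgae ie dom.
  by rewrite integral0.
have Kcvg t : (0 < t)%R -> forall e : R, (0 < e)%R -> exists N, forall n, (N <= n)%N -> K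
  (fn n) t <= e%:E.
  move=> t0 e e0; have e20 : (0 < e / 2)%R by rewrite divr_gt0.
  have l0 : (0 < e / 2 / t)%R by rewrite divr_gt0.
  have I0 n := integral_excess_ge0 mu D (fn n) (e / 2 / t).
  have [N hN] := (cvge0P I0).1 (Icvg _ l0) _ e20; exists N => n Nn.
  apply: (le_trans (Kfun_le _ _ _ _ (ltW l0))).
  by rewrite divfK ?gt_eqF// [e in leRHS]splitr EFinD leeD2l// hN.
have KK n t : K (fn n) t <= K f t by exact: ae_le_Kfun.
have iJ : nu.-integrable P (fun s => K f (tau s) `^ p * (om s)%:E).
  apply/integrableP; split; first exact: measurable_Kmodular_integrand.
  apply: le_lt_trans Jf; rewrite le_eqVlt; apply/orP; left; apply/eqP.
  by apply: eq_integral => s; rewrite inE => Ps; rewrite gee0_abs// Kmodular_integrand_ge0.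
have mi n : measurable_fun P (fun s => K (fn n) (tau s) `^ p * (om s)%:E).
  exact: measurable_Kmodular_integrand.
have cvgP : forall s, P s -> K (fn n) (tau s) `^ p * (om s)%:E @[n --> \oo] --> 0.
  move=> s Ps; apply/(cvge0P (fun n => Kmodular_integrand_ge0 (fn n) Ps)) => e e0.
  have om1 : (0 < om s + 1)%R by rewrite ltr_wpDl ?om_ge0.
  have [h h0 hE] := exists_powR_small p_gt1 (divr_gt0 e0 om1).
  have [N hN] := Kcvg _ (tau_gt0 Ps) h h0; exists N => n Nn.
  apply: (@le_trans _ _ ((h `^ p)%:E * (om s)%:E)).
    apply: lee_wpmul2r; first by rewrite lee_fin om_ge0.
    rewrite -poweR_EFin; apply: le_poweR => //; last exact: hN.
    by rewrite Kfun_ge0// ltW// tau_gt0.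
  by rewrite -EFinM lee_fin hE mulrAC ler_pdivrMr// ler_wpM2l ?(ltW e0)// lerDl.
have domP s n : P s -> `|K (fn n) (tau s) `^ p * (om s)%:E| <= K f (tau s) `^ p * (om s)%:E.
  move=> Ps; rewrite gee0_abs ?Kmodular_integrand_ge0//.
  apply: lee_wpmul2r; first by rewrite lee_fin om_ge0.
  by apply: le_poweR => //; rewrite Kfun_ge0// ltW// tau_gt0.
have [_ _] := @dominated_convergence _ _ _ nu P mP
  (fun n s => K (fn n) (tau s) `^ p * (om s)%:E) (cst 0) _ mi (measurable_cst _)
  (aeW nu cvgP) iJ (aeW nu domP).
by rewrite integral0.
Qed.

End OrderContinuityOfDual.

(** * Rearrangements *)

Section Lebesgue.
Context {R : realType}.
Notation L := (lebesgueType R).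
Notation D := (half_line R).
Notation lm := (leb R : {measure set L -> \bar R}).

Lemma borel_lebesgue (A : set R) :
  @measurable _ (measurableTypeR R) A -> @measurable _ L A.
Proof. exact: sub_caratheodory. Qed.

Lemma measurable_fun_lebesgue d (U : measurableType d) (E : set R) (f : R -> U) :
  @measurable _ (measurableTypeR R) E ->
  @measurable_fun _ _ (measurableTypeR R) U E f -> @measurable_fun _ _ L U E f.
Proof. by move=> mE mf _ B mB; apply: borel_lebesgue; exact: mf. Qed.

Lemma lebesgue_itv_measurable (i : interval R) : @measurable _ L [set` i].
Proof. by apply: borel_lebesgue; exact: measurable_itv. Qed.

Lemma half_line_measurable : @measurable _ L D.
Proof. exact: lebesgue_itv_measurable. Qed.

Lemma leb_itv0 (x : \bar R) : 0 <= x ->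
  lm [set l : R | (0 <= l)%R /\ l%:E < x] = x.
Proof. exact: lebesgue_measure_itv0. Qed.

Variable x : R -> \bar R.
Hypothesis mx : lebesgue_measurable_fun x.
Notation dist := (distribution_fun x).
Notation xr := (rearrangement x).

Let mabs : @measurable_fun _ _ L _ D (fun s => `|x s|).
Proof. by apply: (measurableT_comp (@abse_measurable R setT)). Qed.

Lemma measurable_level (l : \bar R) : @measurable _ L (D `&` [set s | l < `|x s|]).
Proof. exact: (emeasurable_fun_o_infty half_line_measurable mabs). Qed.

Lemma distribution_ge0 l : 0 <= dist l.
Proof. exact: measure_ge0. Qed.

Lemma distribution_anti l l' : (l <= l')%R -> dist l' <= dist l.
Proof.
move=> ll; apply: le_measure; rewrite ?inE; [exact: measurable_level|exact: measurable_level|].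
move=> s [Ds /= h]; split=> //=; by rewrite (le_lt_trans _ h)// lee_fin.
Qed.

(** Right continuity of the distribution function: the sets where |x| > l + 1/(n+1) increase to the
    one where |x| > l. *)
Lemma distribution_right l (t : \bar R) : t < dist l -> exists2 l', (l < l')%R & t < dist l'.
Proof.
move=> tl; apply: contrapT => nl.
have h n : dist (l + n.+1%:R^-1) <= t.
  rewrite leNgt; apply/negP => h; apply: nl; exists (l + n.+1%:R^-1)%R => //.
  by rewrite ltrDl invr_gt0.
pose F n := D `&` [set s | (l + n.+1%:R^-1)%:E < `|x s|].
have cF : leb R (F n) @[n --> \oo] --> leb R (\bigcup_n F n).
  apply: nondecreasing_cvg_mu => [n||].
  - exact: measurable_level.
  - by apply: bigcup_measurable => n _; exact: measurable_level.
  - move=> n m nm; apply/subsetPset => s [Ds /= hs]; split => //=.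
    by rewrite (le_lt_trans _ hs)// lee_fin lerD2l lef_pV2 ?posrE// ler_nat.
have FU : \bigcup_n F n = D `&` [set s | l%:E < `|x s|].
  apply/seteqP; split => [s [n _ [Ds /= hs]]|s [Ds /= hs]].
    by split => //=; rewrite (le_lt_trans _ hs)// lee_fin lerDl invr_ge0.
  have [n hn] : exists n, (l + n.+1%:R^-1)%:E < `|x s|.
    move: hs; case: `|x s| => [r| |//].
      rewrite lte_fin => lr; have rl0 : (0 < r - l)%R by rewrite subr_gt0.
      exists (Num.bound (r - l)^-1); rewrite lte_fin -ltrBrDl.
      rewrite invf_plt ?posrE//; apply: lt_trans (_ : (Num.bound (r - l)^-1)%:R < _)%R;
        last by rewrite ltr_nat.
      by apply: archi_boundP; rewrite invr_ge0 ltW.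
    by move=> _; exists 0%N; exact: ltry.
  by exists n.
move: tl; apply/negP; rewrite -leNgt /distribution_fun -FU.
rewrite -(cvg_lim _ cF)//; apply: lime_le; first by apply/cvg_ex; eexists; exact: cF.
exact: nearW.
Qed.

Lemma rearrangement_ge0 s : 0 <= xr s.
Proof. by apply: le_ereal_inf_tmp => _ [l [l0 _] <-]; rewrite lee_fin ltW. Qed.

(** The Galois connection between the distribution function and its generalized inverse; strictness
    rests on [distribution_right]. Superlevel sets of the rearrangement are thus intervals of length
    [dist l]. *)
Lemma lt_rearrangement l s : (0 <= l)%R -> (l%:E < xr s) = (s%:E < dist l).
Proof.
move=> l0; apply/idP/idP => [|h].
  apply: contraTT; rewrite -!leNgt => dl; apply/lee_addgt0Pr => e e0.
  apply: ereal_inf_lbound; exists (l + e)%R => //; split; first by rewrite ltr_wpDl.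
  by apply: le_trans dl; apply: distribution_anti; rewrite lerDl ltW.
have [l' ll' h'] := distribution_right h.
apply: (@lt_le_trans _ _ l'%:E); first by rewrite lte_fin.
apply: le_ereal_inf_tmp => _ [l'' [_ dl''] <-]; rewrite lee_fin leNgt; apply/negP => l''l'.
move: h'; apply/negP; rewrite -leNgt; apply: le_trans dl''.
by apply: distribution_anti; exact: ltW.
Qed.

Lemma measurable_rearrangement : @measurable_fun _ _ L _ D xr.
Proof.
apply: (measurability _ (ErealGenOInfty.measurableE R)) => // _ [_ [c ->] <-].
have [c0|c0] := leP 0%R c.
  have -> : D `&` xr @^-1` `]c%:E, +oo[ = [set s : R | (0 <= s)%R /\ s%:E < dist c].
    by apply/seteqP; split => s; rewrite /half_line/= !in_itv/= !andbT lt_rearrangement.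
  by apply: borel_lebesgue; exact: measurable_itv0.
have -> : D `&` xr @^-1` `]c%:E, +oo[ = D.
  apply/seteqP; split => s /=; first by case.
  move=> Ds; split => //; rewrite in_itv/= andbT (lt_le_trans _ (rearrangement_ge0 _))//.
exact: half_line_measurable.
Qed.

Lemma rearrangement_anti s s' : (s <= s')%R -> xr s' <= xr s.
Proof.
move=> ss; apply: le_ereal_inf_tmp => _ [l [l0 dl] <-]; apply: ereal_inf_lbound.
by exists l => //; split=> //; apply: (le_trans dl); rewrite lee_fin.
Qed.

(* Hardy's formula [t * x^** t = inf_l (l t + int (|x| - l)^+)], the infimum
   being attained at [l = x^* t]. *)
Lemma integral_rearrangement t : (0 < t)%R ->
  \int[leb R]_(s in `[0%R, t]) xr s = Kfun (leb R) D x t.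
Proof.
move=> t0.
have mD := half_line_measurable.
have mI : @measurable _ L `[0%R, t]%classic := lebesgue_itv_measurable _.
have ID : `[0%R, t]%classic `<=` D by move=> s; rewrite /half_line/= !in_itv/= andbT => /andP[].
have mr : @measurable_fun _ _ L _ `[0%R, t]%classic xr.
  exact: measurable_funS mD ID measurable_rearrangement.
have mer l : @measurable_fun _ _ L _ `[0%R, t]%classic (excess xr l) by exact:
  measurable_excess.
have absr s : `|xr s| = xr s by rewrite gee0_abs ?rearrangement_ge0.
have lebI : lm `[0%R, t]%classic = t%:E.
  transitivity (@lebesgue_measure R `[0%R, t]%classic); first by [].
  by rewrite lebesgue_measure_itv/= lte_fin t0 oppr0 adde0.
have level f r l s : (0 <= l)%R -> (l%:E < excess f r s) = ((l + r)%:E < `|f s|).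
  move=> l0; have l0' : (l%:E < 0) = false by apply/negbTE; rewrite -leNgt lee_fin.
  by rewrite /excess lt_max l0' orbF lteBrDr// EFinD.
have distE r l : (0 <= r)%R -> (0 <= l)%R ->
    lm (D `&` [set s | l%:E < excess x r s]) = dist (l + r).
  move=> r0 l0; rewrite /distribution_fun; congr (completed_lebesgue_measure (_ `&` _)).
  by apply/seteqP; split => s /=; rewrite level.
have rearrE r l : (0 <= r)%R -> (0 <= l)%R ->
    `[0%R, t] `&` [set s | l%:E < excess xr r s] =
    `[0%R, t] `&` [set s | (0 <= s)%R /\ s%:E < dist (l + r)].
  move=> r0 l0; apply/seteqP; split => s [Is /=].
    rewrite level// absr lt_rearrangement ?addr_ge0// => h; split => //; split => //.
    by move: Is; rewrite /= in_itv/= => /andP[].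
  by move=> [_ h]; split => //=; rewrite level// absr lt_rearrangement ?addr_ge0.
have er0 r s : `[0%R, t]%classic s -> 0 <= excess xr r s by move=> _; exact: excess_ge0.
have ex0 r s : D s -> 0 <= excess x r s by move=> _; exact: excess_ge0.
have mex r : @measurable_fun _ _ L _ D (excess x r) by exact: measurable_excess.
have mJ r l : @measurable _ L (`[0%R, t] `&` [set s | (0 <= s)%R /\ s%:E < dist (l + r)]).
  by apply: measurableI => //; apply: borel_lebesgue; exact: measurable_itv0.
have mJ' r l : @measurable _ L [set s | (0 <= s)%R /\ s%:E < dist (l + r)].
  by apply: borel_lebesgue; exact: measurable_itv0.
have sumE r : (0 <= r)%R -> \int[leb R]_(s in `[0%R, t]) (r%:E + excess xr r s) =
    (r * t)%:E + \int[leb R]_(s in `[0%R, t]) excess xr r s.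
  move=> r0; have r0' s : `[0%R, t]%classic s -> 0 <= cst r%:E s by rewrite lee_fin.
  have := ge0_integralD (leb R) mI r0' (measurable_cst _) (er0 r) (mer r).
  by rewrite integral_cst// lebI -EFinM.
apply/eqP; rewrite eq_le; apply/andP; split.
  (* For an arbitrary level [r], the level intervals of the rearrangement cut to [0, t] are no
     longer than the level sets of |x| are large. *)
  apply: le_KfunP => r r0.
  apply: (@le_trans _ _ (\int[leb R]_(s in `[0%R, t]) (r%:E + excess xr r s))).
    apply: (@ge0_le_integral _ L R (leb R) _ mI).
    - by move=> s _; exact: rearrangement_ge0.
    - exact: mr.
    - exact: (emeasurable_funD (measurable_cst _) (mer r)).
    - by move=> s _; rewrite addeC -[leLHS]absr abse_le_excess.
  rewrite sumE// leeD2l//.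
  apply: (le_layers mI mD (mer r) (mex r) (er0 r) (ex0 r)) => u u0.
  rewrite rearrE// distE// -[leRHS]leb_itv0 ?distribution_ge0//.
  by apply: le_measure; rewrite ?inE; [exact: mJ|exact: mJ'|move=> s []].
(* The optimal level is the value of the rearrangement at [t]; it is finite because [t] times it is
   at most the integral. *)
have [->|Iy] := eqVneq (\int[leb R]_(s in `[0%R, t]) xr s) +oo; first exact: leey.
have rtI : xr t * t%:E <= \int[leb R]_(s in `[0%R, t]) xr s.
  rewrite -lebI -(integral_cst (leb R) mI); apply: (@ge0_le_integral _ L R (leb R) _ mI).
  - by move=> s _; exact: rearrangement_ge0.
  - exact: measurable_cst.
  - exact: mr.
  - by move=> s; rewrite /= in_itv/= => /andP[_ st]; exact: rearrangement_anti.
have [r r0 rE] : exists2 r : R, (0 <= r)%R & xr t = r%:E.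
  have rfin : xr t \is a fin_num.
    rewrite ge0_fin_numE ?rearrangement_ge0// ltey; apply: contra_neq Iy => xry.
    by move: rtI; rewrite xry gt0_mulye ?lte_fin// leye_eq => /eqP.
  by exists (fine (xr t)); rewrite ?fineK// fine_ge0 ?rearrangement_ge0.
apply: (le_trans (Kfun_le _ _ _ _ r0)).
have -> : \int[leb R]_(s in `[0%R, t]) xr s = \int[leb R]_(s in `[0%R, t]) (r%:E + excess
  xr r s).
  apply: eq_integral => s; rewrite inE/= in_itv/= => /andP[_ st].
  have rs : r%:E <= xr s by rewrite -rE rearrangement_anti.
  by rewrite /excess absr max_l ?suber_ge0// [RHS]addeC subeK.
rewrite sumE// leeD2l//.
apply: (le_layers mD mI (mex r) (mer r) (ex0 r) (er0 r)) => u u0.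
rewrite rearrE// distE//.
(* At the optimal level these intervals already fit into [0, t], so restricting to [0, t] loses
   nothing. *)
have dt : dist (u + r) <= t%:E.
  by rewrite leNgt -lt_rearrangement ?addr_ge0// rE lte_fin -leNgt lerDr.
rewrite -[leLHS]leb_itv0 ?distribution_ge0//.
apply: le_measure; rewrite ?inE; [exact: mJ'|exact: mJ|].
move=> s /= [s0 sd]; split => //; rewrite in_itv/= s0/= -lee_fin.
by rewrite (le_trans _ dt)// ltW.
Qed.

End Lebesgue.

(** * The space Gamma_{p,w} *)

Section Gamma.
Context {R : realType}.
Notation L := (lebesgueType R).
Notation D := (half_line R).
Notation lm := (leb R : {measure set L -> \bar R}).
Notation P := (`]0%R, +oo[%classic : set R).
Notation lmeas := (@measurable_fun _ _ L _).

Lemma lt0_itv (s : R) : P s -> (0 < s)%R.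
Proof. by rewrite /= in_itv/= andbT. Qed.

Lemma measurable_pos : @measurable _ L P.
Proof. exact: lebesgue_itv_measurable. Qed.

Lemma leb_set1 (a : R) : lm [set a] = 0.
Proof. exact: (@lebesgue_measure_set1 R a). Qed.

(** Passes from the closed intervals of the definitions to open ones, where the formulas with
    negative powers are valid. *)
Lemma integral_closed_open (a : R) (E F : set R) (f : R -> \bar R) :
  @measurable _ L F -> lmeas F f -> (forall s, F s -> 0 <= f s) -> 0 <= f a ->
  ~ F a -> E = a |` F ->
  \int[lm]_(s in E) f s = \int[lm]_(s in F) f s.
Proof.
move=> mF mf f0 fa0 nF ->.
have m0 : @measurable _ L [set a] by apply: borel_lebesgue; exact: measurable_set1.
have mf1 : lmeas [set a] f by exact: measurable_fun_set1.
rewrite (@ge0_integral_setU _ L R lm _ _ m0 mF).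
- rewrite (@null_set_integral _ L R lm _ f m0 mf1 (leb_set1 _)).
  by rewrite add0e.
- exact/(measurable_funU _ m0 mF).
- by move=> s [->//|/f0].
- by rewrite disj_set2E; apply/eqP/seteqP; split => // s [/= -> /nF].
Qed.

Lemma half_lineE : D = 0%R |` P.
Proof.
apply/seteqP; split => s; rewrite /half_line/= !in_itv/= !andbT.
  by rewrite le_eqVlt => /predU1P[<-|]; [left|right].
by move=> [->|/ltW].
Qed.

Lemma itv0E (t : R) : (0 <= t)%R -> `[0%R, t]%classic = 0%R |` `]0%R, t]%classic.
Proof.
move=> t0; apply/seteqP; split => s; rewrite /= !in_itv/=.
  by move=> /andP[]; rewrite le_eqVlt => /predU1P[<-|-> ->]; [left|right].
by move=> [->|/andP[/ltW -> ->//]]; rewrite lexx.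
Qed.

(** By monotonicity in [t], superlevel sets are intervals. *)
Lemma measurable_Kfun (f : R -> \bar R) : lmeas P (fun s => Kfun lm D f s).
Proof.
apply: (measurability _ (ErealGenOInfty.measurableE R)) => // _ [_ [c ->] <-].
apply: borel_lebesgue; apply: is_interval_measurable => u v /= [Pu Ku] [Pv _] z /andP[uz zv].
split; first by rewrite /= in_itv/= andbT (lt_le_trans (lt0_itv Pu)).
move: Ku; rewrite /= !in_itv/= !andbT => Ku.
exact: lt_le_trans Ku (Kfun_nd _ _ _ uz).
Qed.

Variables (p : R) (w : R -> R).
Hypothesis p_gt1 : ((1 : R) < p)%R.
Hypothesis w_weight : weight w.

Let p_ge0 : (0 <= p)%R. Proof. by have := p_gt1; lra. Qed.
Let p_gt0 : (0 < p)%R. Proof. by have := p_gt1; lra. Qed.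

Definition tail_density (s : R) : R := (s `^ (- p) * w s)%R.

Lemma w_ge0 s : P s -> (0 <= w s)%R.
Proof. by move=> /lt0_itv s0; apply: w_weight.2; rewrite /half_line/= in_itv/= ltW. Qed.

Lemma tail_density_ge0 s : P s -> (0 <= tail_density s)%R.
Proof. by move=> Ps; rewrite mulr_ge0 ?powR_ge0 ?w_ge0. Qed.

Lemma pos_sub_half_line : P `<=` D.
Proof. by rewrite half_lineE; exact: subsetUr. Qed.

Lemma measurable_w : lmeas P w.
Proof. exact: measurable_funS half_line_measurable pos_sub_half_line w_weight.1. Qed.

Lemma measurable_powRL (E : set R) q : @measurable _ (measurableTypeR R) E ->
  lmeas E (fun s : R => s `^ q)%R.
Proof.
move=> mE; apply: measurable_fun_lebesgue => //.
exact: measurable_funS measurableT (@subsetT _ _) (@measurable_powR R q).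
Qed.

Lemma measurable_tail_density : lmeas P tail_density.
Proof.
apply: measurable_funM; last exact: measurable_w.
by apply: measurable_powRL; exact: measurable_itv.
Qed.

Definition Gamma_modular := Kmodular lm D lm P id tail_density p.
Notation J := Gamma_modular.

Lemma Gamma_modular_ge0 f : 0 <= J f.
Proof. by apply: Kmodular_ge0; exact: tail_density_ge0. Qed.

(** By [integral_rearrangement] the maximal function is K x t / t, and the factor t^-p is moved into
    the weight. *)
Lemma Gamma_normE x : L0 x -> Gamma_norm p w x = J x `^ p^-1.
Proof.
move=> mx; rewrite /Gamma_norm; congr (_ `^ _).
have eqP_ s : P s -> maximal_fun x s `^ p * (w s)%:E = Kfun lm D x s `^ p * (tail_density s)%:E.
  move=> /lt0_itv s0; rewrite /maximal_fun integral_rearrangement//.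
  have si0 : (0 <= s^-1)%R by rewrite invr_ge0 ltW.
  rewrite poweRM ?lee_fin ?Kfun_ge0 ?(ltW s0)// poweR_EFin [_%:E * _]muleC -muleA -EFinM.
  by rewrite /tail_density powRN -powR_inv1 ?(ltW s0)// -powRrM mulN1r powRN.
rewrite (@integral_closed_open 0%R D P).
- by apply: eq_integral => s; rewrite inE => Ps; rewrite eqP_.
- exact: measurable_pos.
- apply: (@eq_measurable_fun _ _ L _ _ (fun s => Kfun lm D x s `^ p * (tail_density s)%:E)).
    by move=> s; rewrite inE => Ps; rewrite eqP_.
  apply: emeasurable_funM; last exact/measurable_EFinP/measurable_tail_density.
  by apply: (measurableT_comp (measurable_poweR p)); exact: measurable_Kfun.
- by move=> s Ps; rewrite mule_ge0 ?poweR_ge0// lee_fin w_ge0.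
- by rewrite mule_ge0 ?poweR_ge0// lee_fin; apply: w_weight.2; rewrite /half_line/=
  in_itv/= lexx.
- by rewrite /= in_itv/= ltxx.
- exact: half_lineE.
Qed.

Lemma Gamma_norm_le1 x : L0 x -> (Gamma_norm p w x <= 1) = (J x <= 1).
Proof.
move=> mx; rewrite Gamma_normE//; apply/idP/idP => h.
  have -> : J x = (J x `^ p^-1) `^ p.
    by rewrite -poweRrM mulVf ?gt_eqF// poweRe1// Gamma_modular_ge0.
  by apply: le_trans (le_poweR p_ge0 (poweR_ge0 _ _) h) _; rewrite poweR1r.
have pi0 : (0 <= p^-1)%R by rewrite invr_ge0.
by apply: le_trans (le_poweR pi0 (Gamma_modular_ge0 x) h) _; rewrite poweR1r.
Qed.

Lemma GammaP x : Gamma p w x <-> L0 x /\ J x < +oo.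
Proof.
split=> -[mx h]; split=> //; move: h; rewrite Gamma_normE//.
  by apply: lty_poweRy; rewrite invr_eq0 gt_eqF.
exact: poweR_lty.
Qed.

(** * Consequences of infinite mass near 0 *)

Hypothesis w_nondeg : forall t : R, (0 < t)%R ->
  \int[leb R]_(s in `[0%R, t]) (w s * s `^ (- p))%:E = +oo.

Let mP := measurable_pos.

Lemma measurable_EFin_tail_density : lmeas P (fun s => (tail_density s)%:E).
Proof. exact/measurable_EFinP/measurable_tail_density. Qed.

Lemma EFin_tail_density_ge0 s : P s -> 0 <= (tail_density s)%:E.
Proof. by move=> Ps; rewrite lee_fin tail_density_ge0. Qed.

Lemma integral_tail_density : \int[lm]_(s in P) (tail_density s)%:E = +oo.
Proof.
have I1 : @measurable _ L (`]0%R, 1%R]%classic : set R) := lebesgue_itv_measurable _.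
have sub : (`]0%R, 1%R]%classic : set R) `<=` P.
  by move=> s; rewrite /= !in_itv/= andbT => /andP[].
have m1 : lmeas `]0%R, 1%R]%classic (fun s => (tail_density s)%:E) := measurable_funS mP
  sub measurable_EFin_tail_density.
have := w_nondeg ltr01.
have -> : \int[leb R]_(s in `[0%R, 1%R]) (w s * s `^ (- p))%:E
    = \int[lm]_(s in `[0%R, 1%R]%classic) (tail_density s)%:E.
  by apply: eq_integral => s _; rewrite /tail_density mulrC.
rewrite (@integral_closed_open 0%R `[0%R, 1%R]%classic `]0%R, 1%R]%classic _ I1 m1).
- move=> h; apply/eqP; rewrite -leye_eq -[leLHS]h.
  exact: (@ge0_subset_integral _ L R lm _ _ I1 mP _ measurable_EFin_tail_density
    EFin_tail_density_ge0 sub).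
- by move=> s /sub; exact: EFin_tail_density_ge0.
(* By convention the power of 0 with exponent -p is 0, so the integrand vanishes at the end
   point. *)
- by rewrite lee_fin /tail_density powR0 ?mul0r// oppr_eq0 gt_eqF.
- by rewrite /= in_itv/= ltxx.
- exact: itv0E.
Qed.

Lemma itv_sub_P (t : R) : (0 < t)%R -> (`[t, +oo[%classic : set R) `<=` P.
Proof. by move=> t0 s; rewrite /= !in_itv/= !andbT; exact: lt_le_trans. Qed.

Lemma tail_density_unbounded c : exists2 t : R, (0 < t)%R &
  c%:E <= \int[lm]_(s in `[t, +oo[) (tail_density s)%:E.
Proof.
pose F n : set L := `[((n.+1%:R^-1)%R : R), +oo[%classic.
have Fpos n : (0 < n.+1%:R^-1 :> R)%R by rewrite invr_gt0.
have FP n : F n `<=` P by exact: itv_sub_P.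
have mF n : measurable (F n) := lebesgue_itv_measurable _.
have ndF : nondecreasing_seq F.
  move=> n m nm; apply/subsetPset => s; rewrite /F /= !in_itv/= !andbT.
  by apply: le_trans; rewrite lef_pV2 ?posrE// ler_nat.
have FU : \bigcup_n F n = P.
  apply/seteqP; split => [s [n _ /FP//]|s /lt0_itv s0].
  exists (Num.bound s^-1) => //; rewrite /F /= in_itv/= andbT.
  have si0 : (0 < s^-1)%R by rewrite invr_gt0.
  rewrite invf_ple ?posrE//; apply: le_trans (ltW (archi_boundP (ltW si0))) _.
  by rewrite ler_nat.
have mf n : measurable_fun (F n) (fun s => (tail_density s)%:E) := measurable_funS mP (FP
  n) measurable_EFin_tail_density.
have f0 n s : F n s -> 0 <= (tail_density s)%:E by move=> /FP; exact: EFin_tail_density_ge0.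
have cF := @ge0_nondecreasing_set_cvg_integral _ L R F _ lm ndF mF mf f0.
apply: contrapT => nt.
have : limn (fun n => \int[lm]_(s in F n) (tail_density s)%:E) <= c%:E.
  apply: lime_le; first by apply/cvg_ex; eexists; exact: cF.
  apply: nearW => n; rewrite leNgt; apply/negP => /ltW h; apply: nt.
  by exists (n.+1%:R^-1)%R.
by rewrite (cvg_lim _ cF)// FU integral_tail_density leye_eq.
Qed.

(** A Chebyshev bound: the K-functional is nondecreasing, hence at least [Kfun lm D f t] on the
    whole tail. *)
Lemma Gamma_modular_ge_tail f t : (0 < t)%R ->
  Kfun lm D f t `^ p * \int[lm]_(s in `[t, +oo[) (tail_density s)%:E <= J f.
Proof.
move=> t0; have sub := itv_sub_P t0.
have mt : @measurable _ L `[t, +oo[%classic := lebesgue_itv_measurable _.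
have mot : lmeas `[t, +oo[%classic (fun s => (tail_density s)%:E) := measurable_funS mP sub
  measurable_EFin_tail_density.
have ot0 s : `[t, +oo[%classic s -> 0 <= (tail_density s)%:E by move=> /sub; exact:
  EFin_tail_density_ge0.
have mK : lmeas P (fun s => Kfun lm D f s `^ p * (tail_density s)%:E).
  apply: emeasurable_funM; last exact: measurable_EFin_tail_density.
  by apply: (measurableT_comp (measurable_poweR p)); exact: measurable_Kfun.
have K0 s : P s -> 0 <= Kfun lm D f s `^ p * (tail_density s)%:E.
  by move=> Ps; rewrite mule_ge0 ?poweR_ge0// EFin_tail_density_ge0.
rewrite -(@ge0_integralZl _ L R lm _ mt _ mot _ ot0 (poweR_ge0 _ _)).
apply: le_trans (@ge0_subset_integral _ L R lm _ _ mt mP _ mK K0 sub).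
apply: (@ge0_le_integral _ L R lm _ mt).
- by move=> s h; apply: mule_ge0; [exact: poweR_ge0|exact: ot0].
- exact: measurable_funeM.
- exact: measurable_funS mP sub mK.
- move=> s ts; apply: lee_wpmul2r; first exact: ot0.
  apply: le_poweR => //; first by rewrite Kfun_ge0// ltW.
  by apply: Kfun_nd; move: ts; rewrite /= in_itv/= andbT.
Qed.

(** Take [t] so small that the mass of the tail from [t] on is at least e^-p. *)
Lemma Gamma_Kfun_uniform e : (0 < e)%R -> exists2 t : R, (0 < t)%R &
  forall f : R -> \bar R, lmeas D f -> J f <= 1 -> Kfun lm D f t <= e%:E.
Proof.
move=> e0; have ep0 : (0 < e `^ p)%R by rewrite powR_gt0.
have [t t0 ht] := tail_density_unbounded (e `^ p)^-1; exists t => // f mf Jf.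
have K0 : 0 <= Kfun lm D f t by rewrite Kfun_ge0// ltW.
have Kp : Kfun lm D f t `^ p <= (e `^ p)%:E.
  have := le_trans (lee_wpmul2l (poweR_ge0 _ p) ht) (le_trans (Gamma_modular_ge_tail f t0) Jf).
  by rewrite muleC lee_pdivrMl// mule1.
have -> : Kfun lm D f t = (Kfun lm D f t `^ p) `^ p^-1.
  by rewrite -poweRrM mulfV ?gt_eqF// poweRe1.
apply: le_trans (le_poweR _ (poweR_ge0 _ _) Kp) _; first by rewrite invr_ge0.
by rewrite poweR_EFin -powRrM mulfV ?gt_eqF// powRr1// ltW.
Qed.

(** Otherwise K f s >= l * s everywhere; the powers of [s] cancel and the modular is at least l^p
    times the integral of [w]. *)
Lemma Kfun_decay f l : \int[leb R]_(s in `[0%R, +oo[) (w s)%:E = +oo ->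
  J f < +oo -> (0 < l)%R -> exists2 t, (0 < t)%R & Kfun lm D f t < (l * t)%:E.
Proof.
move=> Woo Jf l0; apply: contrapT => nt.
have h s : P s -> (l * s)%:E <= Kfun lm D f s.
  by move=> /lt0_itv s0; rewrite leNgt; apply/negP => hs; apply: nt; exists s.
have mw : lmeas P (fun s => (w s)%:E) by exact/measurable_EFinP/measurable_w.
have w0 s : P s -> 0 <= (w s)%:E by move=> Ps; rewrite lee_fin w_ge0.
have lp0 : (0 < l `^ p)%R by rewrite powR_gt0.
have : (l `^ p)%:E * \int[lm]_(s in P) (w s)%:E <= J f.
  rewrite -(@ge0_integralZl_EFin _ L R lm _ mP _ w0 mw _ (ltW lp0)).
  apply: (@ge0_le_integral _ L R lm _ mP).
  - by move=> s Ps; rewrite mule_ge0 ?w0// lee_fin ltW.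
  - exact: measurable_funeM.
  - apply: emeasurable_funM; last exact: measurable_EFin_tail_density.
    by apply: (measurableT_comp (measurable_poweR p)); exact: measurable_Kfun.
  - move=> s Ps; have s0 := lt0_itv Ps.
    apply: (@le_trans _ _ ((l * s)%:E `^ p * (tail_density s)%:E)); last first.
      apply: lee_wpmul2r; first exact: EFin_tail_density_ge0.
      by apply: le_poweR => //; [rewrite lee_fin mulr_ge0// ltW|exact: h].
    rewrite poweR_EFin -!EFinM lee_fin powRM ?(ltW l0) ?(ltW s0)// /tail_density powRN.
    by rewrite -mulrA mulVKf// gt_eqF// powR_gt0.
have -> : \int[lm]_(s in P) (w s)%:E = +oo.
  rewrite -(@integral_closed_open 0%R D P)//.
  - by rewrite lee_fin; apply: w_weight.2; rewrite /half_line/= in_itv/= lexx.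
  - by rewrite /= in_itv/= ltxx.
  - exact: half_lineE.
by rewrite gt0_muley ?lte_fin// leye_eq => /eqP Jy; move: Jf; rewrite Jy ltxx.
Qed.

(** * Failure of order continuity for weights of finite integral *)

Definition tail_indicator (n : nat) (s : R) : \bar R := (\1_`[n%:R, +oo[ s)%:E.

Lemma measurable_tail_indicator n : lmeas D (tail_indicator n).
Proof.
apply/measurable_EFinP; apply: measurable_indic.
exact: lebesgue_itv_measurable.
Qed.

Lemma tail_indicator_ge0 n s : 0 <= tail_indicator n s.
Proof. by rewrite lee_fin indicE ler0n. Qed.

Lemma tail_indicator_le1 n s : tail_indicator n s <= 1.
Proof. by rewrite lee_fin indicE; case: (s \in _). Qed.

(** A level l >= 1 already costs l * t, and a level l < 1 leaves an excess 1 - l on a set of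
    infinite measure. *)
Lemma le_Kfun_tail_indicator n t : (0 <= t)%R -> t%:E <= Kfun lm D (tail_indicator n) t.
Proof.
move=> t0; have mD : @measurable _ L D := half_line_measurable.
apply: le_KfunP => l l0; have [l1|l1] := leP 1%R l.
  apply: (@le_trans _ _ (l * t)%:E); first by rewrite lee_fin ler_peMl.
  by rewrite leeDl// integral_excess_ge0.
have mI : @measurable _ L `[n%:R : R, +oo[%classic := lebesgue_itv_measurable _.
have ID : `[n%:R : R, +oo[%classic `<=` D.
  by move=> s; rewrite /half_line /= !in_itv/= !andbT; apply: le_trans.
have mex : lmeas D (excess (tail_indicator n) l) := measurable_excess l
  (measurable_tail_indicator n).
have l1' : (0 < 1 - l)%R by rewrite subr_gt0.
have : \int[lm]_(s in `[n%:R : R, +oo[%classic) (1 - l)%:E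
    <= \int[lm]_(s in D) excess (tail_indicator n) l s.
  apply: le_trans (@ge0_subset_integral _ L R lm _ _ mI mD _ mex _ ID); last first.
    by move=> s _; exact: excess_ge0.
  apply: (@ge0_le_integral _ L R lm _ mI).
  - by move=> s _; rewrite lee_fin ltW.
  - exact: measurable_cst.
  - exact: measurable_funS mD ID mex.
  - move=> s Is; rewrite /excess /tail_indicator indicE mem_set// le_max.
    by rewrite /= normr1 EFinB lexx.
rewrite (@integral_cst _ L R lm _ mI).
have -> : lm `[n%:R : R, +oo[%classic = +oo.
  by rewrite [LHS](@lebesgue_measure_itv R `[n%:R, +oo[) /= ltry.
by rewrite gt0_muley ?lte_fin// leye_eq => /eqP ->; rewrite addey// leey.
Qed.

Lemma le_integral_Kmodular_tail n : \int[lm]_(s in P) (w s)%:E <= J (tail_indicator n).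
Proof.
have mw : lmeas P (fun s => (w s)%:E) by exact/measurable_EFinP/measurable_w.
have w0 s : P s -> 0 <= (w s)%:E by move=> Ps; rewrite lee_fin w_ge0.
apply: (@ge0_le_integral _ L R lm _ mP _ _ w0 mw).
  apply: emeasurable_funM; last exact: measurable_EFin_tail_density.
  by apply: (measurableT_comp (measurable_poweR p)); exact: measurable_Kfun.
move=> s Ps; have s0 := lt0_itv Ps.
have -> : (w s)%:E = s%:E `^ p * (tail_density s)%:E.
  by rewrite poweR_EFin -EFinM /tail_density powRN mulVKf// gt_eqF// powR_gt0.
apply: lee_wpmul2r; first exact: EFin_tail_density_ge0.
apply: le_poweR => //; first by rewrite lee_fin ltW.
by apply: le_Kfun_tail_indicator; exact: ltW.
Qed.

Lemma Kmodular_cst1 : J (cst 1) <= \int[lm]_(s in P) (w s)%:E.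
Proof.
have mw : lmeas P (fun s => (w s)%:E) by exact/measurable_EFinP/measurable_w.
apply: (@ge0_le_integral _ L R lm _ mP _ _ _ _ mw).
- by move=> s Ps; rewrite mule_ge0 ?poweR_ge0 ?EFin_tail_density_ge0.
- apply: emeasurable_funM; last exact: measurable_EFin_tail_density.
  by apply: (measurableT_comp (measurable_poweR p)); exact: measurable_Kfun.
move=> s Ps; have s0 := lt0_itv Ps.
have -> : (w s)%:E = s%:E `^ p * (tail_density s)%:E.
  by rewrite poweR_EFin -EFinM /tail_density powRN mulVKf// gt_eqF// powR_gt0.
apply: lee_wpmul2r; first exact: EFin_tail_density_ge0.
apply: le_poweR => //; first by rewrite Kfun_ge0// ltW.
apply: le_trans (Kfun_le _ _ _ _ ler01) _.
rewrite mul1r (@integral0_eq _ L R lm) ?adde0// => u _.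
by rewrite /excess /= normr1 subee// maxxx.
Qed.

(** Otherwise [w] would vanish a.e., against the infinite mass near 0. It makes the lower bound for
    the norms of the tail indicators positive. *)
Lemma integral_weight_neq0 : \int[lm]_(s in P) (w s)%:E != 0.
Proof.
have mw : lmeas P (fun s => (w s)%:E) by exact/measurable_EFinP/measurable_w.
have w0 s : P s -> 0 <= (w s)%:E by move=> Ps; rewrite lee_fin w_ge0.
apply/eqP => wz; have := integral_tail_density.
have [wae _] := @ae_eq_integral_abs _ L R lm _ mP _ mw.
have -> : \int[lm]_(s in P) (tail_density s)%:E = \int[lm]_(s in P) cst 0 s.
  apply: (@ae_eq_integral _ L R lm _ _ _ mP measurable_EFin_tail_density _ _) => //.
  apply: filterS (wae _).
    by move=> s h Ps; have := h Ps; rewrite /tail_density => -[->]; rewrite mulr0.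
  by rewrite -[RHS]wz; apply: eq_integral => s; rewrite inE => Ps; rewrite gee0_abs// w0.
by rewrite integral0.
Qed.

Lemma order_continuous_integral_weight :
  order_continuous (Gamma p w) (Gamma_norm p w) ->
  \int[leb R]_(s in `[0%R, +oo[) (w s)%:E = +oo.
Proof.
move=> oc; apply/eqP; rewrite -leye_eq leNgt; apply/negP => Wfin.
have mD : @measurable _ L D := half_line_measurable.
have W' : \int[lm]_(s in P) (w s)%:E < +oo.
  apply: le_lt_trans Wfin; apply: (@ge0_subset_integral _ L R lm _ _ mP mD _ _ _
    pos_sub_half_line).
    exact/measurable_EFinP/w_weight.1.
  by move=> s Ds; rewrite lee_fin w_weight.2.
have m1 : lmeas D (cst 1 : R -> \bar R) by exact: measurable_cst.
have J1 : J (cst 1) < +oo := le_lt_trans Kmodular_cst1 W'.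
have mt := measurable_tail_indicator.
have Jt n : J (tail_indicator n) < +oo.
  apply: le_lt_trans J1; apply: (@le_Kmodular _ L R lm D mD _ L lm P mP id tail_density p
    p_gt1 lt0_itv tail_density_ge0
    measurable_tail_density (fun f _ => measurable_Kfun f) _ _ (mt n) m1).
  by move=> s _; rewrite gee0_abs ?tail_indicator_ge0// /= normr1 tail_indicator_le1.
have pi0 : (0 <= p^-1)%R by rewrite invr_ge0.
have G1 : Gamma p w (cst 1) by apply/GammaP.
have Gt n : Gamma p w (tail_indicator n) by apply/GammaP; split; [exact: mt|exact: Jt].
have h1 n : \forall s \ae leb R, D s -> 0 <= tail_indicator n s <= `|(cst 1 : R -> \bar R) s|.
  apply: aeW => s _; rewrite tail_indicator_ge0/=.
  by rewrite /= normr1 tail_indicator_le1.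
have h2 : \forall s \ae leb R, D s -> tail_indicator n s @[n --> \oo] --> 0.
  apply: aeW => s _; apply: cvg_near_cst.
  exists (Num.bound `|s|%R) => // n /= ns; rewrite /tail_indicator indicE memNset//.
  rewrite /= in_itv/= andbT; apply/negP; rewrite -ltNge.
  apply: le_lt_trans (ler_norm s) _; apply: lt_le_trans (archi_boundP (normr_ge0 s)) _.
  by rewrite ler_nat.
have cv := oc _ _ G1 Gt h1 h2.
have : (\int[lm]_(s in P) (w s)%:E) `^ p^-1 <= 0.
  rewrite -(cvg_lim _ cv)//; apply: lime_ge; first by apply/cvg_ex; eexists; exact: cv.
  apply: nearW => n; rewrite Gamma_normE; last exact: mt.
  apply: le_poweR => //; last exact: le_integral_Kmodular_tail.
  by apply: integral_ge0 => s Ps; rewrite lee_fin w_ge0.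
have W0 : 0 <= \int[lm]_(s in P) (w s)%:E.
  by apply: integral_ge0 => s Ps; rewrite lee_fin w_ge0.
rewrite le_eqVlt ltNge poweR_ge0 orbF poweR_eq0// => /andP[W00 _].
by move: integral_weight_neq0; rewrite W00.
Qed.

Lemma Gamma_order_continuous :
  \int[leb R]_(s in `[0%R, +oo[) (w s)%:E = +oo ->
  order_continuous (Gamma p w) (Gamma_norm p w).
Proof.
move=> Woo x x_ /GammaP[mx Jx] Gx_ xle xcv.
have mx_ n : lmeas D (x_ n) := (Gx_ n).1.
have mD : @measurable _ L D := half_line_measurable.
have Jcv := @Kmodular_order_continuous _ L R lm D mD _ L lm P mP id tail_density p p_gt1 lt0_itv
  tail_density_ge0 measurable_tail_density (fun f _ => measurable_Kfun f) x x_ mx Jx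
  (fun l => Kfun_decay Woo Jx) mx_ xle xcv.
have N0 n : 0 <= Gamma_norm p w (x_ n) by exact: poweR_ge0.
have J0 n : 0 <= J (x_ n) by exact: Gamma_modular_ge0.
apply/(cvge0P N0) => e e0; have ep0 : (0 < e `^ p)%R by rewrite powR_gt0.
have [N hN] := (cvge0P J0).1 Jcv _ ep0; exists N => n Nn.
have pi0 : (0 <= p^-1)%R by rewrite invr_ge0.
rewrite Gamma_normE; last exact: mx_.
apply: le_trans (le_poweR pi0 (J0 n) (hN n Nn)) _.
by rewrite poweR_EFin -powRrM mulfV ?gt_eqF// powRr1// ltW.
Qed.

Lemma Kmodular_cst0 : J (cst 0) = 0.
Proof.
have K0 s : P s -> Kfun lm D (cst 0) s = 0.
  move=> /lt0_itv s0; apply/eqP; rewrite eq_le Kfun_ge0 ?(ltW s0)// andbT.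
  apply: le_trans (Kfun_le _ _ _ _ (lexx 0%R)) _.
  rewrite mul0r add0e (@integral0_eq _ L R lm)// => u _.
  by rewrite /excess /= normr0 subee// maxxx.
rewrite /Gamma_modular /Kmodular (@integral0_eq _ L R lm)// => s Ps.
by rewrite /= K0// poweR0r ?gt_eqF// mul0e.
Qed.

Lemma associate_Gamma_order_continuous :
  order_continuous (associate (Gamma p w)) (associate_norm (Gamma p w) (Gamma_norm p w)).
Proof.
move=> y y_ [my Gy] Gy_ yle ycv.
have my_ n : lmeas D (y_ n) := (Gy_ n).1.
have mD : @measurable _ L D := half_line_measurable.
have yE f : lmeas D f -> J f < +oo -> \int[lm]_(s in D) `|f s * y s| < +oo.
  by move=> mf Jf; apply: Gy; apply/GammaP.
(* The zero function is in the unit ball, so the supremum is over a nonempty set of nonnegative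
   values. *)
have N0 n : 0 <= associate_norm (Gamma p w) (Gamma_norm p w) (y_ n).
  have m0 : lmeas D (cst 0 : R -> \bar R) by exact: measurable_cst.
  apply: le_trans (ereal_sup_ubound _); last first.
    exists (cst 0) => //; split; first by apply/GammaP; rewrite Kmodular_cst0.
    by rewrite Gamma_norm_le1// Kmodular_cst0.
  by apply: integral_ge0 => s _; exact: abse_ge0.
apply/(cvge0P N0) => e e0.
have [N hN] := @pairing_order_continuous _ L R lm D mD _ L lm P mP id tail_density p p_gt1
  lt0_itv
  tail_density_ge0 measurable_tail_density (fun f _ => measurable_Kfun f)
    Gamma_Kfun_uniform y y_ my yE my_ yle ycv e e0.
exists N => n Nn; apply: ge_ereal_sup => _ [x [[mx _] xN1] <-].
by apply: hN => //; rewrite -Gamma_norm_le1.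
Qed.

End Gamma.

(** * The dual weight *)

Section DyadicSum.
Context {R : realType}.
Notation L := (lebesgueType R).
Notation D := (half_line R).
Notation lm := (leb R : {measure set L -> \bar R}).
Notation P := (`]0%R, +oo[%classic : set R).
Notation lmeas := (@measurable_fun _ _ L _).

Lemma nondecreasing_measurable_pos (f : R -> R) :
  (forall s t, (0 < s)%R -> (s <= t)%R -> (f s <= f t)%R) -> lmeas P f.
Proof.
move=> fnd; apply: (measurability _ (RGenOInfty.measurableE R)) => // _ [_ [c ->] <-].
apply: borel_lebesgue; apply: is_interval_measurable => u v /= [Pu fu] [Pv _] z /andP[uz zv].
have u0 := lt0_itv Pu.
split; first by rewrite /= in_itv/= andbT (lt_le_trans u0).
move: fu; rewrite /= !in_itv/= !andbT => fu.
exact: lt_le_trans fu (fnd _ _ u0 uz).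
Qed.

Variables (p : R) (w : R -> R).
Hypothesis p_gt1 : ((1 : R) < p)%R.
Hypothesis w_weight : weight w.
Hypothesis w_Dp : class_D p w.

Let p_ge0 : (0 <= p)%R. Proof. by have := p_gt1; lra. Qed.
Let p_gt0 : (0 < p)%R. Proof. by have := p_gt1; lra. Qed.

Definition primitive t : R := fine (W w t).
(** [Wp] without its factor t^p; in this form it is monotone. *)
Definition cotail t : R := fine (\int[leb R]_(s in `[t, +oo[) (s `^ (- p) * w s)%:E).
Notation Wr := primitive.
Notation A := cotail.

Let mP : @measurable _ L P := measurable_pos.

Lemma W_ge0 t : 0 <= W w t.
Proof.
apply: integral_ge0 => s; rewrite /= in_itv/= => /andP[s0 _].
by rewrite lee_fin w_weight.2// /half_line/= in_itv/= s0.
Qed.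

Lemma W_fin t : (0 < t)%R -> (Wr t)%:E = W w t.
Proof. by move=> t0; rewrite fineK// ge0_fin_numE ?W_ge0//; exact: (w_Dp t0).1. Qed.

Lemma tail_ge0 t : (0 < t)%R -> 0 <= \int[leb R]_(s in `[t, +oo[) (s `^ (- p) * w s)%:E.
Proof.
move=> t0; apply: integral_ge0 => s ts.
by apply: EFin_tail_density_ge0 => //; exact: itv_sub_P ts.
Qed.

Lemma tail_fin t : (0 < t)%R ->
  (A t)%:E = \int[lm]_(s in `[t, +oo[%classic) (tail_density p w s)%:E.
Proof.
move=> t0; rewrite fineK// ge0_fin_numE ?tail_ge0//.
have := (w_Dp t0).2; rewrite /Wp; have := tail_ge0 t0.
case: (\int[_]_(_ in _) _) => [r _ _| _|//]; first by rewrite ltry.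
by rewrite gt0_muley ?lte_fin ?powR_gt0.
Qed.

Lemma fine_Wp t : (0 < t)%R -> fine (Wp p w t) = (t `^ p * A t)%R.
Proof. by move=> t0; rewrite /Wp -[X in _ * X]tail_fin. Qed.

Lemma primitive_ge0 t : (0 <= Wr t)%R.
Proof. exact/fine_ge0/W_ge0. Qed.

Lemma cotail_ge0 t : (0 < t)%R -> (0 <= A t)%R.
Proof. by move=> t0; apply/fine_ge0/tail_ge0. Qed.

Lemma integral_open_tail a : (0 < a)%R ->
  \int[lm]_(u in `[a, +oo[%classic) (tail_density p w u)%:E
  = \int[lm]_(u in `]a, +oo[%classic) (tail_density p w u)%:E.
Proof.
move=> a0; have sub : `]a, +oo[%classic `<=` P.
  by move=> u; rewrite /= !in_itv/= !andbT; exact: lt_trans.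
have mo := measurable_EFin_tail_density p w_weight; have o0 := EFin_tail_density_ge0 p w_weight.
apply: (@integral_closed_open _ a).
- exact: lebesgue_itv_measurable.
- exact: measurable_funS mP sub mo.
- by move=> u /sub /o0.
- by apply: o0; rewrite /= in_itv/= andbT.
- by rewrite /= in_itv/= ltxx.
- by apply/seteqP; split => u; rewrite /= !in_itv/= !andbT;
    [rewrite le_eqVlt => /predU1P[<-|]; [left|right]|move=> [->|/ltW]].
Qed.

Lemma cotail_split s t : (0 < s)%R -> (s <= t)%R ->
  (A s)%:E = \int[lm]_(u in `]s, t]%classic) (tail_density p w u)%:E + (A t)%:E.
Proof.
move=> s0 st; have t0 := lt_le_trans s0 st.
have mo := measurable_EFin_tail_density p w_weight; have o0 := EFin_tail_density_ge0 p w_weight.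
have mI : @measurable _ L `]s, t]%classic := lebesgue_itv_measurable _.
have mt : @measurable _ L `]t, +oo[%classic := lebesgue_itv_measurable _.
have sE : `]s, +oo[%classic = `]s, t]%classic `|` `]t, +oo[%classic.
  by rewrite -itv_bndbnd_setU// bnd_simp.
have sub : `]s, +oo[%classic `<=` P.
  by move=> u; rewrite /= !in_itv/= !andbT; exact: lt_trans.
rewrite !tail_fin// !integral_open_tail// sE (@ge0_integral_setU _ L R lm _ _ mI mt)//.
- by rewrite -sE; exact: measurable_funS mP sub mo.
- by rewrite -sE => u /sub /o0.
- rewrite disj_set2E; apply/eqP/seteqP; split => // u [].
  by rewrite /= !in_itv/= andbT => /andP[_ ut]; rewrite ltNge ut.
Qed.

(** On ]s, t] the weight is u^p times the density of the tail, with s^p <= u^p <= t^p. The two-point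
    comparisons of [fundamental] below rest on it. *)
Lemma primitive_cotail_itv s t : (0 < s)%R -> (s <= t)%R ->
  (s `^ p * (A s - A t) <= Wr t - Wr s <= t `^ p * (A s - A t))%R.
Proof.
move=> s0 st; have t0 := lt_le_trans s0 st.
pose I : set L := `]s, t]%classic.
have mI : measurable I := lebesgue_itv_measurable _.
have IP : I `<=` P by move=> u; rewrite /I /= !in_itv/= andbT => /andP[/(lt_trans s0)].
have mw : lmeas P (fun s => (w s)%:E) by exact/measurable_EFinP/measurable_w.
have w0 u : P u -> 0 <= (w u)%:E by move=> Pu; rewrite lee_fin w_ge0.
have mo := measurable_EFin_tail_density p w_weight; have o0 := EFin_tail_density_ge0 p w_weight.
pose X := \int[lm]_(u in I) (w u)%:E; pose Y := \int[lm]_(u in I) (tail_density p w u)%:E.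
have X0 : 0 <= X by apply: integral_ge0 => u /IP /w0.
have Y0 : 0 <= Y by apply: integral_ge0 => u /IP /o0.
have WX : W w t = W w s + X.
  have m0s : @measurable _ L `[0%R, s]%classic := lebesgue_itv_measurable _.
  have tE : `[0%R, t]%classic = `[0%R, s]%classic `|` I.
    by rewrite -itv_bndbnd_setU// bnd_simp// ltW.
  have tD : `[0%R, t]%classic `<=` D.
    by move=> u; rewrite /half_line /= !in_itv/= andbT => /andP[].
  have mwD : lmeas D (fun s => (w s)%:E) by exact/measurable_EFinP/w_weight.1.
  rewrite /W tE (@ge0_integral_setU _ L R lm _ _ m0s mI)//.
  - by rewrite -tE; exact: measurable_funS half_line_measurable tD mwD.
  - by rewrite -tE => u /tD Du; rewrite lee_fin w_weight.2.
  - rewrite disj_set2E; apply/eqP/seteqP; split => // u [].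
    by rewrite /I /= !in_itv/= => /andP[_ us] /andP[]; rewrite ltNge us.
have AY : (A s)%:E = Y + (A t)%:E := cotail_split s0 st.
have Xfin : X \is a fin_num.
  rewrite ge0_fin_numE//; apply: le_lt_trans (w_Dp t0).1.
  by rewrite WX leeDr// W_ge0.
have Yfin : Y \is a fin_num.
  rewrite ge0_fin_numE//; apply: (@le_lt_trans _ _ (A s)%:E); last by rewrite ltry.
  by rewrite AY leeDl// lee_fin cotail_ge0.
have XE : (Wr t - Wr s = fine X)%R.
  apply/EFin_inj; rewrite EFinB W_fin// W_fin// WX (fineK Xfin) [W w s + X]addeC addeK//.
  by rewrite ge0_fin_numE ?W_ge0//; exact: (w_Dp s0).1.
have YE : (A s - A t = fine Y)%R.
  by apply/EFin_inj; rewrite EFinB AY (fineK Yfin) addeK.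
rewrite XE YE -!lee_fin !EFinM (fineK Xfin) (fineK Yfin); apply/andP; split.
  rewrite -(@ge0_integralZl_EFin _ L R lm _ mI _ (fun u Iu => o0 u (IP u Iu))
    (measurable_funS mP IP mo) _ (powR_ge0 _ _)).
  apply: (@ge0_le_integral _ L R lm _ mI).
  - by move=> u /IP /o0 ?; rewrite mule_ge0// lee_fin powR_ge0.
  - by apply: measurable_funeM; exact: measurable_funS mP IP mo.
  - exact: measurable_funS mP IP mw.
  - move=> u Iu; have u0 := lt0_itv (IP u Iu); rewrite -EFinM lee_fin /tail_density powRN.
    rewrite mulrA ler_piMl//; first exact: w_ge0 w_weight _ (IP _ Iu).
    rewrite ler_pdivrMr ?powR_gt0// mul1r ge0_ler_powR// ?nnegrE ?ltW//.
    by move: Iu; rewrite /I /= in_itv/= => /andP[].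
rewrite -(@ge0_integralZl_EFin _ L R lm _ mI _ (fun u Iu => o0 u (IP u Iu))
  (measurable_funS mP IP mo) _ (powR_ge0 _ _)).
apply: (@ge0_le_integral _ L R lm _ mI).
- by move=> u /IP /w0.
- exact: measurable_funS mP IP mw.
- by apply: measurable_funeM; exact: measurable_funS mP IP mo.
- move=> u Iu; have u0 := lt0_itv (IP u Iu); rewrite -EFinM lee_fin /tail_density powRN.
  rewrite mulrA ler_peMl//; first exact: w_ge0 w_weight _ (IP _ Iu).
  rewrite ler_pdivlMr ?powR_gt0// mul1r ge0_ler_powR// ?nnegrE ?(ltW u0) ?(ltW t0)//.
  by move: Iu; rewrite /I /= in_itv/= => /andP[].
Qed.

(* The [p]-th power of the norm of the indicator of [0, t]. *)
Definition fundamental t : R := (Wr t + t `^ p * A t)%R.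
Notation U := fundamental.

Lemma fundamental_ge0 t : (0 < t)%R -> (0 <= U t)%R.
Proof. by move=> t0; rewrite addr_ge0 ?primitive_ge0// mulr_ge0 ?powR_ge0// cotail_ge0. Qed.

Lemma le_primitive s t : (0 < s)%R -> (s <= t)%R -> (Wr s <= Wr t)%R.
Proof.
move=> s0 st; rewrite -lee_fin !W_fin//; last exact: lt_le_trans st.
apply: (@ge0_subset_integral _ L R lm).
- exact: lebesgue_itv_measurable.
- exact: lebesgue_itv_measurable.
- apply: measurable_funS half_line_measurable _ _.
    by move=> u; rewrite /half_line /= !in_itv/= andbT => /andP[].
  exact/measurable_EFinP/w_weight.1.
- move=> u; rewrite /= in_itv/= => /andP[u0 _].
  by rewrite lee_fin w_weight.2// /half_line/= in_itv/= u0.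
- move=> u; rewrite /= !in_itv/= => /andP[-> us]/=; exact: le_trans st.
Qed.

Lemma le_cotail s t : (0 < s)%R -> (s <= t)%R -> (A t <= A s)%R.
Proof.
move=> s0 st; rewrite -lee_fin (cotail_split s0 st) leeDr//.
by apply: integral_ge0 => u; rewrite /= in_itv/= => /andP[su _];
  apply: EFin_tail_density_ge0; rewrite //= in_itv/= andbT (lt_trans s0).
Qed.

Lemma le_powR_base (s t q : R) : (0 <= q)%R -> (0 < s)%R -> (s <= t)%R -> (s `^ q <= t `^ q)%R.
Proof.
move=> q0 s0 st; rewrite ge0_ler_powR// ?nnegrE ?(ltW s0)//.
by rewrite ltW// (lt_le_trans s0).
Qed.

Lemma le_fundamental s t : (0 < s)%R -> (s <= t)%R -> (U s <= U t)%R.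
Proof.
move=> s0 st; have t0 := lt_le_trans s0 st; rewrite /U.
have /andP[h1 _] := primitive_cotail_itv s0 st.
have h2 : (0 <= (t `^ p - s `^ p) * A t)%R.
  by rewrite mulr_ge0 ?cotail_ge0// subr_ge0 le_powR_base.
lra.
Qed.

(** The terms in A (2 t) cancel. As t^p A t is U t (1 - a t), this is growth by at most the factor 1
    + C (1 - a t). *)
Lemma fundamental_double t : (0 < t)%R ->
  (U (2 * t) <= U t + ((2 : R) `^ p - 1) * (t `^ p * A t))%R.
Proof.
move=> t0; have t2 : (t <= 2 * t)%R by lra.
have /andP[_ h1] := primitive_cotail_itv t0 t2; move: h1.
rewrite /U powRM ?(ltW t0)// => h1; lra.
Qed.

Lemma fundamental_quasiconcave s t : (0 < s)%R -> (s <= t)%R ->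
  (s `^ p * U t <= t `^ p * U s)%R.
Proof.
move=> s0 st; have t0 := lt_le_trans s0 st; rewrite /U.
have /andP[_ h1] := primitive_cotail_itv s0 st.
have h2 : (0 <= (t `^ p - s `^ p) * Wr s)%R.
  by rewrite mulr_ge0 ?primitive_ge0// subr_ge0 le_powR_base.
have h3 := ler_wpM2l (powR_ge0 s p) h1.
lra.
Qed.

(** Divided by U (2 t), this bounds the growth of t^p / U t by the ratio [a] at the later point 2 t;
    hence the shift in the products a(t) (1 - a(2t)). *)
Lemma fundamental_double_lower t : (0 < t)%R ->
  ((2 : R) `^ p * U t <= U (2 * t) + ((2 : R) `^ p - 1) * Wr (2 * t))%R.
Proof.
move=> t0; have t2 : (t <= 2 * t)%R by lra.
have /andP[h1 _] := primitive_cotail_itv t0 t2.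
have h2 := ler_wpM2l (powR_ge0 (2 : R) p) h1; move: h2.
rewrite /U powRM ?(ltW t0)// => h2; lra.
Qed.

(** * Behaviour at infinity for weights of infinite integral *)

Hypothesis Woo : \int[leb R]_(s in `[0%R, +oo[) (w s)%:E = +oo.

Lemma primitive_unbounded M : exists n : nat, (M < Wr n.+1%:R)%R.
Proof.
pose F n : set L := `[0%R, (n.+1%:R)%R : R]%classic.
have mD : @measurable _ L D := half_line_measurable.
have FD n : F n `<=` D.
  by move=> u; rewrite /F /half_line /= !in_itv/= andbT => /andP[].
have mF n : measurable (F n) := lebesgue_itv_measurable _.
have ndF : nondecreasing_seq F.
  move=> n m nm; apply/subsetPset => u; rewrite /F /= !in_itv/= => /andP[-> un]/=.
  by apply: le_trans un _; rewrite ler_nat.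
have FU : \bigcup_n F n = D.
  apply/seteqP; split => [u [n _ /FD//]|u]; rewrite /half_line/= in_itv/= andbT => u0.
  exists (Num.bound u) => //; rewrite /F /= in_itv/= u0/=.
  by apply: le_trans (ltW (archi_boundP u0)) _; rewrite ler_nat.
have mwD : lmeas D (fun s => (w s)%:E) by exact/measurable_EFinP/w_weight.1.
have mf n : measurable_fun (F n) (fun s => (w s)%:E) := measurable_funS mD (FD n) mwD.
have f0 n s : F n s -> 0 <= (w s)%:E by move=> /FD Ds; rewrite lee_fin w_weight.2.
have cF := @ge0_nondecreasing_set_cvg_integral _ L R F _ lm ndF mF mf f0.
apply: contrapT => nt.
have : limn (fun n => \int[lm]_(s in F n) (w s)%:E) <= M%:E.
  apply: lime_le; first by apply/cvg_ex; eexists; exact: cF.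
  apply: nearW => n; rewrite -[leLHS]W_fin// lee_fin leNgt; apply/negP => h.
  by apply: nt; exists n.
by rewrite (cvg_lim _ cF)// FU [X in X <= _]Woo leye_eq.
Qed.

Lemma cotail_small e : (0 < e)%R -> exists n : nat, (A n.+1%:R < e)%R.
Proof.
move=> e0.
pose F n : set L := `]1%R, (n.+1%:R)%R : R]%classic.
pose E : set R := `]1%R, +oo[%classic.
have EP : E `<=` P.
  by move=> u; rewrite /E /= !in_itv/= !andbT; apply: lt_trans.
have FE n : F n `<=` E by move=> u; rewrite /F /E /= !in_itv/= andbT => /andP[].
have mF n : measurable (F n) := lebesgue_itv_measurable _.
have ndF : nondecreasing_seq F.
  move=> n m nm; apply/subsetPset => u; rewrite /F /= !in_itv/= => /andP[-> un]/=.
  by apply: le_trans un _; rewrite ler_nat.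
have FU : \bigcup_n F n = E.
  apply/seteqP; split => [u [n _ /FE//]|u]; rewrite /E/= in_itv/= andbT => u1.
  have u0 : (0 <= u)%R by lra.
  exists (Num.bound u) => //; rewrite /F /= in_itv/= u1/=.
  by apply: le_trans (ltW (archi_boundP u0)) _; rewrite ler_nat.
have mo := measurable_EFin_tail_density p w_weight; have o0 := EFin_tail_density_ge0 p w_weight.
have mf n : measurable_fun (F n) (fun s => (tail_density p w s)%:E).
  exact: measurable_funS mP (subset_trans (FE n) EP) mo.
have f0 n s : F n s -> 0 <= (tail_density p w s)%:E by move=> /FE/EP/o0.
have cF := @ge0_nondecreasing_set_cvg_integral _ L R F _ lm ndF mF mf f0.
apply: contrapT => nt.
have : limn (fun n => \int[lm]_(s in F n) (tail_density p w s)%:E) <= (A 1 - e)%:E.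
  apply: lime_le; first by apply/cvg_ex; eexists; exact: cF.
  apply: nearW => n; rewrite EFinB leeBrDr//.
  have n1 : (1 <= n.+1%:R :> R)%R by rewrite ler1n.
  rewrite (cotail_split ltr01 n1); apply: leeD2l; rewrite lee_fin leNgt; apply/negP => h.
  by apply: nt; exists n.
rewrite (cvg_lim _ cF)// FU -integral_open_tail// -tail_fin// lee_fin; lra.
Qed.

(** If it vanished at [t], so would [W] and the tail integral there, and [W] could not grow after
    [t]. *)
Lemma fundamental_gt0 t : (0 < t)%R -> (0 < U t)%R.
Proof.
move=> t0; rewrite lt_def fundamental_ge0// andbT; apply/negP => /eqP U0.
have w0 := primitive_ge0 t; have a0 := cotail_ge0 t0.
have tp0 : (0 < t `^ p)%R by rewrite powR_gt0.
have ta0 := mulr_ge0 (ltW tp0) a0.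
have Wt : (Wr t = 0)%R by move: U0; rewrite /U; lra.
have : (t `^ p * A t = 0)%R by move: U0; rewrite /U; lra.
move=> /eqP; rewrite mulf_eq0 (gt_eqF tp0)/= => /eqP At.
have [n hn] := primitive_unbounded 0%R.
have n0 : (0 < n.+1%:R :> R)%R by [].
have [nt|tn] := leP (n.+1%:R) t.
  by have := le_primitive n0 nt; rewrite Wt leNgt hn.
have /andP[_ h] := primitive_cotail_itv t0 (ltW tn).
have A0 := cotail_ge0 n0.
have : (n.+1%:R `^ p * A n.+1%:R >= 0)%R by rewrite mulr_ge0 ?powR_ge0.
move: h; rewrite Wt At; lra.
Qed.

(** * The dual weight on dyadic intervals *)

Variable p' : R.
Hypothesis p'_gt1 : ((1 : R) < p')%R.
Hypothesis pp' : (p' * p = p' + p)%R.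
Notation v := (dual_weight p p' w).

Lemma dual_weightE t : (0 < t)%R ->
  v t = (t `^ (p' - 1) * Wr t * (t `^ p * A t) / U t `^ (p' + 1))%R.
Proof. by move=> t0; rewrite /dual_weight fine_Wp. Qed.

Lemma dual_weight_ge0 t : (0 < t)%R -> (0 <= v t)%R.
Proof.
move=> t0; rewrite dual_weightE// divr_ge0 ?powR_ge0// mulr_ge0//.
  by rewrite mulr_ge0 ?powR_ge0 ?primitive_ge0.
by rewrite mulr_ge0 ?powR_ge0 ?cotail_ge0.
Qed.

Lemma measurable_dual_weight : lmeas P v.
Proof.
have mpow q : lmeas P (fun s : R => s `^ q)%R.
  by apply: measurable_powRL; exact: measurable_itv.
have mW : lmeas P Wr := nondecreasing_measurable_pos le_primitive.
have mA : lmeas P A.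
  have mnA : lmeas P (fun s => - A s)%R.
    by apply: nondecreasing_measurable_pos => s t s0 st; rewrite lerN2 le_cotail.
  have -> : A = (fun s => - (- A s))%R by apply/funext => s; rewrite opprK.
  exact: measurable_funN.
have mtA : lmeas P (fun t => t `^ p * A t)%R by exact: measurable_funM.
have mU : lmeas P U by exact: measurable_funD.
apply: (@eq_measurable_fun _ _ L _ _ (fun t => t `^ (p' - 1) * Wr t * (t `^ p * A t) * U t
  `^ (- (p' + 1)))%R).
  by move=> t; rewrite inE => /lt0_itv t0; rewrite dual_weightE// powRN.
apply: measurable_funM.
  by apply: measurable_funM => //; exact: measurable_funM.
exact: (measurableT_comp (@measurable_powR R (- (p' + 1))) mU).
Qed.

Definition weight_ratio t : R := (Wr t / U t)%R.

Lemma weight_ratio_itv t : (0 < t)%R -> (0 <= weight_ratio t <= 1)%R.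
Proof.
move=> t0; have U0 := fundamental_gt0 t0.
rewrite divr_ge0 ?primitive_ge0 ?(ltW U0)//= ler_pdivrMr// mul1r lerDl.
by rewrite mulr_ge0 ?powR_ge0 ?cotail_ge0.
Qed.

Lemma one_minus_weight_ratio t : (0 < t)%R -> (U t * (1 - weight_ratio t) = t `^ p * A t)%R.
Proof.
move=> t0; have U0 := fundamental_gt0 t0.
by rewrite mulrBr mulr1 /weight_ratio mulrCA mulfV ?gt_eqF// mulr1 /U addrAC subrr add0r.
Qed.

(** On ]t, 2t] each monotone factor of [v] is replaced by its value at the worse end point.
    Quasiconcavity bounds U (2 t) by a multiple of t^p, and p (p' - 1) = p' makes the powers of [t]
    cancel. *)
Lemma dual_weight_double : exists2 c : R, (0 < c)%R & forall t : R, (1 <= t)%R ->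
  (c * (weight_ratio t * (1 - weight_ratio (2 * t))))%:E <= \int[lm]_(s in `]t, (2 *
    t)%R]%classic) (v s)%:E.
Proof.
have q0 : (0 <= p' - 1)%R by have := p'_gt1; lra.
have U10 := fundamental_gt0 ltr01.
have two0 : (0 < (2 : R) `^ p)%R by rewrite powR_gt0.
pose K : R := (((2 : R) `^ p * U 1) `^ (p' - 1))%R.
have K0 : (0 < K)%R by rewrite powR_gt0// mulr_gt0.
(* One factor 2^p comes from (2 t)^p in 1 - a(2t), one from U (2 t) <= 2^p U t, and [K] from the
   bound of U (2 t)^(p'-1). *)
exists ((2 : R) `^ p * (2 : R) `^ p * K)^-1%R; first by rewrite invr_gt0 !mulr_gt0.
move=> t t1; have t0 : (0 < t)%R by lra.
have T0 : (0 < 2 * t)%R by lra.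
have tT : (t <= 2 * t)%R by lra.
have T1 : (1 <= 2 * t)%R by lra.
have Ut0 := fundamental_gt0 t0; have UT0 := fundamental_gt0 T0.
have tp0 : (0 < t `^ p)%R by rewrite powR_gt0.
have t0' := ltW t0; have UT0' := ltW UT0.
have UTt : (U (2 * t) <= (2 : R) `^ p * U t)%R.
  have := fundamental_quasiconcave t0 tT; rewrite powRM//.
  by rewrite mulrAC mulrC ler_pM2r.
have Q : (U (2 * t) `^ (p' - 1) <= K * t `^ p')%R.
  have -> : (t `^ p' = (t `^ p) `^ (p' - 1))%R.
    rewrite -powRrM; congr (_ `^ _)%R; have := pp'; lra.
  have B0 : (0 <= (2 : R) `^ p * U 1)%R by rewrite ltW// mulr_gt0.
  rewrite -powRM ?(ltW tp0)// ge0_ler_powR// ?nnegrE ?mulr_ge0 ?(ltW tp0) ?(ltW U10)//.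
  have := fundamental_quasiconcave ltr01 T1.
  by rewrite powR1 mul1r powRM// mulrAC.
pose m : R := (t `^ (p' - 1) * Wr t * (t `^ p * A (2 * t)) / U (2 * t) `^ (p' + 1))%R.
have inv_le (x y : R) : (0 < x)%R -> (x <= y)%R -> (y^-1 <= x^-1)%R.
  by move=> x0 xy; rewrite lef_pV2 ?posrE ?(lt_le_trans x0).
have m1 : (0 <= t `^ (p' - 1) * Wr t * (t `^ p * A (2 * t)))%R.
  apply: mulr_ge0; apply: mulr_ge0;
    [exact: powR_ge0|exact: primitive_ge0|exact: powR_ge0|exact: cotail_ge0].
have m0 : (0 <= m)%R by apply: divr_ge0; [exact: m1|exact: powR_ge0].
pose I : set L := `]t, (2 * t)%R]%classic.
have mI : measurable I := lebesgue_itv_measurable _.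
have IP : I `<=` P by move=> u; rewrite /I /= !in_itv/= andbT => /andP[/(lt_trans t0)].
have mtE : (m * t)%:E <= \int[lm]_(s in I) (v s)%:E.
  have -> : (m * t)%:E = \int[lm]_(s in I) (m%:E).
    rewrite (@integral_cst _ L R lm _ mI) EFinM; congr (_ * _).
    rewrite [RHS](@lebesgue_measure_itv R `]t, (2 * t)%R]) /= lte_fin.
    by rewrite ltr_pMl// ltr1n -EFinB; congr EFin; lra.
  apply: (@ge0_le_integral _ L R lm _ mI).
  - by move=> s _; rewrite lee_fin.
  - exact: measurable_cst.
  - by apply: measurable_funS mP IP _; exact/measurable_EFinP/measurable_dual_weight.
  - move=> s Is; have s0 := lt0_itv (IP s Is).
    move: Is; rewrite /I /= in_itv/= => /andP[/ltW ts sT].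
    rewrite lee_fin (dual_weightE s0) /m; apply: ler_pM.
    + exact: m1.
    + by rewrite invr_ge0; exact: powR_ge0.
    + apply: ler_pM; [by apply: mulr_ge0; [exact: powR_ge0|exact: primitive_ge0]
        |by apply: mulr_ge0; [exact: powR_ge0|exact: cotail_ge0]| |].
      * apply: ler_pM; [exact: powR_ge0|exact: primitive_ge0|exact: le_powR_base|].
        exact: le_primitive.
      * apply: ler_pM; [exact: powR_ge0|exact: cotail_ge0|exact: le_powR_base|].
        exact: le_cotail.
    + have Us0 := fundamental_gt0 s0.
      have q1 : (0 <= p' + 1)%R by have := p'_gt1; lra.
      apply: inv_le; first exact: powR_gt0.
      by apply: (le_powR_base q1 Us0); exact: le_fundamental.
apply: le_trans mtE; rewrite lee_fin.
have Q0 : (0 < U (2 * t) `^ (p' - 1))%R by rewrite powR_gt0.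
have r1 : (1 - weight_ratio (2 * t) = (2 : R) `^ p * t `^ p * A (2 * t) / U (2 * t))%R.
  by rewrite -powRM// -one_minus_weight_ratio// mulrAC mulfV ?mul1r// gt_eqF.
have UTE : (U (2 * t) `^ (p' + 1) = U (2 * t) * (U (2 * t) * U (2 * t) `^ (p' - 1)))%R.
  rewrite mulr_powRB1//; last by have := p'_gt1; lra.
  have -> : (U (2 * t) * U (2 * t) `^ p' = U (2 * t) * U (2 * t) `^ (p' + 1 - 1))%R by
    rewrite addrK.
  by rewrite mulr_powRB1//; have := p'_gt1; lra.
have tpE : (t * t `^ (p' - 1) = t `^ p')%R.
  by rewrite mulr_powRB1//; have := p'_gt1; lra.
pose X : R := (Wr t * (t `^ p * A (2 * t)))%R.
have X0 : (0 <= X)%R.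
  apply: mulr_ge0; first exact: primitive_ge0.
  by apply: mulr_ge0; [exact: powR_ge0|exact: cotail_ge0].
have -> : (m * t = X * (t `^ p' / (U (2 * t) * (U (2 * t) * U (2 * t) `^ (p' - 1)))))%R.
  by rewrite /m UTE -tpE /X; ring.
rewrite r1 /weight_ratio.
have -> : (((2 : R) `^ p * (2 : R) `^ p * K)^-1 *
    (Wr t / U t * ((2 : R) `^ p * t `^ p * A (2 * t) / U (2 * t))) =
  X * (((2 : R) `^ p * (2 : R) `^ p * K)^-1 * (2 : R) `^ p / U t / U (2 * t)))%R.
  by rewrite /X; ring.
apply: ler_wpM2l => //.
rewrite ler_pdivlMr ?mulr_gt0//.
move: Q UTt Q0 K0 two0 UT0 Ut0 {UTE r1 m m0 m1}.
have : (0 < t `^ p')%R by rewrite powR_gt0.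
move: (t `^ p')%R (U (2 * t)) (U t) ((2 : R) `^ p)%R K (U (2 * t) `^ (p' - 1))%R => P' UT
  Ut B K Q P0 hQ hU Q0 K0 B0 UT0 Ut0.
have -> : ((B * B * K)^-1 * B / Ut / UT * (UT * (UT * Q)) = (UT * Q) / (B * Ut * K))%R.
  field; rewrite !gt_eqF//.
rewrite ler_pdivrMr ?mulr_gt0//.
have := ler_pM (ltW UT0) (ltW Q0) hU hQ.
by rewrite mulrCA mulrAC => /le_trans; apply; rewrite le_eqVlt; apply/orP; left; apply/eqP;
  ring.
Qed.

Lemma fundamental_unbounded M : exists k : nat, (M < U (2 ^+ k))%R.
Proof.
have [n hn] := primitive_unbounded M; exists n.+1; apply: lt_le_trans hn _.
have n0 : (0 < n.+1%:R :> R)%R by [].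
have n2 : (n.+1%:R <= 2 ^+ n.+1 :> R)%R by rewrite -natrX ler_nat ltnW// ltn_expl.
apply: le_trans (le_primitive n0 n2) _; rewrite /U lerDl mulr_ge0 ?powR_ge0//.
by rewrite cotail_ge0// exprn_gt0.
Qed.

(** For s <= t, U t <= W s + t^p A s. First fix [s] with A s < 1 / (2 M), then take [t] so large
    that t^p > 2 M W s. *)
Lemma inv_fundamental_unbounded M : exists k : nat, (M < (2 ^+ k) `^ p / U (2 ^+ k))%R.
Proof.
wlog M0 : M / (0 < M)%R.
  have M1 : (0 < Num.max M 1)%R by rewrite lt_max ltr01 orbT.
  move=> h; have [k hk] := h _ M1.
  by exists k; apply: le_lt_trans hk; rewrite le_max lexx.
have e0 : (0 < (2 * M)^-1)%R by rewrite invr_gt0 mulr_gt0.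
have [n hn] := cotail_small e0.
pose s : R := n.+1%:R; have s0 : (0 < s)%R by [].
have Ws := primitive_ge0 s.
have [k kn kb] : exists2 k, (n < k)%N & (Num.bound (2 * M * Wr s) <= k)%N.
  by exists (maxn n.+1 (Num.bound (2 * M * Wr s))); rewrite ?leq_maxl ?leq_maxr.
exists k.
have t1 : (1 <= 2 ^+ k :> R)%R by rewrite exprn_ege1// ler1n.
have t0 : (0 < 2 ^+ k :> R)%R by rewrite exprn_gt0.
have kt : (k%:R <= 2 ^+ k :> R)%R by rewrite -natrX ler_nat ltnW// ltn_expl.
have st : (s <= 2 ^+ k)%R.
  by apply: le_trans kt; rewrite ler_nat.
have Wt : (2 * M * Wr s < (2 ^+ k) `^ p)%R.
  apply: (@lt_le_trans _ _ (2 ^+ k)%R); last first.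
    by rewrite -[leLHS]powRr1 ?(ltW t0)//; apply: ler_powR => //; exact: ltW.
  have M2 : (0 <= 2 * M * Wr s)%R by rewrite !mulr_ge0// ltW.
  apply: lt_le_trans (archi_boundP M2) _; apply: le_trans kt.
  by rewrite ler_nat.
have tp0 : (0 < (2 ^+ k : R) `^ p)%R by rewrite powR_gt0.
rewrite ltr_pdivlMr ?fundamental_gt0//.
have /andP[_ h] := primitive_cotail_itv s0 st.
have As : (2 * M * A s < 1)%R.
  by move: hn; rewrite -[ltRHS]mul1r ltr_pdivlMr ?mulr_gt0// mulrC.
have h2 : (M * U (2 ^+ k) <= M * (Wr s + (2 ^+ k) `^ p * A s))%R.
  apply: ler_wpM2l; first exact: ltW.
  rewrite /U; move: h.
  move: (Wr (2 ^+ k)%R) (A (2 ^+ k)%R) ((2 ^+ k) `^ p)%R (Wr s) (A s) => a1 a2 a3 a4 a5.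
  by rewrite mulrBr => h; lra.
have h3 : ((2 ^+ k : R) `^ p * (2 * M * A s) < (2 ^+ k) `^ p)%R.
  by rewrite gtr_pMr.
move: h2 h3 Wt.
move: (U (2 ^+ k)%R) ((2 ^+ k) `^ p)%R (Wr s) (A s) => a1 a2 a3 a4 h2 h3 h4.
apply: le_lt_trans h2 _; lra.
Qed.

Lemma integral_dual_weight : \int[leb R]_(s in `]0%R, +oo[) (v s)%:E = +oo.
Proof.
have [c c0 hc] := dual_weight_double.
have z0 k : (0 < 2 ^+ k :> R)%R by rewrite exprn_gt0.
have z1 k : (1 <= 2 ^+ k :> R)%R by rewrite exprn_ege1// ler1n.
have zle (m n : nat) : (m <= n)%N -> (2 ^+ m <= 2 ^+ n :> R)%R.
  by move=> mn; rewrite ler_eXn2l// ltr1n.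
have C0 : (0 <= (2 : R) `^ p - 1)%R.
  rewrite subr_ge0 -[leLHS](powRr0 2); apply: ler_powR => //.
  by rewrite ler1n.
(* The constant 2^p - 1 is the one of both doubling estimates, read along the points 2^k. *)
have cross := @unbounded_crossing_sum R (fun k => weight_ratio (2 ^+ k)%R) (fun k => U (2
  ^+ k)%R)
  (fun k => (2 ^+ k) `^ p / U (2 ^+ k))%R ((2 : R) `^ p - 1)%R (fun k => weight_ratio_itv
    (z0 k)) C0
  (fun k => fundamental_ge0 (z0 k)).
have {}cross : forall B : R, exists n, (B < \sum_(k < n) weight_ratio (2 ^+ k) * (1 -
  weight_ratio (2 ^+ k.+1)))%R.
  apply: cross.
  - by move=> k; rewrite divr_ge0 ?powR_ge0 ?fundamental_ge0.
  - by move=> m n mn; apply: le_fundamental => //; exact: zle.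
  - move=> m n mn; rewrite ler_pdivrMr ?fundamental_gt0// mulrAC.
    by rewrite ler_pdivlMr ?fundamental_gt0// fundamental_quasiconcave// zle.
  - move=> k; rewrite exprS; apply: le_trans (fundamental_double (z0 k)) _.
    rewrite -(one_minus_weight_ratio (z0 k)) le_eqVlt; apply/orP; left; apply/eqP; ring.
  - move=> k; rewrite exprS.
    have U1 := fundamental_gt0 (z0 k).
    have z2 : (0 < 2 * 2 ^+ k :> R)%R by rewrite mulr_gt0.
    have U2 := fundamental_gt0 z2.
    have z0' := ltW (z0 k).
    have := fundamental_double_lower (z0 k).
    rewrite /weight_ratio powRM//; have : (0 < (2 ^+ k : R) `^ p)%R by rewrite powR_gt0.
    move: U1 U2; move: (U (2 ^+ k)%R) (U (2 * 2 ^+ k)%R) (Wr (2 * 2 ^+ k)%R) ((2 : R) `^ p)%R.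
    move: ((2 ^+ k : R) `^ p)%R => z u1 u2 w2 B u10 u20 zp h.
    have -> : (z / u1 * (1 + (B - 1) * (w2 / u2)) = (u2 + (B - 1) * w2) * (z / (u1 * u2)))%R.
      by field; rewrite !gt_eqF.
    have -> : (B * z / u2 = B * u1 * (z / (u1 * u2)))%R by field; rewrite !gt_eqF.
    by apply: ler_wpM2r => //; rewrite divr_ge0 ?mulr_ge0 ?ltW.
  - exact: fundamental_unbounded.
  - exact: inv_fundamental_unbounded.
have mv : lmeas P (fun s => (v s)%:E) by exact/measurable_EFinP/measurable_dual_weight.
have v0 s : P s -> 0 <= (v s)%:E by move=> /lt0_itv s0; rewrite lee_fin dual_weight_ge0.
have subP n : `]1%R, (2 ^+ n)%R]%classic `<=` P.
  by move=> u; rewrite /= !in_itv/= andbT => /andP[/(lt_trans ltr01)].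
have sumle n : (c * \sum_(k < n) weight_ratio (2 ^+ k) * (1 - weight_ratio (2 ^+ k.+1)))%:E
    <= \int[lm]_(s in `]1%R, (2 ^+ n)%R]%classic) (v s)%:E.
  elim: n => [|n ih].
    rewrite big_ord0 mulr0; apply: integral_ge0 => s.
    by rewrite /= in_itv/= => /andP[s1 _]; rewrite lee_fin dual_weight_ge0// (lt_trans ltr01).
  have mI : @measurable _ L `]1%R, (2 ^+ n)%R]%classic := lebesgue_itv_measurable _.
  have mI' : @measurable _ L `](2 ^+ n)%R, (2 ^+ n.+1)%R]%classic := lebesgue_itv_measurable _.
  have sE : (`]1%R, (2 ^+ n.+1)%R]%classic : set R) = `]1%R, (2 ^+ n)%R]%classic `|` `](2
    ^+ n)%R, (2 ^+ n.+1)%R]%classic.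
    by rewrite -itv_bndbnd_setU// bnd_simp; [exact: z1|exact: zle].
  have sub := subP n.+1.
  rewrite big_ord_recr/= mulrDr EFinD sE (@ge0_integral_setU _ L R lm _ _ mI mI').
  - apply: leeD; first exact: ih.
    by rewrite exprS; exact: hc.
  - by rewrite -sE; exact: measurable_funS mP sub mv.
  - by rewrite -sE => u /sub/v0.
  - rewrite disj_set2E; apply/eqP/seteqP; split => // u [].
    by rewrite /= !in_itv/= => /andP[_ us] /andP[]; rewrite ltNge us.
apply/eqyP => B B0.
have [n hn] := cross (B / c)%R.
apply: (@le_trans _ _ (c * \sum_(k < n) weight_ratio (2 ^+ k) * (1 - weight_ratio (2 ^+
  k.+1)))%:E).
  by rewrite lee_fin mulrC -ler_pdivrMr// ltW.
apply: le_trans (sumle n) _.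
by apply: (@ge0_subset_integral _ L R lm _ _ (lebesgue_itv_measurable _) mP _ mv v0 (subP n)).
Qed.

End DyadicSum.

Theorem lemma6p4 (R : realType) (p p' : R) (w : R -> R)
  (p_gt1 : (1 < p)%R) (p'_gt1 : (1 < p')%R) (pp' : (p' * p = p' + p)%R)
  (w_weight : weight w) (w_Dp : class_D p w)
  (w_nondeg : forall t : R, (0 < t)%R ->
     \int[leb R]_(s in `[0%R, t]) (w s * s `^ (- p))%:E = +oo) :
  reflexive_space (Gamma p w) (Gamma_norm p w) <->
  (\int[leb R]_(s in `[0%R, +oo[) (w s)%:E = +oo /\
   \int[leb R]_(s in `]0%R, +oo[) (dual_weight p p' w s)%:E = +oo).
Proof.
split=> [[oc _]|[Woo _]].
  have Woo := order_continuous_integral_weight p_gt1 w_weight w_nondeg oc.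
  by split=> //; exact: integral_dual_weight.
split; first exact: Gamma_order_continuous.
exact: associate_Gamma_order_continuous.
Qed.
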